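(* Let $T$ be a complete, consistent $\mathcal L$-theory such that $T\vdash\text{Infinity}$. The following are equivalent: (I) $T\vdash\mathrm{MOST}+\Delta_0^{\mathcal P}\text{-collection}$; (II) there is an $\mathcal L$-structure $\mathcal M\models\mathrm{MOST}$ and a non-trivial automorphism $j:\mathcal M\to\mathcal M$ such that $\mathcal I_{\mathrm{fix}}(j)\models T$.
   Context: $\mathcal{L}$ is the language with one binary relation $\in$. $\mathrm{Mac}$: extensionality, pairing, emptyset, union, infinity, powerset, transitive containment, $\Delta_0$-separation, set foundation, and ''every set can be well-ordered''. $\mathrm{MOST}=\mathrm{Mac}+\Sigma_1$-separation$+\Delta_0$-collection. $\Delta_0^{\mathcal P}$-collection is the collection scheme restricted to formulae built from atomic formulae using connectives and bounded quantifiers $\exists x\in y,\forall x\in y,\exists x\subseteq y,\forall x\subseteq y$. For an automorphism $j$ of $\mathcal M$, $\mathcal I_{\mathrm{fix}}(j)$ is the substructure of $\mathcal M$ with domain $\{x\in M: j(y)=y\text{ for all }y\in M\text{ with }\mathcal M\models y\in\mathrm{TC}(\{x\})\}$, transitive closure computed in $\mathcal M$. Non-trivial means not the identity. *)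

(* Defs.v *)
From Stdlib Require Import List FinFun.
Import ListNotations.

(** * Formulae of the language with equality and one binary relation

    Variables are de Bruijn indices.  The language has no function symbols, so
    every term is a variable and substitution is renaming. *)

Inductive form : Type :=
| Fal : form
| Eq  : nat -> nat -> form
| Mem : nat -> nat -> form
| Imp : form -> form -> form
| And : form -> form -> form
| Or  : form -> form -> form
| All : form -> form
| Ex  : form -> form.

Definition Not (a : form) : form := Imp a Fal.
Definition Iff (a b : form) : form := And (Imp a b) (Imp b a).

Definition scons {X : Type} (x : X) (r : nat -> X) (n : nat) : X :=
  match n with
  | 0 => x
  | S k => r k
  end.

Definition up (r : nat -> nat) : nat -> nat := scons 0 (fun n => S (r n)).

Fixpoint ren (r : nat -> nat) (a : form) : form :=
  match a with
  | Fal => Fal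
  | Eq m n => Eq (r m) (r n)
  | Mem m n => Mem (r m) (r n)
  | Imp a b => Imp (ren r a) (ren r b)
  | And a b => And (ren r a) (ren r b)
  | Or a b => Or (ren r a) (ren r b)
  | All a => All (ren (up r) a)
  | Ex a => Ex (ren (up r) a)
  end.

Definition shift : form -> form := ren S.

(* [inst t a] replaces variable 0 by [t] and lowers the other variables. *)
Definition inst (t : nat) : form -> form := ren (scons t (fun n => n)).

Fixpoint closed_at (n : nat) (a : form) : Prop :=
  match a with
  | Fal => True
  | Eq k l => k < n /\ l < n
  | Mem k l => k < n /\ l < n
  | Imp a b => closed_at n a /\ closed_at n b
  | And a b => closed_at n a /\ closed_at n b
  | Or a b => closed_at n a /\ closed_at n b
  | All a => closed_at (S n) a
  | Ex a => closed_at (S n) a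
  end.

Definition sentence (a : form) : Prop := closed_at 0 a.

Fixpoint alls (n : nat) (a : form) : form :=
  match n with
  | 0 => a
  | S k => All (alls k a)
  end.

(** * Provability: classical natural deduction with equality *)

Inductive prf : list form -> form -> Prop :=
| prf_ctx A a : In a A -> prf A a
| prf_impI A a b : prf (a :: A) b -> prf A (Imp a b)
| prf_impE A a b : prf A (Imp a b) -> prf A a -> prf A b
| prf_contra A a : prf (Not a :: A) Fal -> prf A a
| prf_andI A a b : prf A a -> prf A b -> prf A (And a b)
| prf_andE1 A a b : prf A (And a b) -> prf A a
| prf_andE2 A a b : prf A (And a b) -> prf A b
| prf_orI1 A a b : prf A a -> prf A (Or a b)
| prf_orI2 A a b : prf A b -> prf A (Or a b)
| prf_orE A a b c :
    prf A (Or a b) -> prf (a :: A) c -> prf (b :: A) c -> prf A c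
| prf_allI A a : prf (map shift A) a -> prf A (All a)
| prf_allE A a t : prf A (All a) -> prf A (inst t a)
| prf_exI A a t : prf A (inst t a) -> prf A (Ex a)
| prf_exE A a b :
    prf A (Ex a) -> prf (a :: map shift A) (shift b) -> prf A b
| prf_eq_refl A t : prf A (Eq t t)
| prf_eq_subst A a s t : prf A (Eq s t) -> prf A (inst s a) -> prf A (inst t a).

Definition is_theory (T : form -> Prop) : Prop :=
  forall a, T a -> sentence a.

Definition proves (T : form -> Prop) (a : form) : Prop :=
  exists A : list form, (forall b, In b A -> T b) /\ prf A a.

Definition proves_all (T U : form -> Prop) : Prop :=
  forall a, U a -> proves T a.

Definition consistent (T : form -> Prop) : Prop := ~ proves T Fal.

Definition complete (T : form -> Prop) : Prop :=
  forall a, sentence a -> proves T a \/ proves T (Not a).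

(** * Formula classes *)

Definition Sub (m n : nat) : form := All (Imp (Mem 0 (S m)) (Mem 0 (S n))).

(* Bounded quantifiers: the bound variable is 0 in [a], the bound [n] is a
   variable of the outer scope. *)
Definition AllIn (n : nat) (a : form) : form := All (Imp (Mem 0 (S n)) a).
Definition ExIn (n : nat) (a : form) : form := Ex (And (Mem 0 (S n)) a).
Definition AllSub (n : nat) (a : form) : form := All (Imp (Sub 0 (S n)) a).
Definition ExSub (n : nat) (a : form) : form := Ex (And (Sub 0 (S n)) a).

Inductive Delta0 : form -> Prop :=
| Delta0_fal : Delta0 Fal
| Delta0_eq m n : Delta0 (Eq m n)
| Delta0_mem m n : Delta0 (Mem m n)
| Delta0_imp a b : Delta0 a -> Delta0 b -> Delta0 (Imp a b)
| Delta0_and a b : Delta0 a -> Delta0 b -> Delta0 (And a b)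
| Delta0_or a b : Delta0 a -> Delta0 b -> Delta0 (Or a b)
| Delta0_allIn n a : Delta0 a -> Delta0 (AllIn n a)
| Delta0_exIn n a : Delta0 a -> Delta0 (ExIn n a).

Inductive Sigma1 : form -> Prop :=
| Sigma1_Delta0 a : Delta0 a -> Sigma1 a
| Sigma1_ex a : Sigma1 a -> Sigma1 (Ex a).

Inductive Delta0P : form -> Prop :=
| Delta0P_fal : Delta0P Fal
| Delta0P_eq m n : Delta0P (Eq m n)
| Delta0P_mem m n : Delta0P (Mem m n)
| Delta0P_imp a b : Delta0P a -> Delta0P b -> Delta0P (Imp a b)
| Delta0P_and a b : Delta0P a -> Delta0P b -> Delta0P (And a b)
| Delta0P_or a b : Delta0P a -> Delta0P b -> Delta0P (Or a b)
| Delta0P_allIn n a : Delta0P a -> Delta0P (AllIn n a)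
| Delta0P_exIn n a : Delta0P a -> Delta0P (ExIn n a)
| Delta0P_allSub n a : Delta0P a -> Delta0P (AllSub n a)
| Delta0P_exSub n a : Delta0P a -> Delta0P (ExSub n a).

(** * Axioms *)

Definition Empty (m : nat) : form := All (Not (Mem 0 (S m))).

Definition Trans (m : nat) : form := AllIn m (Sub 0 (S m)).

(* m = {a, b} *)
Definition IsPair (m a b : nat) : form :=
  All (Iff (Mem 0 (S m)) (Or (Eq 0 (S a)) (Eq 0 (S b)))).

(* m = (a, b) = {{a}, {a, b}} *)
Definition IsOPair (m a b : nat) : form :=
  Ex (Ex (And (IsPair 1 (S (S a)) (S (S a)))
         (And (IsPair 0 (S (S a)) (S (S b)))
              (IsPair (S (S m)) 1 0)))).

(* (a, b) ∈ r *)
Definition Rel (r a b : nat) : form := ExIn r (IsOPair 0 (S a) (S b)).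

(* m = a ∪ {a} *)
Definition IsSucc (m a : nat) : form :=
  All (Iff (Mem 0 (S m)) (Or (Mem 0 (S a)) (Eq 0 (S a)))).

Definition ax_ext : form :=
  All (All (Imp (All (Iff (Mem 0 2) (Mem 0 1))) (Eq 1 0))).

Definition ax_empty : form := Ex (Empty 0).

Definition ax_pair : form := All (All (Ex (IsPair 0 2 1))).

Definition ax_union : form :=
  All (Ex (All (Iff (Mem 0 1) (ExIn 2 (Mem 1 0))))).

Definition ax_power : form :=
  All (Ex (All (Iff (Mem 0 1) (Sub 0 2)))).

Definition ax_infinity : form :=
  Ex (And (ExIn 0 (Empty 0)) (AllIn 0 (ExIn 1 (IsSucc 0 1)))).

(* ∀x ∃y (x ⊆ y ∧ y is transitive) *)
Definition ax_tco : form := All (Ex (And (Sub 1 0) (Trans 0))).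

Definition ax_foundation : form :=
  All (Imp (Ex (Mem 0 1)) (ExIn 0 (AllIn 0 (Not (Mem 0 2))))).

(* r is a strict linear order on x, r ⊆ x × x, and every nonempty subset of x
   has an r-least element. *)
Definition WellOrders (r x : nat) : form :=
  And (AllIn r (ExIn (S x) (ExIn (S (S x)) (IsOPair 2 1 0))))
 (And (AllIn x (Not (Rel (S r) 0 0)))
 (And (AllIn x (AllIn (S x) (AllIn (S (S x))
        (Imp (Rel (3 + r) 2 1) (Imp (Rel (3 + r) 1 0) (Rel (3 + r) 2 0))))))
 (And (AllIn x (AllIn (S x)
        (Or (Rel (2 + r) 1 0) (Or (Eq 1 0) (Rel (2 + r) 0 1)))))
      (AllSub x
        (Imp (Ex (Mem 0 1))
             (ExIn 0 (AllIn 1 (Or (Eq 1 0) (Rel (3 + r) 1 0))))))))).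

Definition ax_wo : form := All (Ex (WellOrders 0 1)).

(* The formula is a(x, z1, ..., zn), with x as variable 0 and the parameters z
   as variables 1, ..., n:
   ∀z ∀w ∃y ∀x (x ∈ y <-> x ∈ w ∧ a(x, z)). *)
Definition sep_instance (n : nat) (a : form) : form :=
  alls n (All (Ex (All
    (Iff (Mem 0 1)
         (And (Mem 0 2) (ren (scons 0 (fun k => 3 + k)) a)))))).

Definition separation (G : form -> Prop) (b : form) : Prop :=
  exists n a, G a /\ closed_at (S n) a /\ b = sep_instance n a.

(* The formula is a(x, y, z1, ..., zn), with y as variable 0, x as variable 1
   and the parameters z as variables 2, ..., n + 1:
   ∀z ∀w ((∀x ∈ w) ∃y a(x, y, z) -> ∃c (∀x ∈ w) (∃y ∈ c) a(x, y, z)). *)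
Definition coll_instance (n : nat) (a : form) : form :=
  alls n (All
    (Imp (AllIn 0 (Ex (ren (scons 0 (scons 1 (fun k => 3 + k))) a)))
         (Ex (AllIn 1 (ExIn 1
           (ren (scons 0 (scons 1 (fun k => 4 + k))) a)))))).

Definition collection (G : form -> Prop) (b : form) : Prop :=
  exists n a, G a /\ closed_at (S (S n)) a /\ b = coll_instance n a.

Inductive Mac : form -> Prop :=
| Mac_ext : Mac ax_ext
| Mac_pair : Mac ax_pair
| Mac_empty : Mac ax_empty
| Mac_union : Mac ax_union
| Mac_infinity : Mac ax_infinity
| Mac_power : Mac ax_power
| Mac_tco : Mac ax_tco
| Mac_sep a : separation Delta0 a -> Mac a
| Mac_foundation : Mac ax_foundation
| Mac_wo : Mac ax_wo.

Inductive MOST : form -> Prop :=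
| MOST_Mac a : Mac a -> MOST a
| MOST_sep a : separation Sigma1 a -> MOST a
| MOST_coll a : collection Delta0 a -> MOST a.

Definition theory_union (T U : form -> Prop) (a : form) : Prop := T a \/ U a.

(** * Structures and satisfaction *)

(* Nonemptiness is part of [models], so that substructures on arbitrary domains
   can be formed without proof obligations. *)
Record structure : Type := Structure {
  dom :> Type;
  mem : dom -> dom -> Prop
}.

Arguments mem {s} _ _.

Fixpoint sat (M : structure) (v : nat -> M) (a : form) : Prop :=
  match a with
  | Fal => False
  | Eq m n => v m = v n
  | Mem m n => mem (v m) (v n)
  | Imp a b => sat M v a -> sat M v b
  | And a b => sat M v a /\ sat M v b
  | Or a b => sat M v a \/ sat M v b
  | All a => forall x : M, sat M (scons x v) a
  | Ex a => exists x : M, sat M (scons x v) a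
  end.

Definition models (M : structure) (T : form -> Prop) : Prop :=
  inhabited M /\ forall a, T a -> forall v : nat -> M, sat M v a.

Definition substructure (M : structure) (P : M -> Prop) : structure :=
  Structure {x : M | P x} (fun x y => mem (proj1_sig x) (proj1_sig y)).

Definition automorphism (M : structure) (j : M -> M) : Prop :=
  Bijective j /\ forall x y : M, mem x y <-> mem (j x) (j y).

(** * The initial segment fixed pointwise by an automorphism *)

Definition incl_in (M : structure) (x y : M) : Prop :=
  forall z : M, mem z x -> mem z y.

Definition transitive_in (M : structure) (x : M) : Prop :=
  forall y : M, mem y x -> incl_in M y x.

(* t is the transitive closure of s in M *)
Definition is_TC (M : structure) (s t : M) : Prop :=
  transitive_in M t /\ incl_in M s t /\
  forall u : M, transitive_in M u -> incl_in M s u -> incl_in M t u.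

(* M ⊨ y ∈ TC({x}) *)
Definition in_TC_singleton (M : structure) (y x : M) : Prop :=
  exists s t : M, (forall z : M, mem z s <-> z = x) /\ is_TC M s t /\ mem y t.

Definition Ifix (M : structure) (j : M -> M) : structure :=
  substructure M (fun x => forall y : M, in_TC_singleton M y x -> j y = y).

(* Main.v *)
Require Import Defs.
From Stdlib Require Import List Arith Lia ClassicalEpsilon FunctionalExtensionality PropExtensionality Cantor.
Import ListNotations.

(** Call a class of a model of MOST good if it is transitive, contains an inductive set, and is
    closed under pairs, unions, subsets, power sets and transitive images of its elements. A good
    class satisfies MOST: a Löwenheim-Skolem hull followed by a Mostowski collapse brings every
    witness of a Sigma1 statement into a transitive image of a set of the class.

    (II) => (I). A set whose elements lie in [I_fix(j)] lies there, and so does a transitive image of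
    a member [x]: a surjection [f] and [j f] pull membership back to the same relation on [x]. So
    [I_fix(j)] is good. Since its ordinals do not form a set, overspill along an ordinal outside it
    gives Delta0P-collection.

    (I) => (II). Take a countable model [N] of [T] realising countably many prescribed types. By back
    and forth, Delta0P-collection yields a Delta0P-elementary embedding of [N] onto a segment [C] of
    [N] closed under subsets and lying below a decreasing sequence [c_0, c_1, ...] of transitive sets
    such that every ordinal outside [C] maps onto some [c_n]. A chain
    [U_0, U_1, ...] in which [U_(k+1)] contains the subsets and transitive images of [U_k] has a good
    union. A second back and forth, keeping agreement over [c_n] at step [n], gives an automorphism of
    a transitive set containing the chain that fixes [C] pointwise; Cantor's theorem supplies, for
    every [n], two elements of [P(P(c_n))] of the same type over [c_n], so that an element of
    [P(P(c_n))] can be moved, and the fixed segment is exactly [C]. *)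

(** MOST does not prove that power sets can be iterated along an infinite ordinal, so no rank
    hierarchy is at hand. Size replaces rank: the transitive images of a set stand for the sets of
    no larger hereditary size, and an ordinal is compared with a set by asking for a surjection.
    Four families of types are enough, so they are built into the Henkin construction, and no notion
    of computable type is required. Delta0P-collection enters the construction of the embedding at
    one point, the step back to a subset of an old value. The second back and forth compares
    complete types over a set, and truth in the whole model is out of reach for separation. Hence
    everything is placed in one transitive set [W], where truth is a Delta0 condition with [W] as
    parameter. The union of the chain need not be a set, but a code of the chain is the starting
    parameter, so every link is fixed and the map restricts to the union. Agreement shrinks from
    [c_n] to [c_(n+1)] because the traces of an element on [c_(n+1)] are subsets of it, and these
    are elements of [c_n]. *)

Notation "x .: v" := (scons x v) (at level 55, right associativity).

(** * Renaming, satisfaction and soundness *)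

Lemma scons_up {X : Type} (x : X) (v : nat -> X) (r : nat -> nat) :
  (fun k => (x .: v) (up r k)) = (x .: fun k => v (r k)).
Proof. extensionality k; destruct k; reflexivity. Qed.

Lemma scons_eta {X : Type} (v : nat -> X) : (v 0 .: fun k => v (S k)) = v.
Proof. extensionality k; destruct k; reflexivity. Qed.

Lemma scons_map {X Y : Type} (f : X -> Y) (x : X) (v : nat -> X) :
  (fun k => f ((x .: v) k)) = (f x .: fun k => f (v k)).
Proof. extensionality k; destruct k; reflexivity. Qed.

Lemma sat_ren (M : structure) (a : form) : forall (v : nat -> M) (r : nat -> nat),
  sat M v (ren r a) <-> sat M (fun k => v (r k)) a.
Proof.
  induction a as [|m n|m n|a IHa b IHb|a IHa b IHb|a IHa b IHb|a IHa|a IHa];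
    intros v r; cbn.
  1-3: tauto.
  1-3: rewrite IHa, IHb; tauto.
  - split; intros H x; specialize (H x); [rewrite IHa, scons_up in H | rewrite IHa, scons_up]; exact H.
  - split; intros [x H]; exists x; [rewrite IHa, scons_up in H | rewrite IHa, scons_up]; exact H.
Qed.

Lemma sat_closed (M : structure) (a : form) : forall n (v w : nat -> M),
  closed_at n a -> (forall k, k < n -> v k = w k) -> sat M v a <-> sat M w a.
Proof.
  induction a as [|m k|m k|a IHa b IHb|a IHa b IHb|a IHa b IHb|a IHa|a IHa];
    intros n v w Hc H; cbn in *.
  - tauto.
  - destruct Hc; rewrite !H by assumption; tauto.
  - destruct Hc; rewrite !H by assumption; tauto.
  - destruct Hc; rewrite (IHa n v w), (IHb n v w) by assumption; tauto.
  - destruct Hc; rewrite (IHa n v w), (IHb n v w) by assumption; tauto.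
  - destruct Hc; rewrite (IHa n v w), (IHb n v w) by assumption; tauto.
  - assert (E : forall x, sat M (x .: v) a <-> sat M (x .: w) a).
    { intros x; apply (IHa (S n)); [assumption|]; intros [|j] Hj; cbn; [reflexivity|apply H; lia]. }
    split; intros F x; apply E, F.
  - assert (E : forall x, sat M (x .: v) a <-> sat M (x .: w) a).
    { intros x; apply (IHa (S n)); [assumption|]; intros [|j] Hj; cbn; [reflexivity|apply H; lia]. }
    split; intros [x F]; exists x; apply E, F.
Qed.

Lemma closed_at_mono (a : form) : forall n m, n <= m -> closed_at n a -> closed_at m a.
Proof.
  induction a as [|p q|p q|a IHa b IHb|a IHa b IHb|a IHa b IHb|a IHa|a IHa];
    intros n m L; cbn; intros H; try (destruct H; split); eauto; try lia.
  - apply (IHa (S n)); [lia|assumption].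
  - apply (IHa (S n)); [lia|assumption].
Qed.

Lemma closed_at_ex (a : form) : exists n, closed_at n a.
Proof.
  assert (two : forall a b, (exists n, closed_at n a) -> (exists n, closed_at n b) ->
    exists n, closed_at n a /\ closed_at n b).
  { intros x y [n Hn] [m Hm]; exists (n + m); split;
      [apply (closed_at_mono _ n)|apply (closed_at_mono _ m)]; auto; lia. }
  induction a as [|p q|p q|a IHa b IHb|a IHa b IHb|a IHa b IHb|a IHa|a IHa]; cbn.
  - exists 0; exact I.
  - exists (S (p + q)); lia.
  - exists (S (p + q)); lia.
  - apply two; assumption.
  - apply two; assumption.
  - apply two; assumption.
  - destruct IHa as [n H]; exists n; apply (closed_at_mono _ n); auto.
  - destruct IHa as [n H]; exists n; apply (closed_at_mono _ n); auto.
Qed.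

Lemma closed_at_ren (a : form) : forall (r : nat -> nat) b,
  (forall k, r k < b) -> closed_at b (ren r a).
Proof.
  induction a as [|p q|p q|a IHa c IHb|a IHa c IHb|a IHa c IHb|a IHa|a IHa];
    intros r b H; cbn; auto.
  - apply IHa; intros [|k]; cbn; [lia|specialize (H k); lia].
  - apply IHa; intros [|k]; cbn; [lia|specialize (H k); lia].
Qed.

Lemma ren_ext_closed (a : form) : forall n (r s : nat -> nat),
  closed_at n a -> (forall k, k < n -> r k = s k) -> ren r a = ren s a.
Proof.
  induction a as [|p q|p q|a IHa c IHb|a IHa c IHb|a IHa c IHb|a IHa|a IHa];
    intros n r s; cbn; intros Hc H; try destruct Hc; f_equal; eauto.
  - apply (IHa (S n)); [assumption|]; intros [|k] Hk; cbn; [|rewrite H]; lia.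
  - apply (IHa (S n)); [assumption|]; intros [|k] Hk; cbn; [|rewrite H]; lia.
Qed.

Lemma up_up (r s : nat -> nat) : (fun k => up s (up r k)) = up (fun k => s (r k)).
Proof. extensionality k; destruct k; reflexivity. Qed.

Lemma ren_ren (a : form) : forall r s : nat -> nat, ren s (ren r a) = ren (fun k => s (r k)) a.
Proof.
  induction a as [|p q|p q|a IHa c IHb|a IHa c IHb|a IHa c IHb|a IHa|a IHa];
    intros r s; cbn; f_equal; auto; rewrite IHa, up_up; reflexivity.
Qed.

Lemma ren_id (a : form) : ren (fun k => k) a = a.
Proof.
  assert (U : up (fun k => k) = fun k => k) by (extensionality k; destruct k; reflexivity).
  induction a; cbn; rewrite ?U; congruence.
Qed.

Lemma soundness (A : list form) (a : form) : prf A a ->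
  forall (M : structure) (v : nat -> M), (forall b, In b A -> sat M v b) -> sat M v a.
Proof.
  assert (instE : forall (M : structure) (v : nat -> M) t a,
    sat M v (inst t a) <-> sat M (v t .: v) a).
  { intros M v t b; unfold inst; rewrite sat_ren; rewrite scons_map; reflexivity. }
  assert (shiftE : forall (M : structure) (v : nat -> M) x A,
    (forall b, In b A -> sat M v b) -> forall b, In b (map shift A) -> sat M (x .: v) b).
  { intros M v x B H b Hb; apply in_map_iff in Hb as [c [<- Hc]].
    unfold shift; rewrite sat_ren; apply H; assumption. }
  induction 1 as [A a H|A a b H IH|A a b H IH H1 IH1|A a H IH|A a b H IH H1 IH1|A a b H IH
    |A a b H IH|A a b H IH|A a b H IH|A a b c H IH H1 IH1 H2 IH2|A a H IH|A a t H IH|A a t H IH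
    |A a b H IH H1 IH1|A t|A a s t H IH H1 IH1]; intros M v HA; cbn in *.
  - auto.
  - intros Ha; apply IH; intros c [<-|Hc]; auto.
  - apply (IH M v HA), (IH1 M v HA).
  - apply NNPP; intros N; apply (IH M v); intros c [<-|Hc]; auto.
  - split; [apply (IH M v HA)|apply (IH1 M v HA)].
  - apply (IH M v HA).
  - apply (IH M v HA).
  - left; apply (IH M v HA).
  - right; apply (IH M v HA).
  - destruct (IH M v HA); [apply IH1|apply IH2]; intros d [<-|Hd]; auto.
  - intros x; apply IH, shiftE, HA.
  - apply instE, (IH M v HA).
  - exists (v t); apply instE, (IH M v HA).
  - destruct (IH M v HA) as [x Hx].
    specialize (IH1 M (x .: v)); unfold shift in IH1; rewrite sat_ren in IH1.
    apply IH1; intros c [<-|Hc]; [assumption|exact (shiftE M v x A HA c Hc)].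
  - reflexivity.
  - rewrite instE; rewrite <- (IH M v HA); apply instE, (IH1 M v HA).
Qed.

Lemma models_proves (T : form -> Prop) (M : structure) (a : form) :
  models M T -> proves T a -> forall v : nat -> M, sat M v a.
Proof. intros [_ H] [A [HA Ha]] v; apply (soundness A a Ha); auto. Qed.

(** * Satisfaction relativised to a class *)

Fixpoint satR (M : structure) (K : M -> Prop) (v : nat -> M) (a : form) : Prop :=
  match a with
  | Fal => False
  | Eq m n => v m = v n
  | Mem m n => mem (v m) (v n)
  | Imp a b => satR M K v a -> satR M K v b
  | And a b => satR M K v a /\ satR M K v b
  | Or a b => satR M K v a \/ satR M K v b
  | All a => forall x : M, K x -> satR M K (x .: v) a
  | Ex a => exists x : M, K x /\ satR M K (x .: v) a
  end.

Lemma sat_substructure (M : structure) (K : M -> Prop) (a : form) :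
  forall v : nat -> substructure M K,
  sat (substructure M K) v a <-> satR M K (fun k => proj1_sig (v k)) a.
Proof.
  induction a as [|m n|m n|a IHa b IHb|a IHa b IHb|a IHa b IHb|a IHa|a IHa];
    intros v; cbn.
  - tauto.
  - split; [congruence|]; intros H; destruct (v m), (v n); cbn in *; subst; f_equal.
    apply proof_irrelevance.
  - tauto.
  - rewrite IHa, IHb; tauto.
  - rewrite IHa, IHb; tauto.
  - rewrite IHa, IHb; tauto.
  - split.
    + intros H x Kx; specialize (H (exist _ x Kx)); rewrite IHa, scons_map in H; exact H.
    + intros H [x Kx]; rewrite IHa, scons_map; apply H, Kx.
  - split.
    + intros [[x Kx] H]; exists x; split; [exact Kx|]; rewrite IHa, scons_map in H; exact H.
    + intros [x [Kx H]]; exists (exist _ x Kx); rewrite IHa, scons_map; exact H.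
Qed.

Lemma satR_ren (M : structure) K (a : form) : forall (v : nat -> M) (r : nat -> nat),
  satR M K v (ren r a) <-> satR M K (fun k => v (r k)) a.
Proof.
  induction a as [|m n|m n|a IHa b IHb|a IHa b IHb|a IHa b IHb|a IHa|a IHa];
    intros v r; cbn.
  1-3: tauto.
  1-3: rewrite IHa, IHb; tauto.
  - split; intros H x Kx; specialize (H x Kx); [rewrite IHa, scons_up in H | rewrite IHa, scons_up]; exact H.
  - split; intros [x [Kx H]]; exists x; (split; [exact Kx|]); [rewrite IHa, scons_up in H | rewrite IHa, scons_up]; exact H.
Qed.

Lemma satR_closed (M : structure) K (a : form) : forall n (v w : nat -> M),
  closed_at n a -> (forall k, k < n -> v k = w k) -> satR M K v a <-> satR M K w a.
Proof.
  induction a as [|m k|m k|a IHa b IHb|a IHa b IHb|a IHa b IHb|a IHa|a IHa];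
    intros n v w Hc H; cbn in *.
  - tauto.
  - destruct Hc; rewrite !H by assumption; tauto.
  - destruct Hc; rewrite !H by assumption; tauto.
  - destruct Hc; rewrite (IHa n v w), (IHb n v w) by assumption; tauto.
  - destruct Hc; rewrite (IHa n v w), (IHb n v w) by assumption; tauto.
  - destruct Hc; rewrite (IHa n v w), (IHb n v w) by assumption; tauto.
  - assert (E : forall x, satR M K (x .: v) a <-> satR M K (x .: w) a).
    { intros x; apply (IHa (S n)); [assumption|]; intros [|j] Hj; cbn; [reflexivity|apply H; lia]. }
    split; intros F x Kx; apply E, F, Kx.
  - assert (E : forall x, satR M K (x .: v) a <-> satR M K (x .: w) a).
    { intros x; apply (IHa (S n)); [assumption|]; intros [|j] Hj; cbn; [reflexivity|apply H; lia]. }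
    split; intros [x [Kx F]]; exists x; (split; [exact Kx|]); apply E, F.
Qed.

(** The bound sits in variable [w], so the result is Delta0 whatever [a] is: truth of an arbitrary
    formula in a set becomes a condition to which separation applies. The index is raised under each
    quantifier to keep pointing at the bound. *)
Fixpoint relf (w : nat) (a : form) : form :=
  match a with
  | Fal => Fal
  | Eq m n => Eq m n
  | Mem m n => Mem m n
  | Imp a b => Imp (relf w a) (relf w b)
  | And a b => And (relf w a) (relf w b)
  | Or a b => Or (relf w a) (relf w b)
  | All a => AllIn w (relf (S w) a)
  | Ex a => ExIn w (relf (S w) a)
  end.

Lemma sat_relf (M : structure) (a : form) : forall w (v : nat -> M),
  sat M v (relf w a) <-> satR M (fun x => mem x (v w)) v a.
Proof.
  induction a as [|m k|m k|a IHa b IHb|a IHa b IHb|a IHa b IHb|a IHa|a IHa];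
    intros w v; cbn.
  1-3: tauto.
  1-3: rewrite IHa, IHb; tauto.
  - split; intros H x Kx; apply (IHa (S w) (x .: v)), H, Kx.
  - split; intros [x [Kx H]]; exists x; (split; [exact Kx|]); apply (IHa (S w) (x .: v)), H.
Qed.

Lemma sat_iso (A B : structure) (f : A -> B) :
  (forall y, exists x, f x = y) -> (forall x y, f x = f y -> x = y) ->
  (forall x y, mem x y <-> mem (f x) (f y)) ->
  forall a (v : nat -> A), sat A v a <-> sat B (fun k => f (v k)) a.
Proof.
  intros Su In Me.
  induction a as [|m k|m k|a IHa b IHb|a IHa b IHb|a IHa b IHb|a IHa|a IHa];
    intros v; cbn.
  - tauto.
  - split; [congruence|apply In].
  - apply Me.
  - rewrite IHa, IHb; tauto.
  - rewrite IHa, IHb; tauto.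
  - rewrite IHa, IHb; tauto.
  - split.
    + intros H y; destruct (Su y) as [x <-]; specialize (H x); rewrite IHa, scons_map in H; exact H.
    + intros H x; rewrite IHa, scons_map; apply H.
  - split.
    + intros [x H]; exists (f x); rewrite IHa, scons_map in H; exact H.
    + intros [y H]; destruct (Su y) as [x <-]; exists x; rewrite IHa, scons_map; exact H.
Qed.

Lemma sat_alls (M : structure) (a : form) n :
  (forall v : nat -> M, sat M v (alls n a)) <-> (forall v : nat -> M, sat M v a).
Proof.
  induction n as [|n IH]; cbn; [tauto|].
  rewrite <- IH; split.
  - intros H v; rewrite <- (scons_eta v); apply H.
  - intros H v x; apply H.
Qed.

Fixpoint bigand (l : list form) : form :=
  match l with [] => Imp Fal Fal | a :: l => And a (bigand l) end.

Fixpoint bigor (l : list form) : form :=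
  match l with [] => Fal | a :: l => Or a (bigor l) end.

Lemma sat_bigand (M : structure) (v : nat -> M) l :
  sat M v (bigand l) <-> forall a, In a l -> sat M v a.
Proof.
  induction l as [|b l IH]; cbn; [tauto|]; rewrite IH; split.
  - intros [H1 H2] a [<-|H]; auto.
  - intros H; split; auto.
Qed.

Lemma sat_bigor (M : structure) (v : nat -> M) l :
  sat M v (bigor l) <-> exists a, In a l /\ sat M v a.
Proof.
  induction l as [|b l IH]; cbn; [firstorder|]; rewrite IH; split.
  - intros [H|[a [H1 H2]]]; eauto.
  - intros [a [[<-|H1] H2]]; eauto.
Qed.

Lemma satR_bigand (M : structure) K (v : nat -> M) l :
  satR M K v (bigand l) <-> forall a, In a l -> satR M K v a.
Proof.
  induction l as [|b l IH]; cbn; [tauto|]; rewrite IH; split.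
  - intros [H1 H2] a [<-|H]; auto.
  - intros H; split; auto.
Qed.

(** * Formula classes *)

Lemma Delta0_ren a : Delta0 a -> forall r, Delta0 (ren r a).
Proof.
  induction 1; intros r; cbn; constructor; auto.
Qed.

Lemma Delta0P_ren a : Delta0P a -> forall r, Delta0P (ren r a).
Proof.
  induction 1; intros r; cbn; constructor; auto.
Qed.

Lemma Delta0_relf a : forall w, Delta0 (relf w a).
Proof. induction a; intros w; cbn; constructor; auto. Qed.

Lemma Delta0P_bigand l : (forall a, In a l -> Delta0P a) -> Delta0P (bigand l).
Proof. induction l; cbn; intros H; repeat constructor; auto. Qed.

Lemma Delta0P_bigor l : (forall a, In a l -> Delta0P a) -> Delta0P (bigor l).
Proof. induction l; cbn; intros H; repeat constructor; auto. Qed.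

Lemma Delta0_abs (M : structure) (K : M -> Prop) :
  (forall x y, K y -> mem x y -> K x) -> forall a, Delta0 a ->
  forall v, (forall k, K (v k)) -> satR M K v a <-> sat M v a.
Proof.
  intros HK; induction 1 as [|m n|m n|a b _ IHa _ IHb|a b _ IHa _ IHb|a b _ IHa _ IHb|n a _ IH|n a _ IH];
    intros v Hv; cbn; try tauto.
  - rewrite IHa, IHb by assumption; tauto.
  - rewrite IHa, IHb by assumption; tauto.
  - rewrite IHa, IHb by assumption; tauto.
  - assert (L : forall x, mem x (v n) -> forall k, K ((x .: v) k)).
    { intros x Hx [|k]; cbn; [apply (HK _ (v n))|]; auto. }
    split.
    + intros H x Hx; apply IH; [apply L, Hx|apply H; [apply (HK _ (v n)); auto|exact Hx]].
    + intros H x Kx Hx; apply IH; [apply L, Hx|apply H, Hx].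
  - assert (L : forall x, mem x (v n) -> forall k, K ((x .: v) k)).
    { intros x Hx [|k]; cbn; [apply (HK _ (v n))|]; auto. }
    split.
    + intros [x [Kx [Hx H]]]; exists x; split; [exact Hx|]; apply IH; [apply L, Hx|exact H].
    + intros [x [Hx H]]; exists x; split; [apply (HK _ (v n)); auto|]; split; [exact Hx|].
      apply IH; [apply L, Hx|exact H].
Qed.

(** A witness stays a witness in a larger class, and the Delta0 matrix has the same value in every
    transitive class containing its parameters. *)
Lemma Sigma1_up (M : structure) (K L : M -> Prop) :
  (forall x y, K y -> mem x y -> K x) -> (forall x y, L y -> mem x y -> L x) ->
  (forall x, K x -> L x) -> forall a, Sigma1 a ->
  forall v, (forall k, K (v k)) -> satR M K v a -> satR M L v a.
Proof.
  intros HK HL KL; induction 1 as [a Ha|a _ IH]; intros v Hv H.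
  - apply (Delta0_abs M L HL a Ha); [auto|]; apply (Delta0_abs M K HK a Ha); auto.
  - destruct H as [x [Kx H]]; exists x; split; [auto|]; apply IH; [|exact H].
    intros [|k]; cbn; auto.
Qed.

Lemma satR_True (M : structure) a : forall v, satR M (fun _ => True) v a <-> sat M v a.
Proof.
  induction a as [|m k|m k|a IHa b IHb|a IHa b IHb|a IHa b IHb|a IHa|a IHa]; intros v; cbn.
  1-3: tauto.
  1-3: rewrite IHa, IHb; tauto.
  - split; [intros H x; apply IHa, H; exact I|intros H x _; apply IHa, H].
  - split; [intros [x [_ H]]; exists x; apply IHa, H|intros [x H]; exists x; split; [exact I|apply IHa, H]].
Qed.

(** * Enumerations *)

Fixpoint list_stage (n : nat) : list (list nat) :=
  match n with
  | 0 => [[]]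
  | S n => list_stage n ++
      flat_map (fun l => map (fun k => k :: l) (seq 0 (S n))) (list_stage n)
  end.

Fixpoint form_stage (n : nat) : list form :=
  match n with
  | 0 => [Fal]
  | S n =>
    let L := form_stage n in
    L ++ flat_map (fun i => flat_map (fun j => [Eq i j; Mem i j]) (seq 0 (S n))) (seq 0 (S n))
      ++ flat_map (fun a => flat_map (fun b => [Imp a b; And a b; Or a b]) L) L
      ++ flat_map (fun a => [All a; Ex a]) L
  end.

Lemma stage_mono {X} (F : nat -> list X) : (forall n x, In x (F n) -> In x (F (S n))) ->
  forall n m x, n <= m -> In x (F n) -> In x (F m).
Proof. intros H n m x L; induction L; auto. Qed.

Lemma list_stage_all (l : list nat) : exists n, In l (list_stage n).
Proof.
  assert (S1 : forall n x, In x (list_stage n) -> In x (list_stage (S n))).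
  { intros n x H; cbn; apply in_or_app; auto. }
  induction l as [|k l [n IH]]; [exists 0; cbn; auto|].
  exists (S (n + k)); cbn [list_stage]; apply in_or_app; right; apply in_flat_map; exists l; split.
  - apply (stage_mono list_stage S1 n); [lia|assumption].
  - apply in_map_iff; exists k; split; [reflexivity|apply in_seq; lia].
Qed.

Lemma form_stage_all (a : form) : exists n, In a (form_stage n).
Proof.
  assert (S1 : forall n x, In x (form_stage n) -> In x (form_stage (S n))).
  { intros n x H; cbn [form_stage]; apply in_or_app; auto. }
  assert (two : forall a b, (exists n, In a (form_stage n)) -> (exists n, In b (form_stage n)) ->
    exists n, In a (form_stage n) /\ In b (form_stage n)).
  { intros x y [n Hn] [m Hm]; exists (n + m); split;
      [apply (stage_mono form_stage S1 n)|apply (stage_mono form_stage S1 m)]; auto; lia. }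
  induction a as [|p q|p q|a IHa b IHb|a IHa b IHb|a IHa b IHb|a IHa|a IHa].
  - exists 0; cbn; auto.
  - exists (S (p + q)); cbn [form_stage]; apply in_or_app; right; apply in_or_app; left.
    apply in_flat_map; exists p; split; [apply in_seq; lia|].
    apply in_flat_map; exists q; split; [apply in_seq; lia|cbn; auto].
  - exists (S (p + q)); cbn [form_stage]; apply in_or_app; right; apply in_or_app; left.
    apply in_flat_map; exists p; split; [apply in_seq; lia|].
    apply in_flat_map; exists q; split; [apply in_seq; lia|cbn; auto].
  - destruct (two _ _ IHa IHb) as [n [Ha Hb]]; exists (S n); cbn [form_stage].
    do 2 (apply in_or_app; right); apply in_or_app; left.
    apply in_flat_map; exists a; split; [assumption|]; apply in_flat_map; exists b; cbn; auto.
  - destruct (two _ _ IHa IHb) as [n [Ha Hb]]; exists (S n); cbn [form_stage].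
    do 2 (apply in_or_app; right); apply in_or_app; left.
    apply in_flat_map; exists a; split; [assumption|]; apply in_flat_map; exists b; cbn; auto.
  - destruct (two _ _ IHa IHb) as [n [Ha Hb]]; exists (S n); cbn [form_stage].
    do 2 (apply in_or_app; right); apply in_or_app; left.
    apply in_flat_map; exists a; split; [assumption|]; apply in_flat_map; exists b; cbn; auto.
  - destruct IHa as [n H]; exists (S n); cbn [form_stage].
    do 3 (apply in_or_app; right); apply in_flat_map; exists a; cbn; auto.
  - destruct IHa as [n H]; exists (S n); cbn [form_stage].
    do 3 (apply in_or_app; right); apply in_flat_map; exists a; cbn; auto.
Qed.

(** A number codes a stage together with a position in it; positions past the end give the default
    [d]. *)
Definition enum_of {X} (F : nat -> list X) (d : X) (k : nat) : X :=
  nth (snd (of_nat k)) (F (fst (of_nat k))) d.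

Lemma enum_of_surj {X} (F : nat -> list X) (d : X) :
  (forall x, exists n, In x (F n)) -> forall x, exists k, enum_of F d k = x.
Proof.
  intros H x; destruct (H x) as [n Hn]; destruct (In_nth _ _ d Hn) as [i [_ Hi]].
  exists (to_nat (n, i)); unfold enum_of; rewrite cancel_of_to; exact Hi.
Qed.

Definition form_enum : nat -> form := enum_of form_stage Fal.
Definition list_enum : nat -> list nat := enum_of list_stage [].

Lemma form_enum_surj a : exists k, form_enum k = a.
Proof. apply enum_of_surj, form_stage_all. Qed.

Lemma list_enum_surj l : exists k, list_enum k = l.
Proof. apply enum_of_surj, list_stage_all. Qed.

(** Dependent choice with a stage-dependent step, [Good] being the invariant. The Henkin
    construction, both back-and-forth arguments and the chain are instances. *)
Lemma sequence_of_steps {S : Type} (Good : S -> Prop) (Step : nat -> S -> S -> Prop) (s0 : S) :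
  Good s0 -> (forall n s, Good s -> exists s', Good s' /\ Step n s s') ->
  exists f : nat -> S, f 0 = s0 /\ forall n, Good (f n) /\ Step n (f n) (f (Datatypes.S n)).
Proof.
  intros H0 H.
  assert (C : forall n (s : {s | Good s}), {s' : {s | Good s} | Step n (proj1_sig s) (proj1_sig s')}).
  { intros n [s Hs]; apply constructive_indefinite_description.
    destruct (H n s Hs) as [s' [G' St]]; exists (exist _ s' G'); exact St. }
  set (g := fix g n := match n with 0 => exist _ s0 H0 | Datatypes.S n => proj1_sig (C n (g n)) end).
  exists (fun n => proj1_sig (g n)); split; [reflexivity|]; intros n; split.
  - apply (proj2_sig (g n)).
  - exact (proj2_sig (C n (g n))).
Qed.

(** * Countable models realising prescribed types *)

Lemma prf_weaken A a : prf A a -> forall B, incl A B -> prf B a.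
Proof.
  assert (C : forall (a : form) A B, incl A B -> incl (a :: A) (a :: B)).
  { intros b X Y H x [<-|Hx]; cbn; auto. }
  induction 1 as [A a H|A a b H IH|A a b H IH H1 IH1|A a H IH|A a b H IH H1 IH1|A a b H IH
    |A a b H IH|A a b H IH|A a b H IH|A a b c H IH H1 IH1 H2 IH2|A a H IH|A a t H IH|A a t H IH
    |A a b H IH H1 IH1|A t|A a s t H IH H1 IH1]; intros B HB.
  - apply prf_ctx; auto.
  - apply prf_impI; auto.
  - apply prf_impE with a; auto.
  - apply prf_contra; auto.
  - apply prf_andI; auto.
  - apply prf_andE1 with b; auto.
  - apply prf_andE2 with a; auto.
  - apply prf_orI1; auto.
  - apply prf_orI2; auto.
  - apply prf_orE with a b; auto.
  - apply prf_allI, IH, incl_map, HB.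
  - apply prf_allE; auto.
  - apply prf_exI with t; auto.
  - apply prf_exE with a; auto; apply IH1, C, incl_map, HB.
  - apply prf_eq_refl.
  - apply prf_eq_subst with s; auto.
Qed.

Lemma ren_shift r b : ren (up r) (shift b) = shift (ren r b).
Proof. unfold shift; rewrite !ren_ren; reflexivity. Qed.

Lemma ren_inst r t a : ren r (inst t a) = inst (r t) (ren (up r) a).
Proof.
  unfold inst; rewrite !ren_ren; f_equal; extensionality k; destruct k; reflexivity.
Qed.

(** This lets a variable that serves as a fresh constant be moved to position 0, where the
    quantifier rules can bind it. *)
Lemma prf_ren A a : prf A a -> forall r, prf (map (ren r) A) (ren r a).
Proof.
  assert (SH : forall r A, map (ren (up r)) (map shift A) = map shift (map (ren r) A)).
  { intros r A0; rewrite !map_map; apply map_ext; intros b; apply ren_shift. }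
  induction 1 as [A a H|A a b H IH|A a b H IH H1 IH1|A a H IH|A a b H IH H1 IH1|A a b H IH
    |A a b H IH|A a b H IH|A a b H IH|A a b c H IH H1 IH1 H2 IH2|A a H IH|A a t H IH|A a t H IH
    |A a b H IH H1 IH1|A t|A a s t H IH H1 IH1]; intros r; cbn in *.
  - apply prf_ctx, in_map, H.
  - apply prf_impI; auto.
  - apply prf_impE with (ren r a); auto.
  - apply prf_contra; apply IH.
  - apply prf_andI; auto.
  - apply prf_andE1 with (ren r b); auto.
  - apply prf_andE2 with (ren r a); auto.
  - apply prf_orI1; auto.
  - apply prf_orI2; auto.
  - apply prf_orE with (ren r a) (ren r b); auto.
  - apply prf_allI; rewrite <- SH; apply IH.
  - rewrite ren_inst; apply prf_allE; apply IH.
  - apply prf_exI with (r t); rewrite <- ren_inst; apply IH.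
  - apply prf_exE with (ren (up r) a); [apply IH|].
    rewrite <- SH, <- ren_shift; apply IH1.
  - apply prf_eq_refl.
  - rewrite ren_inst; apply prf_eq_subst with (r s); [apply IH|].
    rewrite <- ren_inst; apply IH1.
Qed.

Lemma prf_cut A : forall a B, prf A a -> (forall b, In b A -> prf B b) -> prf B a.
Proof.
  induction A as [|c A IH]; intros a B H HB.
  - apply (prf_weaken _ _ H); intros x [].
  - apply prf_impE with c; [|apply HB; cbn; auto].
    apply IH; [apply prf_impI, H|intros b Hb; apply HB; cbn; auto].
Qed.

Lemma prf_bigand A l : (forall a, In a l -> prf A a) -> prf A (bigand l).
Proof.
  induction l as [|b l IH]; cbn; intros H.
  - apply prf_impI, prf_ctx; cbn; auto.
  - apply prf_andI; auto.
Qed.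

Lemma prf_bigandE A l : prf A (bigand l) -> forall a, In a l -> prf A a.
Proof.
  induction l as [|b l IH]; cbn; intros H a []; subst.
  - apply prf_andE1 with (bigand l), H.
  - apply IH; [apply prf_andE2 with b, H|assumption].
Qed.

Lemma proves_mono (S S' : form -> Prop) a :
  (forall b, S b -> S' b) -> proves S a -> proves S' a.
Proof. intros H [A [HA Ha]]; exists A; split; auto. Qed.

Lemma proves_in (S : form -> Prop) a : S a -> proves S a.
Proof.
  intros H; exists [a]; split; [intros b [<-|[]]; exact H|apply prf_ctx; cbn; auto].
Qed.

Lemma proves_cut (S : form -> Prop) A a :
  prf A a -> (forall b, In b A -> proves S b) -> proves S a.
Proof.
  intros H HA.
  assert (G : forall l, incl l A -> exists B, (forall b, In b B -> S b) /\ forall b, In b l -> prf B b).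
  { induction l as [|c l IH]; intros L.
    - exists []; split; intros b [].
    - destruct IH as [B [HB Hl]]; [intros x Hx; apply L; cbn; auto|].
      destruct (HA c) as [C [HC Hc]]; [apply L; cbn; auto|].
      exists (C ++ B); split.
      + intros b Hb; apply in_app_or in Hb as []; auto.
      + intros b [<-|Hb]; [apply (prf_weaken _ _ Hc)|apply (prf_weaken _ _ (Hl b Hb))];
          intros x Hx; apply in_or_app; auto. }
  destruct (G A (incl_refl A)) as [B [HB Hl]]; exists B; split; [exact HB|].
  apply (prf_cut A); assumption.
Qed.

Definition add (S : form -> Prop) (a : form) (b : form) : Prop := S b \/ b = a.

Lemma proves_add (S : form -> Prop) a b : proves (add S a) b -> proves S (Imp a b).
Proof.
  intros [A [HA Hb]].
  assert (G : exists B, (forall c, In c B -> S c) /\ incl A (a :: B)).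
  { clear Hb; induction A as [|c A IH]; [exists []; split; intros x []|].
    destruct IH as [B [HB L]]; [intros x Hx; apply HA; cbn; auto|].
    destruct (HA c) as [Hc| ->]; [cbn; auto| |].
    - exists (c :: B); split; [intros x [<-|Hx]; auto|].
      intros x [<-|Hx]; cbn; auto; destruct (L x Hx); auto.
    - exists B; split; auto; intros x [<-|Hx]; [cbn; auto|apply L, Hx]. }
  destruct G as [B [HB L]]; exists B; split; [exact HB|].
  apply prf_impI, (prf_weaken _ _ Hb _ L).
Qed.

Lemma consistent_split S a : consistent S ->
  consistent (add S a) \/ (consistent (add S (Not a)) /\ proves S (Not a)).
Proof.
  intros HS; destruct (classic (consistent (add S a))) as [H|H]; [left; exact H|right].
  apply NNPP, proves_add in H; split; [|exact H].
  intros F; apply proves_add in F; apply HS.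
  apply (proves_cut S [Imp a Fal; Imp (Not a) Fal]).
  - apply prf_impE with (Not a); apply prf_ctx; cbn; auto.
  - intros b [<-|[<-|[]]]; assumption.
Qed.

Section Henkin.
Context (T : form -> Prop) (T_theory : is_theory T) (T_con : consistent T).
Context (G : list nat -> nat -> form) (g : list nat -> nat)
  (G_closed : forall j k, closed_at (S (g j)) (G j k)).

(** Free variables play the part of Henkin constants, and [closed_at n] says that only constants
    below [n] occur. For fresh [n], this renaming sends [n] to 0 and acts as [shift] on everything
    else. *)
Definition swap (n k : nat) : nat := if k =? n then 0 else S k.

Lemma ren_swap n a : closed_at n a -> ren (swap n) a = shift a.
Proof.
  intros H; apply (ren_ext_closed a n); [exact H|]; intros k Hk; unfold swap.
  replace (k =? n) with false; [reflexivity|]; symmetry; apply Nat.eqb_neq; lia.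
Qed.

Lemma map_ren_swap n A : (forall a, In a A -> closed_at n a) -> map (ren (swap n)) A = map shift A.
Proof. intros H; apply map_ext_in; intros a Ha; apply ren_swap, H, Ha. Qed.

Definition asg (l : list nat) (i : nat) : nat := nth i l 0.
Definition tyf (j l : list nat) (t k : nat) : form := ren (t .: asg l) (G j k).
(** Finite satisfiability of type [j] up to [K], as one formula; the refutation of such a formula is
    the only excuse for omitting the type. *)
Definition tyE (j l : list nat) (K : nat) : form :=
  Ex (bigand (map (fun k => ren (0 .: fun i => S (asg l i)) (G j k)) (seq 0 K))).

(** A contradiction from [inst n a] with [n] fresh becomes, after [swap], a derivation from [a] with
    variable 0 free, which existential elimination turns into a contradiction from [Ex a]. *)
Lemma witness_consistent (S : form -> Prop) n a :
  (forall b, S b -> closed_at n b) -> S (Ex a) -> consistent S -> consistent (add S (inst n a)).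
Proof.
  intros HS Ha HC F; apply proves_add in F as [A [HA F]]; apply HC.
  exists (Ex a :: A); split; [intros b [<-|Hb]; auto|].
  apply prf_exE with a; [apply prf_ctx; cbn; auto|].
  apply (prf_ren _ _) with (r := swap n) in F; cbn in F.
  rewrite map_ren_swap in F by auto.
  replace (ren (swap n) (inst n a)) with a in F.
  - apply prf_impE with a; [|apply prf_ctx; cbn; auto].
    apply (prf_weaken _ _ F); intros x Hx; cbn; auto.
  - unfold inst; rewrite ren_ren; rewrite <- (ren_id a) at 1.
    apply (ren_ext_closed a (Datatypes.S n)); [apply (HS _ Ha)|].
    intros [|k] Hk; cbn; unfold swap; [rewrite Nat.eqb_refl; reflexivity|].
    replace (k =? n) with false; [reflexivity|]; symmetry; apply Nat.eqb_neq; lia.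
Qed.

(** If realising the type by the fresh variable [n] is inconsistent, the contradiction uses finitely
    many of its formulae; quantifying [n] away refutes their joint solvability. *)
Lemma type_consistent (S : form -> Prop) n j l :
  (forall b, S b -> closed_at n b) -> (forall i, asg l i < n) -> consistent S ->
  consistent (fun b => S b \/ exists k, b = tyf j l n k) \/
  exists K, proves S (Not (tyE j l K)).
Proof.
  intros HS Hl HC.
  destruct (classic (consistent (fun b => S b \/ exists k, b = tyf j l n k))) as [H|H]; [auto|right].
  apply NNPP in H as [A [HA F]].
  assert (Q : exists B K, (forall b, In b B -> S b) /\ incl A (map (tyf j l n) (seq 0 K) ++ B)).
  { clear F; induction A as [|c A IH]; [exists (@nil form), 0; split; intros x Hx; destruct Hx|].
    destruct IH as [B [K [HB L]]]; [intros x Hx; apply HA; cbn; auto|].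
    destruct (HA c) as [Hc|[k ->]]; [cbn; auto| |].
    - exists (c :: B), K; split; [intros x [<-|Hx]; auto|].
      intros x [<-|Hx]; apply in_or_app; [right; cbn; auto|].
      apply L, in_app_or in Hx as [Hx|Hx]; [left|right; right]; exact Hx.
    - exists B, (K + Datatypes.S k); split; [exact HB|].
      intros x [<-|Hx]; apply in_or_app.
      + left; apply in_map, in_seq; lia.
      + apply L, in_app_or in Hx as [Hx|Hx]; [left|auto].
        apply in_map_iff in Hx as [m [<- Hm]]; apply in_map; apply in_seq in Hm; apply in_seq; lia. }
  destruct Q as [B [K [HB L]]]; exists K, B; split; [exact HB|].
  apply (prf_weaken _ _ F) in L; clear F; rename L into F.
  apply (prf_ren _ _) with (r := swap n) in F; rewrite map_app, (map_ren_swap n B) in F by auto.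
  apply prf_impI, prf_exE with (bigand (map (fun k => ren (0 .: fun i => Datatypes.S (asg l i)) (G j k)) (seq 0 K)));
    [apply prf_ctx; cbn; auto|].
  cbn in F; cbn; apply (prf_cut _ _ _ F); intros b Hb; apply in_app_or in Hb as [Hb|Hb];
    [|apply prf_ctx; cbn; auto].
  rewrite map_map in Hb; apply in_map_iff in Hb as [k [<- Hk]].
  eapply prf_bigandE; [apply prf_ctx; cbn; left; reflexivity|].
  apply in_map_iff; exists k; split; [|exact Hk].
  unfold tyf; rewrite ren_ren; f_equal; extensionality i; unfold swap.
  destruct i as [|i]; cbn; [rewrite Nat.eqb_refl; reflexivity|].
  specialize (Hl i); replace (asg l i =? n) with false; [reflexivity|]; symmetry; apply Nat.eqb_neq; lia.
Qed.

Definition hgood (s : (form -> Prop) * nat) : Prop :=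
  consistent (fst s) /\ (forall b, fst s b -> closed_at (snd s) b) /\ (forall b, T b -> fst s b).

Definition hstep (m : nat) (s s' : (form -> Prop) * nat) : Prop :=
  (forall b, fst s b -> fst s' b) /\
  (fst s' (form_enum m) \/ fst s' (Not (form_enum m))) /\
  (forall a, form_enum m = Ex a -> fst s' (Ex a) -> exists t, fst s' (inst t a)) /\
  (let j := list_enum (fst (of_nat m)) in let l := list_enum (snd (of_nat m)) in
   (exists t, forall k, fst s' (tyf j l t k)) \/ exists K, proves (fst s') (Not (tyE j l K))).

Lemma asg_bound l : exists n, forall i, asg l i < n.
Proof.
  induction l as [|x l [n IH]]; [exists 1; intros [|i]; cbn; lia|].
  exists (S (x + n)); intros [|i]; cbn; [lia|]; specialize (IH i); unfold asg in IH; lia.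
Qed.

Lemma hstep_ex m s : hgood s -> exists s', hgood s' /\ hstep m s s'.
Proof.
  destruct s as [S n]; intros [HC [Hn HT]]; cbn in *.
  set (psi := form_enum m).
  destruct (closed_at_ex psi) as [q Hq].
  set (n1 := n + q).
  assert (Hn1 : forall b, S b -> closed_at n1 b).
  { intros b Hb; apply (closed_at_mono _ n); [unfold n1; lia|auto]. }
  assert (Hq1 : closed_at n1 psi) by (apply (closed_at_mono _ q); [unfold n1; lia|auto]).
  assert (Step1 : exists S1, consistent S1 /\ (forall b, S b -> S1 b) /\
    (forall b, S1 b -> closed_at n1 b) /\ (S1 psi \/ S1 (Not psi))).
  { destruct (consistent_split S psi HC) as [H|[H _]].
    - exists (add S psi); unfold add; repeat split; auto; intros b [Hb| ->]; auto.
    - exists (add S (Not psi)); unfold add; repeat split; auto; intros b [Hb| ->]; auto; cbn; auto. }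
  destruct Step1 as [S1 [C1 [L1 [B1 D1]]]].
  assert (Step2 : exists S2, consistent S2 /\ (forall b, S1 b -> S2 b) /\
    (forall b, S2 b -> closed_at (Datatypes.S n1) b) /\
    (forall a, psi = Ex a -> S2 (Ex a) -> exists t, S2 (inst t a))).
  { destruct (classic (exists a, psi = Ex a /\ S1 psi)) as [[a [E H]]|H].
    - exists (add S1 (inst n1 a)); rewrite E in H, Hq1; repeat split.
      + apply witness_consistent; auto.
      + left; assumption.
      + intros b [Hb| ->]; [apply (closed_at_mono _ n1); auto|].
        (* No variable of [inst n1 a] exceeds [n1], so capping variables at [n1] changes nothing and
           shows it closed at [S n1]. *)
        assert (R : inst n1 a = ren (fun k => Nat.min k n1) (inst n1 a)).
        { unfold inst; rewrite ren_ren; apply (ren_ext_closed a (Datatypes.S n1)); [exact Hq1|].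
          intros [|k] Hk; cbn; lia. }
        rewrite R; apply closed_at_ren; intros k; lia.
      + intros a' E' _; rewrite E in E'; injection E' as <-; exists n1; right; reflexivity.
    - exists S1; repeat split; auto.
      + intros b Hb; apply (closed_at_mono _ n1); auto.
      + intros a E H2; exfalso; apply H; exists a; rewrite E; split; [reflexivity|exact H2]. }
  destruct Step2 as [S2 [C2 [L2 [B2 W2]]]].
  set (j := list_enum (fst (of_nat m))); set (l := list_enum (snd (of_nat m))).
  destruct (asg_bound l) as [p Hp].
  set (n2 := Datatypes.S n1 + p).
  assert (B2' : forall b, S2 b -> closed_at n2 b).
  { intros b Hb; apply (closed_at_mono _ (Datatypes.S n1)); [unfold n2; lia|auto]. }
  assert (Hp2 : forall i, asg l i < n2) by (intros i; specialize (Hp i); unfold n2; lia).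
  assert (U : forall S3 : form -> Prop, (forall b, S2 b -> S3 b) ->
     (forall b, S3 b -> S2 b \/ exists k, b = tyf j l n2 k) -> consistent S3 ->
     ((exists t, forall k, S3 (tyf j l t k)) \/ exists K, proves S3 (Not (tyE j l K))) ->
     exists s', hgood s' /\ hstep m (S, n) s').
  { intros S3 L3 R3 C3 Ty; exists (S3, Datatypes.S n2); split.
    - repeat split; cbn; auto.
      intros b Hb; destruct (R3 b Hb) as [Hb2|[k ->]].
      + apply (closed_at_mono _ n2); auto.
      + apply closed_at_ren; intros [|i]; cbn; [lia|]; specialize (Hp2 i); lia.
    - split; [cbn; auto|]; split; [cbn; destruct D1; auto|]; split; [|exact Ty].
      cbn; intros a E Ha; destruct (W2 a E) as [t Ht]; [|eauto].
      destruct D1 as [D1|D1]; [rewrite <- E; auto|exfalso].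
      apply C3; apply (proves_cut S3 [Ex a; Not (Ex a)]).
      + apply prf_impE with (Ex a); apply prf_ctx; cbn; auto.
      + unfold psi in D1; rewrite E in D1.
        intros b [<-|[<-|[]]]; apply proves_in; auto. }
  destruct (type_consistent S2 n2 j l B2' Hp2 C2) as [H|[K H]].
  - apply (U (fun b => S2 b \/ exists k, b = tyf j l n2 k)); auto; left; exists n2; eauto.
  - apply (U S2); auto; right; exists K; exact H.
Qed.

Theorem saturated_model : exists (N : structure) (e : nat -> N),
  (forall x, exists n, e n = x) /\ models N T /\
  forall j (v : nat -> N), (forall K, exists x, forall k, k < K -> sat N (x .: v) (G j k)) ->
    exists x, forall k, sat N (x .: v) (G j k).
Proof.
  destruct (sequence_of_steps hgood hstep (T, 0)) as [f [_ Hf]].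
  { repeat split; cbn; auto. }
  { apply hstep_ex. }
  set (W := fun a => exists n, fst (f n) a).
  assert (mono : forall n m a, n <= m -> fst (f n) a -> fst (f m) a).
  { intros n m a L; induction L; [auto|]; intros H; apply (proj2 (Hf m)); auto. }
  assert (fin : forall A, (forall b, In b A -> W b) -> exists n, forall b, In b A -> fst (f n) b).
  { induction A as [|c A IH]; intros HA; [exists 0; intros b []|].
    destruct IH as [n Hn]; [intros b Hb; apply HA; cbn; auto|].
    destruct (HA c) as [m Hm]; [cbn; auto|]; exists (n + m); intros b [<-|Hb].
    - apply (mono m); [lia|auto].
    - apply (mono n); [lia|auto]. }
  assert (Wcon : consistent W).
  { intros [A [HA F]]; destruct (fin A HA) as [n Hn].
    apply (proj1 (proj1 (Hf n))); exists A; auto. }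
  assert (Wdec : forall a, W a \/ W (Not a)).
  { intros a; destruct (form_enum_surj a) as [m <-].
    destruct (proj1 (proj2 (proj2 (Hf m)))) as [H|H]; [left|right]; exists (S m); exact H. }
  assert (Wnot : forall a, W a -> W (Not a) -> False).
  { intros a H1 H2; apply Wcon; apply (proves_cut W [a; Not a]).
    - apply prf_impE with a; apply prf_ctx; cbn; auto.
    - intros b [<-|[<-|[]]]; apply proves_in; auto. }
  assert (Wprf : forall a, proves W a -> W a).
  { intros a H; destruct (Wdec a) as [|N]; [assumption|exfalso]; apply Wcon.
    apply (proves_cut W [a; Not a]).
    - apply prf_impE with a; apply prf_ctx; cbn; auto.
    - intros b [<-|[<-|[]]]; [exact H|apply proves_in; auto]. }
  assert (W1 : forall a b, prf [a] b -> W a -> W b).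
  { intros a b H Ha; apply Wprf, (proves_cut W [a]); [exact H|].
    intros c [<-|[]]; apply proves_in, Ha. }
  assert (Wimp : forall a b, W (Imp a b) <-> (W a -> W b)).
  { intros a b; split.
    - intros H Ha; apply Wprf, (proves_cut W [Imp a b; a]).
      + apply prf_impE with a; apply prf_ctx; cbn; auto.
      + intros c [<-|[<-|[]]]; apply proves_in; auto.
    - intros H; destruct (Wdec a) as [Ha|Ha].
      + apply (W1 b); [apply prf_impI, prf_ctx; cbn; auto|auto].
      + apply (W1 (Not a)); [|exact Ha].
        apply prf_impI, prf_contra, prf_impE with a; apply prf_ctx; cbn; auto. }
  assert (Wand : forall a b, W (And a b) <-> W a /\ W b).
  { intros a b; split.
    - intros H; split; apply (W1 (And a b)); auto;
        [apply prf_andE1 with b|apply prf_andE2 with a]; apply prf_ctx; cbn; auto.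
    - intros [Ha Hb]; apply Wprf, (proves_cut W [a; b]).
      + apply prf_andI; apply prf_ctx; cbn; auto.
      + intros c [<-|[<-|[]]]; apply proves_in; auto. }
  assert (Wor : forall a b, W (Or a b) <-> W a \/ W b).
  { intros a b; split.
    - intros H; destruct (Wdec a) as [|Ha]; [auto|right].
      apply Wprf, (proves_cut W [Or a b; Not a]).
      + apply prf_orE with a b; [apply prf_ctx; cbn; auto| |apply prf_ctx; cbn; auto].
        apply prf_contra, prf_impE with a; apply prf_ctx; cbn; auto.
      + intros c [<-|[<-|[]]]; apply proves_in; auto.
    - intros [H|H]; apply (W1 _ _) with (2 := H); [apply prf_orI1|apply prf_orI2]; apply prf_ctx; cbn; auto. }
  assert (Wex : forall a, W (Ex a) <-> exists t, W (inst t a)).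
  { intros a; split.
    - intros H; destruct (form_enum_surj (Ex a)) as [m E].
      assert (H' : fst (f (S m)) (Ex a)).
      { destruct (proj1 (proj2 (proj2 (Hf m)))) as [H1|H1]; rewrite E in H1; [exact H1|].
        exfalso; apply (Wnot (Ex a) H); exists (S m); exact H1. }
      destruct (proj1 (proj2 (proj2 (proj2 (Hf m)))) a E H') as [t Ht].
      exists t, (S m); exact Ht.
    - intros [t Ht]; apply (W1 (inst t a)); [|exact Ht]; apply prf_exI with t, prf_ctx; cbn; auto. }
  assert (Wall : forall a, W (All a) <-> forall t, W (inst t a)).
  { intros a; split.
    - intros H t; apply (W1 (All a)); [|exact H]; apply prf_allE, prf_ctx; cbn; auto.
    - intros H; destruct (Wdec (All a)) as [|N]; [assumption|exfalso].
      assert (E : W (Ex (Not a))).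
      { apply (W1 (Not (All a))); [|exact N].
        apply prf_contra, prf_impE with (All a); [apply prf_ctx; cbn; auto|].
        apply prf_allI, prf_contra, prf_impE with (shift (Ex (Not a))); [apply prf_ctx; cbn; auto|].
        apply prf_exI with 0.
        assert (EN : inst 0 (ren (up S) (Not a)) = Not a); [|apply prf_ctx; left; symmetry; exact EN].
        assert (E0 : (fun k => (0 .: fun n => n) (up S k)) = fun k => k)
          by (extensionality k; destruct k; reflexivity).
        unfold inst; rewrite ren_ren, E0, ren_id; reflexivity. }
      apply Wex in E as [t Ht]; apply (Wnot (inst t a) (H t)); exact Ht. }
  assert (Wsub : forall a s t, W (Eq s t) -> W (inst s a) -> W (inst t a)).
  { intros a s t H1 H2; apply Wprf, (proves_cut W [Eq s t; inst s a]).
    - apply prf_eq_subst with s; apply prf_ctx; cbn; auto.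
    - intros c [<-|[<-|[]]]; apply proves_in; auto. }
  assert (Wrefl : forall t, W (Eq t t)) by (intros t; apply Wprf; exists []; split; [intros b []|apply prf_eq_refl]).
  assert (Wsym : forall s t, W (Eq s t) -> W (Eq t s)).
  { intros s t H; apply (Wsub (Eq 0 (S s)) s t H); apply Wrefl. }
  assert (Wtrans : forall s t u, W (Eq s t) -> W (Eq t u) -> W (Eq s u)).
  { intros s t u H1 H2; apply (Wsub (Eq (S s) 0) t u H2); exact H1. }
  (* Each class of provably equal constants is represented by its least member, which avoids a
     quotient. *)
  set (least := fun n => forall m, m < n -> ~ W (Eq m n)).
  assert (Rep : forall n, {m | W (Eq n m) /\ least m}).
  { intros n; apply constructive_indefinite_description.
    induction n as [n IH] using lt_wf_ind.
    destruct (classic (least n)) as [L|L]; [exists n; auto|].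
    apply not_all_ex_not in L as [m L]; apply imply_to_and in L as [L1 L2]; apply NNPP in L2.
    destruct (IH m L1) as [k [K1 K2]]; exists k; split; [|exact K2].
    apply Wtrans with m; auto. }
  set (N := Structure {n | least n} (fun x y => W (Mem (proj1_sig x) (proj1_sig y)))).
  set (e := fun n => exist least (proj1_sig (Rep n)) (proj2 (proj2_sig (Rep n))) : N).
  assert (eEq : forall n m, e n = e m <-> W (Eq n m)).
  { intros n m; unfold e; destruct (Rep n) as [n' [Hn Ln]], (Rep m) as [m' [Hm Lm]]; cbn; split.
    - intros H; apply (f_equal (@proj1_sig _ _)) in H; cbn in H; subst m'; apply Wtrans with n'; auto.
    - intros H; assert (E : n' = m').
      { assert (H' : W (Eq n' m')) by (apply Wtrans with n; [auto|apply Wtrans with m; auto]).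
        destruct (lt_eq_lt_dec n' m') as [[L|L]|L]; [|exact L|].
        - exfalso; apply (Lm _ L); auto.
        - exfalso; apply (Ln _ L); auto. }
      subst m'; f_equal; apply proof_irrelevance. }
  assert (eMem : forall n m, mem (e n) (e m) <-> W (Mem n m)).
  { intros n m; unfold e; destruct (Rep n) as [n' [Hn Ln]], (Rep m) as [m' [Hm Lm]]; cbn; split.
    - intros H; apply (Wsub (Mem 0 (S m)) n' n); [auto|]; apply (Wsub (Mem (S n') 0) m' m); auto.
    - intros H; apply (Wsub (Mem 0 (S m')) n n'); [auto|]; apply (Wsub (Mem (S n) 0) m m'); auto. }
  assert (esurj : forall x : N, exists n, e n = x).
  { intros [n Ln]; exists n; unfold e; destruct (Rep n) as [m [H L]]; cbn.
    assert (E : m = n).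
    { destruct (lt_eq_lt_dec m n) as [[L1|L1]|L1]; [|exact L1|].
      - exfalso; apply (Ln _ L1); auto.
      - exfalso; apply (L _ L1); auto. }
    subst m; f_equal; apply proof_irrelevance. }
  (* Stated for every renaming [r], because the quantifier cases extend [r] by a new value. *)
  assert (truth : forall a (r : nat -> nat), sat N (fun k => e (r k)) a <-> W (ren r a)).
  { induction a as [|m k|m k|a IHa b IHb|a IHa b IHb|a IHa b IHb|a IHa|a IHa]; intros r; cbn [sat ren].
    - split; [tauto|]; intros H; apply Wcon, proves_in, H.
    - apply eEq.
    - apply eMem.
    - rewrite Wimp, IHa, IHb; tauto.
    - rewrite Wand, IHa, IHb; tauto.
    - rewrite Wor, IHa, IHb; tauto.
    - rewrite Wall; split.
      + intros H t; specialize (H (e t)); rewrite <- scons_map in H; apply IHa in H.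
        unfold inst; rewrite ren_ren, scons_up; exact H.
      + intros H x; destruct (esurj x) as [t <-]; rewrite <- scons_map; apply IHa.
        specialize (H t); unfold inst in H; rewrite ren_ren, scons_up in H; exact H.
    - rewrite Wex; split.
      + intros [x H]; destruct (esurj x) as [t <-]; exists t; rewrite <- scons_map in H; apply IHa in H.
        unfold inst; rewrite ren_ren, scons_up; exact H.
      + intros [t H]; exists (e t); rewrite <- scons_map; apply IHa.
        unfold inst in H; rewrite ren_ren, scons_up in H; exact H. }
  exists N, e; split; [exact esurj|]; split.
  - split; [constructor; exact (e 0)|].
    intros a Ta v; apply (sat_closed N a 0 v (fun k => e k)); [apply T_theory, Ta|lia|].
    apply (truth a (fun k => k)); rewrite ren_id; exists 0; apply (proj1 (Hf 0)), Ta.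
  - intros j v Fin.
    (* Only variables below [g j] matter to type [j], so a finite list of constants names the
       relevant parameters. *)
    assert (L : exists l, forall i, i < g j -> v i = e (asg l i)).
    { assert (L' : forall n, exists l, length l = n /\ forall i, i < n -> v i = e (asg l i)).
      { induction n as [|n [l [El Hl]]]; [exists []; split; [reflexivity|lia]|].
        destruct (esurj (v n)) as [t Ht]; exists (l ++ [t]); split; [rewrite length_app; cbn; lia|].
        intros i Hi; unfold asg; destruct (Nat.eq_dec i n) as [->|Ne].
        - rewrite <- El at 2; rewrite nth_middle; auto.
        - rewrite app_nth1 by lia; apply Hl; lia. }
      destruct (L' (g j)) as [l [_ Hl]]; exists l; exact Hl. }
    destruct L as [l Hl].
    destruct (list_enum_surj j) as [mj Ej], (list_enum_surj l) as [ml El].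
    (* The stage treating the pair of [j] and [l] either realised the type or refuted a finite part
       of it; finite satisfiability excludes the second. *)
    pose proof (proj2 (proj2 (proj2 (proj2 (Hf (to_nat (mj, ml))))))) as Ty.
    rewrite cancel_of_to in Ty; cbn in Ty; rewrite Ej, El in Ty.
    assert (tr : forall t k, sat N (e t .: v) (G j k) <-> W (tyf j l t k)).
    { intros t k; unfold tyf; rewrite <- truth, scons_map.
      apply (sat_closed N _ (S (g j))); [apply G_closed|]; intros [|i] Hi; cbn; [reflexivity|apply Hl; lia]. }
    destruct Ty as [[t Ht]|[K HK]].
    + exists (e t); intros k; apply tr; exists (S (to_nat (mj, ml))); apply Ht.
    + exfalso; destruct (Fin K) as [x Hx]; destruct (esurj x) as [t <-].
      apply (Wnot (tyE j l K)).
      * apply Wex; exists t; apply Wprf.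
        replace (inst t (bigand (map (fun k => ren (0 .: fun i => S (asg l i)) (G j k)) (seq 0 K))))
          with (bigand (map (tyf j l t) (seq 0 K))).
        -- apply (proves_cut W (map (tyf j l t) (seq 0 K))).
           ++ apply prf_bigand; intros a Ha; apply prf_ctx, Ha.
           ++ intros b Hb; apply in_map_iff in Hb as [k [<- Hk]]; apply in_seq in Hk.
              apply proves_in, tr, Hx; lia.
        -- generalize (seq 0 K); induction l0 as [|k l0 IH]; [reflexivity|cbn].
           rewrite IH; unfold inst; cbn; f_equal; unfold tyf; rewrite ren_ren; f_equal.
           extensionality i; destruct i; reflexivity.
      * apply Wprf; apply (proves_mono (fst (f (S (to_nat (mj, ml)))))); [|exact HK].
        intros b Hb; exists (S (to_nat (mj, ml))); exact Hb.
Qed.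

End Henkin.

(** * Definable relations *)

Fixpoint ctx (M : structure) (n : nat) : Type :=
  match n with 0 => unit | S n => (ctx M n * M)%type end.

(* Terms are variables of the context or constants satisfying [C]. *)
Fixpoint term {M : structure} (C : M -> Prop) (n : nat) : (ctx M n -> M) -> Prop :=
  match n with
  | 0 => fun t => exists c, C c /\ forall e, t e = c
  | S n => fun t => (forall e, t e = snd e) \/
      exists t', term C n t' /\ forall e, t e = t' (fst e)
  end.

(** Definability with constants from [C], as a property of predicates on contexts. The closure
    lemmas below build the formula, and a tactic applies them, which keeps de Bruijn bookkeeping out
    of most later proofs. [s] says which term each variable stands for. *)
Definition Def {M : structure} (G : form -> Prop) (C : M -> Prop) n (P : ctx M n -> Prop) : Prop :=
  exists a (s : nat -> ctx M n -> M), G a /\ (forall k, term C n (s k)) /\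
    forall e, sat M (fun k => s k e) a <-> P e.

Class fclass (G : form -> Prop) : Prop := {
  fc_fal : G Fal;
  fc_eq : forall m n, G (Eq m n);
  fc_mem : forall m n, G (Mem m n);
  fc_imp : forall a b, G a -> G b -> G (Imp a b);
  fc_and : forall a b, G a -> G b -> G (And a b);
  fc_or : forall a b, G a -> G b -> G (Or a b);
  fc_all : forall n a, G a -> G (AllIn n a);
  fc_ex : forall n a, G a -> G (ExIn n a);
  fc_ren : forall r a, G a -> G (ren r a) }.

Global Instance fclass_Delta0 : fclass Delta0.
Proof. split; try (constructor; auto; fail); intros; apply Delta0_ren; assumption. Qed.

Global Instance fclass_Delta0P : fclass Delta0P.
Proof. split; try (constructor; auto; fail); intros; apply Delta0P_ren; assumption. Qed.

Notation sub := (incl_in _).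
Notation trans := (transitive_in _).

Section Def.
Context {M : structure} {G : form -> Prop} {FG : fclass G} {C : M -> Prop}.

Lemma term_0 n : term C (S n) (fun e => snd e).
Proof. left; reflexivity. Qed.
Lemma term_w1 n t : term C n t -> term C (S n) (fun e => t (fst e)).
Proof. intros H; right; exists t; auto. Qed.
Lemma term_w2 n t : term C n t -> term C (S (S n)) (fun e => t (fst (fst e))).
Proof. intros H; apply (term_w1 (S n) (fun e => t (fst e))), term_w1, H. Qed.
Lemma term_w3 n t : term C n t -> term C (S (S (S n))) (fun e => t (fst (fst (fst e)))).
Proof. intros H; apply (term_w1 (S (S n)) (fun e => t (fst (fst e)))), term_w2, H. Qed.
Lemma term_w4 n t : term C n t -> term C (S (S (S (S n)))) (fun e => t (fst (fst (fst (fst e))))).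
Proof. intros H; apply (term_w1 (S (S (S n))) (fun e => t (fst (fst (fst e))))), term_w3, H. Qed.
Lemma term_w5 n t : term C n t -> term C (S (S (S (S (S n))))) (fun e => t (fst (fst (fst (fst (fst e)))))).
Proof. intros H; apply (term_w1 (S (S (S (S n)))) (fun e => t (fst (fst (fst (fst e)))))), term_w4, H. Qed.
Lemma term_w6 n t : term C n t -> term C (S (S (S (S (S (S n)))))) (fun e => t (fst (fst (fst (fst (fst (fst e))))))).
Proof. intros H; apply (term_w1 (S (S (S (S (S n))))) (fun e => t (fst (fst (fst (fst (fst e))))))), term_w5, H. Qed.
Lemma term_1 n : term C (S (S n)) (fun e => snd (fst e)).
Proof. apply (term_w1 (S n) (fun e => snd e)), term_0. Qed.
Lemma term_2 n : term C (S (S (S n))) (fun e => snd (fst (fst e))).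
Proof. apply (term_w2 (S n) (fun e => snd e)), term_0. Qed.
Lemma term_3 n : term C (S (S (S (S n)))) (fun e => snd (fst (fst (fst e)))).
Proof. apply (term_w3 (S n) (fun e => snd e)), term_0. Qed.
Lemma term_4 n : term C (S (S (S (S (S n))))) (fun e => snd (fst (fst (fst (fst e))))).
Proof. apply (term_w4 (S n) (fun e => snd e)), term_0. Qed.
Lemma term_5 n : term C (S (S (S (S (S (S n)))))) (fun e => snd (fst (fst (fst (fst (fst e)))))).
Proof. apply (term_w5 (S n) (fun e => snd e)), term_0. Qed.
Lemma term_6 n : term C (S (S (S (S (S (S (S n))))))) (fun e => snd (fst (fst (fst (fst (fst (fst e))))))).
Proof. apply (term_w6 (S n) (fun e => snd e)), term_0. Qed.
Lemma term_7 n : term C (S (S (S (S (S (S (S (S n)))))))) (fun e => snd (fst (fst (fst (fst (fst (fst (fst e)))))))).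
Proof. apply (term_w1 (S (S (S (S (S (S (S n))))))) (fun e => snd (fst (fst (fst (fst (fst (fst e)))))))), term_6. Qed.
Lemma term_c n c : C c -> term C n (fun _ => c).
Proof. intros H; induction n; [exists c; auto|]; apply (term_w1 _ (fun _ => c)), IHn. Qed.

Lemma Def_ext n (P Q : ctx M n -> Prop) : (forall e, P e <-> Q e) -> Def G C n P -> Def G C n Q.
Proof.
  intros E [a [s [Ga [Ts H]]]]; exists a, s; split; [exact Ga|]; split; [exact Ts|].
  intros e; rewrite H; apply E.
Qed.

Lemma Def_mem n t s : term C n t -> term C n s -> Def G C n (fun e => mem (t e) (s e)).
Proof.
  intros Ht Hs; exists (Mem 0 1), (t .: fun _ => s); split; [apply fc_mem|]; split.
  - intros [|k]; assumption.
  - intros e; cbn; tauto.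
Qed.

Lemma Def_eq n t s : term C n t -> term C n s -> Def G C n (fun e => t e = s e).
Proof.
  intros Ht Hs; exists (Eq 0 1), (t .: fun _ => s); split; [apply fc_eq|]; split.
  - intros [|k]; assumption.
  - intros e; cbn; tauto.
Qed.

(** The two formulae come with unrelated assignments; sending the variables of one to even and of
    the other to odd positions gives them a common one. *)
Lemma Def_bin n (P Q : ctx M n -> Prop) : Def G C n P -> Def G C n Q ->
  exists a b (s : nat -> ctx M n -> M), G a /\ G b /\ (forall k, term C n (s k)) /\
    forall e, (sat M (fun k => s k e) a <-> P e) /\ (sat M (fun k => s k e) b <-> Q e).
Proof.
  intros [a [s [Ga [Ts Hs]]]] [b [t [Gb [Tt Ht]]]].
  exists (ren (fun k => 2 * k) a), (ren (fun k => S (2 * k)) b).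
  exists (fun k => if Nat.even k then s (Nat.div2 k) else t (Nat.div2 k)).
  split; [apply fc_ren, Ga|]; split; [apply fc_ren, Gb|]; split.
  - intros k; destruct (Nat.even k); auto.
  - intros e; rewrite !sat_ren; split.
    + rewrite <- Hs; assert (E : forall k, Nat.even (2 * k) = true) by (intros; apply Nat.even_spec; exists k; reflexivity).
      replace (fun k => _) with (fun k => s k e); [tauto|].
      extensionality k; rewrite E, Nat.div2_double; reflexivity.
    + rewrite <- Ht.
      assert (E : forall k, Nat.even (S (2 * k)) = false).
      { intros k; rewrite Nat.even_succ, <- Nat.negb_even; replace (Nat.even (2 * k)) with true; [reflexivity|].
        symmetry; apply Nat.even_spec; exists k; reflexivity. }
      replace (fun k => _) with (fun k => t k e); [tauto|].
      extensionality k; rewrite E, Nat.div2_succ_double; reflexivity.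
Qed.

Lemma Def_and n (P Q : ctx M n -> Prop) : Def G C n P -> Def G C n Q -> Def G C n (fun e => P e /\ Q e).
Proof.
  intros HP HQ; destruct (Def_bin n P Q HP HQ) as [a [b [s [Ga [Gb [Ts H]]]]]].
  exists (And a b), s; split; [apply fc_and; auto|]; split; [exact Ts|].
  intros e; cbn; destruct (H e); tauto.
Qed.

Lemma Def_or n (P Q : ctx M n -> Prop) : Def G C n P -> Def G C n Q -> Def G C n (fun e => P e \/ Q e).
Proof.
  intros HP HQ; destruct (Def_bin n P Q HP HQ) as [a [b [s [Ga [Gb [Ts H]]]]]].
  exists (Or a b), s; split; [apply fc_or; auto|]; split; [exact Ts|].
  intros e; cbn; destruct (H e); tauto.
Qed.

Lemma Def_imp n (P Q : ctx M n -> Prop) : Def G C n P -> Def G C n Q -> Def G C n (fun e => P e -> Q e).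
Proof.
  intros HP HQ; destruct (Def_bin n P Q HP HQ) as [a [b [s [Ga [Gb [Ts H]]]]]].
  exists (Imp a b), s; split; [apply fc_imp; auto|]; split; [exact Ts|].
  intros e; cbn; destruct (H e); tauto.
Qed.

Lemma Def_not n (P : ctx M n -> Prop) : Def G C n P -> Def G C n (fun e => ~ P e).
Proof.
  intros [a [s [Ga [Ts H]]]]; exists (Imp a Fal), s; split; [apply fc_imp; auto; apply fc_fal|].
  split; [exact Ts|]; intros e; cbn; rewrite H; tauto.
Qed.

Lemma Def_iff n (P Q : ctx M n -> Prop) : Def G C n P -> Def G C n Q -> Def G C n (fun e => P e <-> Q e).
Proof. intros HP HQ; apply Def_and; apply Def_imp; assumption. Qed.

(** Each term of the larger context is either the bound variable or a term of the smaller one, so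
    variables are redirected to 0 or kept as outer ones. The bound [t] comes first so that a bounded
    quantifier can refer to it as variable 0. *)
Lemma Def_under n (t : ctx M n -> M) (Q : ctx M n -> M -> Prop) : term C n t ->
  Def G C (S n) (fun e => Q (fst e) (snd e)) ->
  exists b (s : nat -> ctx M n -> M), G b /\ (forall k, term C n (s k)) /\ s 0 = t /\
    forall e x, sat M (x .: fun k => s k e) b <-> Q e x.
Proof.
  intros Ht [b [s [Gb [Ts H]]]].
  assert (c : forall k, {p : bool * (ctx M n -> M) | term C n (snd p) /\
     forall e, s k e = if fst p then snd e else snd p (fst e)}).
  { intros k; apply constructive_indefinite_description; destruct (Ts k) as [E|[t' [Tt E]]].
    - exists (true, t); auto.
    - exists (false, t'); auto. }
  exists (ren (fun k => if fst (proj1_sig (c k)) then 0 else S (S k)) b).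
  exists (t .: fun k => snd (proj1_sig (c k))).
  split; [apply fc_ren, Gb|]; split.
  { intros [|k]; [exact Ht|]; apply (proj1 (proj2_sig (c k))). }
  split; [reflexivity|]; intros e x; rewrite sat_ren.
  pose proof (H (e, x)) as Hx; cbn in Hx; rewrite <- Hx.
  replace (fun k => _) with (fun k => s k (e, x)); [tauto|].
  extensionality k; pose proof (proj2 (proj2_sig (c k)) (e, x)) as E; rewrite E.
  destruct (fst (proj1_sig (c k))); reflexivity.
Qed.

Lemma Def_allin n (t : ctx M n -> M) (Q : ctx M n -> M -> Prop) : term C n t ->
  Def G C (S n) (fun e => Q (fst e) (snd e)) ->
  Def G C n (fun e => forall x, mem x (t e) -> Q e x).
Proof.
  intros Ht HQ; destruct (Def_under n t Q Ht HQ) as [b [s [Gb [Ts [E H]]]]].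
  exists (AllIn 0 b), s; split; [apply fc_all, Gb|]; split; [exact Ts|].
  intros e; cbn; rewrite E; split; intros F x Hx; apply (H e x), F, Hx.
Qed.

Lemma Def_exin n (t : ctx M n -> M) (Q : ctx M n -> M -> Prop) : term C n t ->
  Def G C (S n) (fun e => Q (fst e) (snd e)) ->
  Def G C n (fun e => exists x, mem x (t e) /\ Q e x).
Proof.
  intros Ht HQ; destruct (Def_under n t Q Ht HQ) as [b [s [Gb [Ts [E H]]]]].
  exists (ExIn 0 b), s; split; [apply fc_ex, Gb|]; split; [exact Ts|].
  intros e; cbn; rewrite E; split; intros [x [Hx F]]; exists x; (split; [exact Hx|]); apply (H e x), F.
Qed.

Lemma Def_allsub n (t : ctx M n -> M) (Q : ctx M n -> M -> Prop) :
  (forall n a, G a -> G (AllSub n a)) -> term C n t ->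
  Def G C (S n) (fun e => Q (fst e) (snd e)) ->
  Def G C n (fun e => forall x, sub x (t e) -> Q e x).
Proof.
  intros GS Ht HQ; destruct (Def_under n t Q Ht HQ) as [b [s [Gb [Ts [E H]]]]].
  exists (AllSub 0 b), s; split; [apply GS, Gb|]; split; [exact Ts|].
  intros e; cbn; rewrite E; split; intros F x Hx; apply (H e x), F; exact Hx.
Qed.

(** Truth in a set counts as a Delta0 condition for [a] of any complexity, through [relf]; the
    bounding set becomes variable 0. *)
Lemma Def_satR n (s : nat -> ctx M n -> M) w a : (forall b, Delta0 b -> G b) ->
  (forall k, term C n (s k)) -> term C n w ->
  Def G C n (fun e => satR M (fun x => mem x (w e)) (fun k => s k e) a).
Proof.
  intros GD Ts Tw.
  exists (relf 0 (ren S a)), (w .: s); split; [apply GD, Delta0_relf|]; split.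
  - intros [|k]; [exact Tw|apply Ts].
  - intros e; rewrite sat_relf, satR_ren; cbn; tauto.
Qed.

Definition sbt m n (f : ctx M m -> ctx M n) : Prop :=
  forall t, term C n t -> term C m (fun e => t (f e)).

Lemma sbt_pair m n f t : sbt m n f -> term C m t -> sbt m (S n) (fun e => (f e, t e)).
Proof.
  intros Hf Ht u [E|[u' [Tu E]]].
  - replace (fun e => u (f e, t e)) with t; [exact Ht|]; extensionality e; rewrite E; reflexivity.
  - replace (fun e => u (f e, t e)) with (fun e => u' (f e)); [apply Hf, Tu|].
    extensionality e; rewrite E; reflexivity.
Qed.

Lemma Def_subst m n f P : sbt m n f -> Def G C n P -> Def G C m (fun e => P (f e)).
Proof.
  intros Hf [a [s [Ga [Ts H]]]]; exists a, (fun k e => s k (f e)); split; [exact Ga|].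
  split; [intros k; apply Hf, Ts|]; intros e; apply H.
Qed.

Lemma Def_fin_ex n (P : nat -> ctx M n -> Prop) K t : term C n t -> (forall k, Def G C n (P k)) ->
  Def G C n (fun e => exists k, k < K /\ P k e).
Proof.
  intros Ht H; induction K as [|K IH].
  - apply (Def_ext n (fun e => ~ t e = t e)).
    + intros e; split; [tauto|intros [k [L _]]; lia].
    + apply Def_not, Def_eq; exact Ht.
  - apply (Def_ext n (fun e => (exists k, k < K /\ P k e) \/ P K e)); [|apply Def_or; auto].
    intros e; split.
    + intros [[k [L Hk]]|Hk]; [exists k; split; [lia|auto]|exists K; split; [lia|auto]].
    + intros [k [L Hk]]; destruct (Nat.eq_dec k K) as [->|Ne]; [auto|left; exists k; split; [lia|auto]].
Qed.

Fixpoint ev n : ctx M n -> (nat -> M) -> nat -> M :=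
  match n with 0 => fun _ v => v | S n => fun e v => snd e .: ev n (fst e) v end.

Lemma ev_tail n e v k : ev n e v (n + k) = v k.
Proof. induction n; cbn; auto. Qed.

Lemma term_cases n t : term C n t ->
  (exists p, forall e v, t e = ev n e v p) \/ (exists c, C c /\ forall e, t e = c).
Proof.
  revert t; induction n as [|n IH]; intros t; [right; assumption|].
  intros [E|[t' [Ht E]]].
  - left; exists 0; intros e v; cbn; apply E.
  - destruct (IH t' Ht) as [[p Hp]|[c Hc]].
    + left; exists (S p); intros e v; cbn; rewrite E; apply Hp.
    + right; exists c; split; [apply Hc|]; intros e; rewrite E; apply Hc.
Qed.

(** Context entries become the first [n] variables; a constant standing for variable [k] is stored
    at position [n + k], in the tail [v]. *)
Lemma Def_formula (m0 : M) n P : Def G C n P ->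
  exists a v, G a /\ forall e, sat M (ev n e v) a <-> P e.
Proof.
  intros [a [s [Ga [Ts H]]]].
  assert (c : forall k, {p : nat * M | forall e v, v k = snd p -> s k e = ev n e v (fst p)}).
  { intros k; apply constructive_indefinite_description.
    destruct (term_cases n (s k) (Ts k)) as [[p Hp]|[c [_ Hc]]].
    - exists (p, m0); intros e v _; apply Hp.
    - exists (n + k, c); cbn; intros e v Hv; rewrite ev_tail, Hv; apply Hc. }
  exists (ren (fun k => fst (proj1_sig (c k))) a), (fun k => snd (proj1_sig (c k))).
  split; [apply fc_ren, Ga|]; intros e; rewrite sat_ren, <- H.
  replace (fun k => _) with (fun k => s k e); [tauto|].
  extensionality k; apply (proj2_sig (c k)); reflexivity.
Qed.

End Def.

Definition pure {M : structure} (c : M) : Prop := False.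
Definition full {M : structure} (c : M) : Prop := True.

(** Without constants one formula serves for every tail [v], so the predicate can be carried along
    any map that preserves formulae of class [G]. *)
Lemma Def_pure {M : structure} (G : form -> Prop) {FG : fclass G} n (P : ctx M n -> Prop) :
  Def G pure n P -> exists a, G a /\ forall e v, sat M (ev n e v) a <-> P e.
Proof.
  intros [a [s [Ga [Ts H]]]].
  assert (c : forall k, {p : nat | forall e v, s k e = ev n e v p}).
  { intros k; apply constructive_indefinite_description.
    destruct (term_cases n (s k) (Ts k)) as [Hp|[c [[] _]]]; exact Hp. }
  exists (ren (fun k => proj1_sig (c k)) a); split; [apply fc_ren, Ga|].
  intros e v; rewrite sat_ren, <- H.
  replace (fun k => _) with (fun k => s k e); [tauto|].
  extensionality k; apply (proj2_sig (c k)).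
Qed.

Ltac tsolve := first [assumption | solve [left; intro; reflexivity]
  | match goal with |- term _ (S (S ?n)) _ => exact (term_1 n) end
  | match goal with |- term _ (S (S (S ?n))) _ => exact (term_2 n) end
  | match goal with |- term _ (S (S (S (S ?n)))) _ => exact (term_3 n) end
  | match goal with |- term _ (S (S (S (S (S ?n))))) _ => exact (term_4 n) end
  | match goal with |- term _ (S (S (S (S (S (S ?n)))))) _ => exact (term_5 n) end
  | match goal with |- term _ (S (S (S (S (S (S (S ?n))))))) _ => exact (term_6 n) end
  | match goal with |- term _ (S (S (S (S (S (S (S (S ?n)))))))) _ => exact (term_7 n) end
  | match goal with |- term _ (S ?n) _ => apply (term_w1 n); assumption end
  | match goal with |- term _ (S (S ?n)) _ => apply (term_w2 n); assumption end
  | match goal with |- term _ (S (S (S ?n))) _ => apply (term_w3 n); assumption end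
  | match goal with |- term _ (S (S (S (S ?n)))) _ => apply (term_w4 n); assumption end
  | match goal with |- term _ (S (S (S (S (S ?n))))) _ => apply (term_w5 n); assumption end
  | apply term_c; exact I].

(** Entry point of [dsolve] for defined notions, filled in once their definability is proved. *)
Ltac dhook := fail.

Ltac dstep := cbv beta; first [tsolve
  | simple apply Def_and | simple apply Def_or | simple apply Def_not
  | simple apply Def_iff
  | simple apply Def_mem | simple apply Def_eq
  | simple apply Def_allin | simple apply Def_exin
  | dhook
  | simple apply Def_imp ].
Ltac dsolve := repeat dstep.

(** * Definability of pairs, relations and functions *)

Section Notions.
Context {M : structure}.
Implicit Types x y z a b f u : M.

Definition ispair z a b : Prop := forall w, mem w z <-> w = a \/ w = b.
Definition isop z a b : Prop := exists p q, ispair p a a /\ ispair q a b /\ ispair z p q.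
Definition rel f u y : Prop := exists z, mem z f /\ isop z u y.
Definition fnl f : Prop := forall u y y', rel f u y -> rel f u y' -> y = y'.
(** [f] may be undefined on part of [a] and may take values outside [c]: the point is only that [c]
    is no larger than [a]. The notion is therefore monotone in [a] and stable under shrinking
    [c]. *)
Definition Surj f a c : Prop := fnl f /\ forall y, mem y c -> exists u, mem u a /\ rel f u y.

Context {G : form -> Prop} {FG : fclass G} {C : M -> Prop}.

Lemma Def_sub n t s : term C n t -> term C n s -> Def G C n (fun e => sub (t e) (s e)).
Proof. intros Ht Hs; unfold incl_in; dsolve. Qed.

Lemma Def_trans n t : term C n t -> Def G C n (fun e => trans (t e)).
Proof. intros Ht; unfold transitive_in, incl_in; dsolve. Qed.

Lemma Def_ispair n (t a b : ctx M n -> M) : term C n t -> term C n a -> term C n b ->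
  Def G C n (fun e => ispair (t e) (a e) (b e)).
Proof.
  intros Ht Ha Hb.
  apply (Def_ext n (fun e => (mem (a e) (t e) /\ mem (b e) (t e)) /\
    forall w, mem w (t e) -> w = a e \/ w = b e)).
  - intros e; split.
    + intros [[H1 H2] H3] w; split; [apply H3|intros [-> | ->]; assumption].
    + intros H; repeat split; [apply H; auto|apply H; auto|intros w; apply H].
  - dsolve.
Qed.

Lemma Def_isop n (t a b : ctx M n -> M) : term C n t -> term C n a -> term C n b ->
  Def G C n (fun e => isop (t e) (a e) (b e)).
Proof.
  intros Ht Ha Hb.
  apply (Def_ext n (fun e => exists p, mem p (t e) /\ exists q, mem q (t e) /\
    (ispair p (a e) (a e) /\ ispair q (a e) (b e) /\ ispair (t e) p q))).
  - intros e; split.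
    + intros [p [_ [q [_ H]]]]; exists p, q; exact H.
    + intros [p [q [H1 [H2 H3]]]]; exists p; split; [apply H3; auto|].
      exists q; split; [apply H3; auto|auto].
  - apply Def_exin; [tsolve|]; apply Def_exin; [tsolve|].
    repeat apply Def_and; apply Def_ispair; tsolve.
Qed.

Lemma Def_rel n (t a b : ctx M n -> M) : term C n t -> term C n a -> term C n b ->
  Def G C n (fun e => rel (t e) (a e) (b e)).
Proof.
  intros Ht Ha Hb; unfold rel; apply Def_exin; [tsolve|]; apply Def_isop; tsolve.
Qed.

Lemma isop_bounds z a b : isop z a b ->
  exists p q, mem p z /\ mem a p /\ mem q z /\ mem b q.
Proof.
  intros [p [q [H1 [H2 H3]]]]; exists p, q; repeat split;
    [apply H3|apply H1|apply H3|apply H2]; auto.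
Qed.

Lemma sbt_2 n : sbt (C := C) (S (S (S (S (S n))))) (S (S n))
  (fun e => (fst (fst (fst (fst (fst e)))), snd (fst (fst e)), snd e)).
Proof.
  apply (sbt_pair (S (S (S (S (S n))))) (S n) (fun e : ctx M (S (S (S (S (S n))))) => (fst (fst (fst (fst (fst e)))), snd (fst (fst e))))); [|tsolve].
  apply (sbt_pair (S (S (S (S (S n))))) n (fun e : ctx M (S (S (S (S (S n))))) => fst (fst (fst (fst (fst e)))))); [|tsolve].
  intros t Ht; tsolve.
Qed.

(** The components of a Kuratowski pair lie two levels below it, so both quantifiers can be bounded
    through the pair [z] and its elements [p] and [q]. *)
Lemma Def_allrel n (f : ctx M n -> M) (Q : ctx M n -> M -> M -> Prop) : term C n f ->
  Def G C (S (S n)) (fun e => Q (fst (fst e)) (snd (fst e)) (snd e)) ->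
  Def G C n (fun e => forall u y, rel (f e) u y -> Q e u y).
Proof.
  intros Hf HQ.
  apply (Def_ext n (fun e => forall z, mem z (f e) -> forall p, mem p z -> forall u, mem u p ->
    forall q, mem q z -> forall y, mem y q -> isop z u y -> Q e u y)).
  - intros e; split.
    + intros H u y [z [Hz Ho]]; destruct (isop_bounds z u y Ho) as [p [q [H1 [H2 [H3 H4]]]]].
      apply (H z Hz p H1 u H2 q H3 y H4 Ho).
    + intros H z Hz p Hp u Hu q Hq y Hy Ho; apply H; exists z; auto.
  - do 5 (apply Def_allin; [tsolve|]); apply Def_imp; [apply Def_isop; tsolve|].
    exact (Def_subst _ _ _ _ (sbt_2 n) HQ).
Qed.

Lemma Def_exrel n (f : ctx M n -> M) (Q : ctx M n -> M -> M -> Prop) : term C n f ->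
  Def G C (S (S n)) (fun e => Q (fst (fst e)) (snd (fst e)) (snd e)) ->
  Def G C n (fun e => exists u y, rel (f e) u y /\ Q e u y).
Proof.
  intros Hf HQ.
  apply (Def_ext n (fun e => ~ forall u y, rel (f e) u y -> ~ Q e u y)).
  - intros e; split.
    + intros H; apply NNPP; intros N; apply H; intros u y H1 H2; apply N; exists u, y; auto.
    + intros [u [y [H1 H2]]] N; exact (N u y H1 H2).
  - apply Def_not, Def_allrel; [exact Hf|]; apply Def_not, HQ.
Qed.

Lemma Def_exop n (f : ctx M n -> M) (Q : ctx M n -> M -> M -> Prop) : term C n f ->
  Def G C (S (S n)) (fun e => Q (fst (fst e)) (snd (fst e)) (snd e)) ->
  Def G C n (fun e => exists u y, isop (f e) u y /\ Q e u y).
Proof.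
  intros Hf HQ.
  apply (Def_ext n (fun e => exists p, mem p (f e) /\ exists u, mem u p /\ exists q, mem q (f e) /\
    exists y, mem y q /\ (isop (f e) u y /\ Q e u y))).
  - intros e; split.
    + intros [p [_ [u [_ [q [_ [y [_ H]]]]]]]]; exists u, y; exact H.
    + intros [u [y [Ho H]]]; destruct (isop_bounds _ u y Ho) as [p [q [H1 [H2 [H3 H4]]]]].
      exists p; split; [exact H1|]; exists u; split; [exact H2|]; exists q; split; [exact H3|].
      exists y; auto.
  - do 4 (apply Def_exin; [tsolve|]); apply Def_and; [apply Def_isop; tsolve|].
    refine (Def_subst (S (S (S (S n)))) (S (S n)) (fun e : ctx M (S (S (S (S n)))) =>
      (fst (fst (fst (fst e))), snd (fst (fst e)), snd e)) _ _ HQ).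
    apply (sbt_pair (S (S (S (S n)))) (S n) (fun e : ctx M (S (S (S (S n)))) => (fst (fst (fst (fst e))), snd (fst (fst e))))); [|tsolve].
    apply (sbt_pair (S (S (S (S n)))) n (fun e : ctx M (S (S (S (S n)))) => fst (fst (fst (fst e))))); [|tsolve].
    intros t Ht; tsolve.
Qed.

Lemma Def_fnl n (f : ctx M n -> M) : term C n f -> Def G C n (fun e => fnl (f e)).
Proof.
  intros Hf.
  apply (Def_ext n (fun e => forall u y, rel (f e) u y -> forall u' y', rel (f e) u' y' -> u = u' -> y = y')).
  - intros e; split.
    + intros H u y y' H1 H2; exact (H u y H1 u y' H2 eq_refl).
    + intros H u y H1 u' y' H2 <-; exact (H u y y' H1 H2).
  - apply Def_allrel; [tsolve|]; apply Def_allrel; [tsolve|]; apply Def_imp; apply Def_eq; tsolve.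
Qed.

Lemma Def_Surj n (f a c : ctx M n -> M) : term C n f -> term C n a -> term C n c ->
  Def G C n (fun e => Surj (f e) (a e) (c e)).
Proof.
  intros Hf Ha Hc; unfold Surj; apply Def_and; [apply Def_fnl, Hf|].
  apply Def_allin; [tsolve|]; apply Def_exin; [tsolve|]; apply Def_rel; tsolve.
Qed.

End Notions.

Ltac dhook ::= first [simple apply Def_sub | simple apply Def_trans | simple apply Def_ispair
  | simple apply Def_isop | simple apply Def_rel | simple apply Def_fnl | simple apply Def_Surj
  | simple apply Def_allrel | simple apply Def_exrel | simple apply Def_exop].

(** * Set theory in models of MOST *)

Definition issucc {M : structure} (m a : M) : Prop := forall w, mem w m <-> mem w a \/ w = a.

Definition inductive {M : structure} (i : M) : Prop :=
  (exists o, mem o i /\ forall z, ~ mem z o) /\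
  forall n, mem n i -> exists m, mem m i /\ issucc m n.

Definition wo {M : structure} (r x : M) : Prop :=
  (forall z, mem z r -> exists a, mem a x /\ exists b, mem b x /\ isop z a b) /\
  (forall a, mem a x -> ~ rel r a a) /\
  (forall a, mem a x -> forall b, mem b x -> forall c, mem c x ->
     rel r a b -> rel r b c -> rel r a c) /\
  (forall a, mem a x -> forall b, mem b x -> rel r a b \/ a = b \/ rel r b a) /\
  (forall s, sub s x -> (exists z, mem z s) ->
     exists m, mem m s /\ forall z, mem z s -> m = z \/ rel r m z).

Record most (M : structure) : Prop := {
  m_ext : forall a b : M, (forall z, mem z a <-> mem z b) -> a = b;
  m_emp : exists o : M, forall z, ~ mem z o;
  m_pair : forall a b : M, exists p, ispair p a b;
  m_union : forall a : M, exists u, forall z, mem z u <-> exists w, mem w a /\ mem z w;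
  m_pow : forall a : M, exists p, forall z, mem z p <-> sub z a;
  m_inf : exists i : M, inductive i;
  m_tco : forall x : M, exists y, sub x y /\ trans y;
  m_found : forall x : M, (exists z, mem z x) -> exists y, mem y x /\ forall z, mem z y -> ~ mem z x;
  m_wo : forall x : M, exists r, wo r x;
  m_ssep : forall a, Sigma1 a -> forall (v : nat -> M) w,
    exists y, forall x, mem x y <-> mem x w /\ sat M (x .: v) a;
  m_scoll : forall a, Delta0 a -> forall (v : nat -> M) w,
    (forall x, mem x w -> exists y, sat M (y .: x .: v) a) ->
    exists c, forall x, mem x w -> exists y, mem y c /\ sat M (y .: x .: v) a }.

Lemma sep_instance_sat (M : structure) n a : (forall v : nat -> M, sat M v (sep_instance n a)) <->
  forall (v : nat -> M) w, exists y, forall x, mem x y <-> mem x w /\ sat M (x .: v) a.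
Proof.
  unfold sep_instance; rewrite sat_alls; cbn.
  assert (E : forall (v : nat -> M) w y x, sat M (x .: y .: w .: v) (ren (0 .: fun k => 3 + k) a)
      <-> sat M (x .: v) a).
  { intros v w y x; rewrite sat_ren, scons_map; cbn; tauto. }
  split; intros H v w; destruct (H v w) as [y Hy]; exists y; intros x; specialize (Hy x);
    [rewrite E in Hy|rewrite E]; exact Hy.
Qed.

Lemma coll_instance_sat (M : structure) n a : (forall v : nat -> M, sat M v (coll_instance n a)) <->
  forall (v : nat -> M) w, (forall x, mem x w -> exists y, sat M (y .: x .: v) a) ->
    exists c, forall x, mem x w -> exists y, mem y c /\ sat M (y .: x .: v) a.
Proof.
  unfold coll_instance; rewrite sat_alls; cbn.
  assert (E1 : forall (v : nat -> M) w y x, sat M (y .: x .: w .: v) (ren (0 .: 1 .: fun k => 3 + k) a)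
      <-> sat M (y .: x .: v) a).
  { intros v w y x; rewrite sat_ren, !scons_map; cbn; tauto. }
  assert (E2 : forall (v : nat -> M) w c y x, sat M (y .: x .: c .: w .: v) (ren (0 .: 1 .: fun k => 4 + k) a)
      <-> sat M (y .: x .: v) a).
  { intros v w c y x; rewrite sat_ren, !scons_map; cbn; tauto. }
  split; intros H v w Hw.
  - destruct (H v w) as [c Hc].
    + intros x Hx; destruct (Hw x Hx) as [y Hy]; exists y; apply E1, Hy.
    + exists c; intros x Hx; destruct (Hc x Hx) as [y [Hy1 Hy2]]; exists y; split; [exact Hy1|].
      apply E2 in Hy2; exact Hy2.
  - destruct (H v w) as [c Hc].
    + intros x Hx; destruct (Hw x Hx) as [y Hy]; exists y; apply E1 in Hy; exact Hy.
    + exists c; intros x Hx; destruct (Hc x Hx) as [y [Hy1 Hy2]]; exists y; split; [exact Hy1|].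
      apply E2, Hy2.
Qed.

Lemma models_most (M : structure) : models M MOST -> most M.
Proof.
  intros [[m0] H].
  assert (Mc : forall a, Mac a -> sat M (fun _ => m0) a) by (intros; apply H; constructor; assumption).
  split.
  - intros a b E; exact (Mc _ Mac_ext a b E).
  - exact (Mc _ Mac_empty).
  - intros a b; exact (Mc _ Mac_pair a b).
  - intros a; exact (Mc _ Mac_union a).
  - intros a; exact (Mc _ Mac_power a).
  - exact (Mc _ Mac_infinity).
  - intros x; exact (Mc _ Mac_tco x).
  - intros x; exact (Mc _ Mac_foundation x).
  - intros x; exact (Mc _ Mac_wo x).
  - intros a Ha; destruct (closed_at_ex a) as [n Hn].
    apply (sep_instance_sat M n a); apply H, MOST_sep; exists n, a; split; [exact Ha|].
    split; [apply (closed_at_mono _ n); auto|reflexivity].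
  - intros a Ha; destruct (closed_at_ex a) as [n Hn].
    apply (coll_instance_sat M n a); apply H, MOST_coll; exists n, a; split; [exact Ha|].
    split; [apply (closed_at_mono _ n); auto|reflexivity].
Qed.

Definition pick {X : Type} {P : X -> Prop} (H : exists x, P x) : X :=
  proj1_sig (constructive_indefinite_description P H).

Lemma pick_spec {X : Type} {P : X -> Prop} (H : exists x, P x) : P (pick H).
Proof. exact (proj2_sig (constructive_indefinite_description P H)). Qed.

Notation D0 := (Def Delta0 full).

Section Sets.
Context {M : structure} (HM : most M).
Implicit Types x y z a b c f g r s t u v w : M.

Definition emp : M := pick (m_emp M HM).
Definition pr a b : M := pick (m_pair M HM a b).
Definition un a : M := pick (m_union M HM a).
Definition pw a : M := pick (m_pow M HM a).
Definition sg a : M := pr a a.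
Definition bun a b : M := un (pr a b).
Definition op a b : M := pr (sg a) (pr a b).

Lemma ext a b : (forall z, mem z a <-> mem z b) -> a = b.
Proof. apply (m_ext M HM). Qed.

Lemma in_emp z : ~ mem z emp.
Proof. apply (pick_spec (m_emp M HM)). Qed.
Lemma in_pr z a b : mem z (pr a b) <-> z = a \/ z = b.
Proof. apply (pick_spec (m_pair M HM a b)). Qed.
Lemma in_un z a : mem z (un a) <-> exists w, mem w a /\ mem z w.
Proof. apply (pick_spec (m_union M HM a)). Qed.
Lemma in_pw z a : mem z (pw a) <-> sub z a.
Proof. apply (pick_spec (m_pow M HM a)). Qed.
Lemma in_sg z a : mem z (sg a) <-> z = a.
Proof. unfold sg; rewrite in_pr; tauto. Qed.
Lemma in_bun z a b : mem z (bun a b) <-> mem z a \/ mem z b.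
Proof.
  unfold bun; rewrite in_un; split.
  - intros [w [Hw Hz]]; apply in_pr in Hw as [-> | ->]; auto.
  - intros [H|H]; [exists a|exists b]; rewrite in_pr; auto.
Qed.

Lemma ispair_pr z a b : ispair z a b <-> z = pr a b.
Proof.
  split.
  - intros H; apply ext; intros w; rewrite in_pr; apply H.
  - intros -> w; apply in_pr.
Qed.

Lemma isop_op z a b : isop z a b <-> z = op a b.
Proof.
  split.
  - intros [p [q [H1 [H2 H3]]]]; apply ispair_pr in H1, H2, H3; subst; reflexivity.
  - intros ->; exists (sg a), (pr a b); rewrite !ispair_pr; auto.
Qed.

Lemma rel_op f u y : rel f u y <-> mem (op u y) f.
Proof.
  split; [intros [z [Hz Ho]]; apply isop_op in Ho; subst; exact Hz|].
  intros H; exists (op u y); split; [exact H|apply isop_op; reflexivity].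
Qed.

Lemma pr_inj a b a' b' : pr a b = pr a' b' -> (a = a' /\ b = b') \/ (a = b' /\ b = a').
Proof.
  intros E.
  assert (H : forall z, z = a \/ z = b <-> z = a' \/ z = b') by (intros z; rewrite <- !in_pr, E; tauto).
  destruct (proj1 (H a) (or_introl eq_refl)), (proj1 (H b) (or_intror eq_refl)); subst; auto.
  - destruct (proj2 (H b') (or_intror eq_refl)); subst; auto.
  - destruct (proj2 (H a') (or_introl eq_refl)); subst; auto.
Qed.

Lemma op_inj a b a' b' : op a b = op a' b' -> a = a' /\ b = b'.
Proof.
  intros E; unfold op, sg in E; apply pr_inj in E as [[E1 E2]|[E1 E2]].
  - apply pr_inj in E1; apply pr_inj in E2; destruct E1 as [[]|[]], E2 as [[]|[]]; subst; auto.
  - apply pr_inj in E1; apply pr_inj in E2; destruct E1 as [[]|[]], E2 as [[]|[]]; subst; auto.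
Qed.

(** With [ssep] and [coll], this stands in for the axiom schemes in the set theory below: the side
    condition is discharged by [dsolve]. *)
Lemma sep (P : M -> Prop) w : D0 1 (fun e => P (snd e)) -> exists y, forall x, mem x y <-> mem x w /\ P x.
Proof.
  intros D; destruct (Def_formula emp 1 _ D) as [a [v [Ga H]]].
  destruct (m_ssep M HM a (Sigma1_Delta0 a Ga) v w) as [y Hy]; exists y; intros x.
  rewrite Hy, <- (H (tt, x)); cbn; tauto.
Qed.

Lemma ssep (P : M -> M -> Prop) w : D0 2 (fun e => P (snd (fst e)) (snd e)) -> exists y, forall x, mem x y <-> mem x w /\ exists z, P x z.
Proof.
  intros D; destruct (Def_formula emp 2 _ D) as [a [v [Ga H]]].
  destruct (m_ssep M HM (Ex a) (Sigma1_ex _ (Sigma1_Delta0 a Ga)) v w) as [y Hy]; exists y; intros x.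
  rewrite Hy; cbn; split; intros [H1 [z H2]]; split; auto; exists z; apply (H (tt, x, z)), H2.
Qed.

Lemma coll (P : M -> M -> Prop) w : D0 2 (fun e => P (snd (fst e)) (snd e)) -> (forall x, mem x w -> exists y, P x y) ->
  exists c, forall x, mem x w -> exists y, mem y c /\ P x y.
Proof.
  intros D Hw; destruct (Def_formula emp 2 _ D) as [a [v [Ga H]]].
  destruct (m_scoll M HM a Ga v w) as [c Hc].
  - intros x Hx; destruct (Hw x Hx) as [y Hy]; exists y; apply (H (tt, x, y)), Hy.
  - exists c; intros x Hx; destruct (Hc x Hx) as [y [Hy1 Hy2]]; exists y; split; [exact Hy1|].
    apply (H (tt, x, y)), Hy2.
Qed.

Lemma prod_ex a b : exists p, forall z, mem z p <-> exists u, mem u a /\ exists y, mem y b /\ isop z u y.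
Proof.
  destruct (sep (fun z => exists u, mem u a /\ exists y, mem y b /\ isop z u y) (pw (pw (bun a b))))
    as [p Hp]; [dsolve|].
  exists p; intros z; rewrite Hp; split; [tauto|]; intros H; split; [|exact H].
  destruct H as [u [Hu [y [Hy Ho]]]]; apply isop_op in Ho; subst; apply in_pw.
  intros w Hw; apply in_pw; intros q Hq; apply in_bun.
  apply in_pr in Hw as [-> | ->]; [apply in_sg in Hq; subst; auto|].
  apply in_pr in Hq as [-> | ->]; auto.
Qed.
Definition prod a b : M := pick (prod_ex a b).
Lemma mem_prod z a b : mem z (prod a b) <-> exists u, mem u a /\ exists y, mem y b /\ isop z u y.
Proof. apply (pick_spec (prod_ex a b)). Qed.
Lemma op_in_prod u y a b : mem (op u y) (prod a b) <-> mem u a /\ mem y b.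
Proof.
  rewrite mem_prod; split.
  - intros [u' [Hu [y' [Hy Ho]]]]; apply isop_op, op_inj in Ho as [-> ->]; auto.
  - intros [Hu Hy]; exists u; split; [exact Hu|]; exists y; split; [exact Hy|apply isop_op; reflexivity].
Qed.

Lemma mkrel (P : M -> M -> Prop) a b : D0 2 (fun e => P (snd (fst e)) (snd e)) -> exists r, sub r (prod a b) /\ forall u y, rel r u y <-> mem u a /\ mem y b /\ P u y.
Proof.
  intros D.
  destruct (sep (fun z => exists u, mem u a /\ exists y, mem y b /\ (isop z u y /\ P u y)) (prod a b)) as [r Hr].
  { dsolve.
    refine (Def_subst 3 2 (fun e : ctx M 3 => (tt, snd (fst e), snd e)) (fun e => P (snd (fst e)) (snd e)) _ D).
    apply (sbt_pair 3 1 (fun e : ctx M 3 => (tt, snd (fst e)))); [|tsolve].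
    apply (sbt_pair 3 0 (fun e : ctx M 3 => tt)); [|tsolve].
    intros t [c [_ E]]; rewrite (functional_extensionality _ (fun _ => c) (fun e => E tt)); tsolve. }
  exists r; split; [intros z Hz; apply Hr in Hz; tauto|].
  intros u y; rewrite rel_op, Hr; split.
  - intros [_ [u' [Hu [y' [Hy [Ho HP]]]]]]; apply isop_op, op_inj in Ho as [-> ->]; auto.
  - intros [Hu [Hy HP]]; split; [apply op_in_prod; auto|].
    exists u; split; [exact Hu|]; exists y; split; [exact Hy|]; split; [apply isop_op; reflexivity|exact HP].
Qed.

Definition fld f : M := un (un f).
Lemma rel_fld f u y : rel f u y -> mem u (fld f) /\ mem y (fld f).
Proof.
  rewrite rel_op; intros H; split; apply in_un; exists (pr u y); rewrite !in_pr; (split; [|auto]);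
    apply in_un; exists (op u y); (split; [exact H|]); apply in_pr; auto.
Qed.

Lemma rel_un X u y : rel (un X) u y <-> exists g, mem g X /\ rel g u y.
Proof.
  rewrite rel_op, in_un; split; intros [g [H1 H2]]; exists g; rewrite rel_op in *; auto.
Qed.

Lemma found x : (exists z, mem z x) -> exists y, mem y x /\ forall z, mem z y -> ~ mem z x.
Proof. apply (m_found M HM). Qed.

Lemma mem_ind (P : M -> Prop) a : D0 1 (fun e => P (snd e)) ->
  (forall x, mem x a -> (forall y, mem y x -> mem y a -> P y) -> P x) ->
  forall x, mem x a -> P x.
Proof.
  intros D H x Hx; apply NNPP; intros N.
  destruct (sep (fun x => ~ P x) a) as [b Hb]; [dsolve; exact D|].
  destruct (found b) as [m [Hm Hmin]]; [exists x; apply Hb; auto|].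
  apply Hb in Hm as [Hma Hm]; apply Hm, H; [exact Hma|].
  intros y Hy Hya; apply NNPP; intros Ny; apply (Hmin y Hy), Hb; auto.
Qed.

Lemma no_cycle3 a b c : mem a b -> mem b c -> mem c a -> False.
Proof.
  intros H1 H2 H3; destruct (found (bun (pr a b) (sg c))) as [m [Hm Hmin]].
  - exists a; rewrite in_bun, in_pr; auto.
  - rewrite in_bun, in_pr, in_sg in Hm; destruct Hm as [[-> | ->]| ->].
    + apply (Hmin c H3); rewrite in_bun, in_sg; auto.
    + apply (Hmin a H1); rewrite in_bun, in_pr; auto.
    + apply (Hmin b H2); rewrite in_bun, in_pr; auto.
Qed.
Lemma no_cycle1 a : ~ mem a a.
Proof. intros H; exact (no_cycle3 a a a H H H). Qed.
Lemma no_cycle2 a b : mem a b -> mem b a -> False.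
Proof.
  intros H1 H2; destruct (found (pr a b)) as [m [Hm Hmin]]; [exists a; apply in_pr; auto|].
  apply in_pr in Hm as [-> | ->]; [apply (Hmin b H2)|apply (Hmin a H1)]; apply in_pr; auto.
Qed.

Lemma trans_around x : exists t, trans t /\ mem x t.
Proof.
  destruct (m_tco M HM (sg x)) as [t [H1 H2]]; exists t; split; [exact H2|apply H1, in_sg; reflexivity].
Qed.

(** ** Mostowski collapse *)

Definition wf a r : Prop :=
  forall s, sub s a -> (exists z, mem z s) -> exists m, mem m s /\ forall z, mem z s -> ~ rel r z m.

(** An attempt at the collapse, possibly partial. It is a Delta0 condition, and apart from the
    leading premise [g] occurs only positively, so that unions of attempts are attempts. *)
Definition At a r g : Prop := forall u y, rel g u y -> mem u a /\
  (forall z, mem z y -> exists v, mem v a /\ (rel r v u /\ rel g v z)) /\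
  (forall v, mem v a -> rel r v u -> exists z, mem z y /\ rel g v z).

Lemma Def_At {G : form -> Prop} {FG : fclass G} {C : M -> Prop} n (a r g : ctx M n -> M) :
  term C n a -> term C n r -> term C n g ->
  Def G C n (fun e => At (a e) (r e) (g e)).
Proof. intros Ha Hr Hg; unfold At; dsolve. Qed.

Lemma At_unique a r g g' : wf a r -> At a r g -> At a r g' ->
  forall u y y', rel g u y -> rel g' u y' -> y = y'.
Proof.
  intros W A A' u y y' H H'; apply NNPP; intros N.
  destruct (sep (fun u => exists u1 y, rel g u1 y /\ exists u2 y', rel g' u2 y' /\ ((u1 = u /\ u2 = u) /\ ~ y = y')) a) as [b Hb]; [dsolve|].
  destruct (W b) as [m [Hm Hmin]].
  - intros z Hz; apply Hb in Hz; tauto.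
  - exists u; apply Hb; split; [apply (A u y H)|]; exists u, y; split; [exact H|]; exists u, y'; auto.
  - apply Hb in Hm as [Hma [u1 [y1 [R1 [u2 [y2 [R2 [[-> ->] Ne]]]]]]]].
    assert (ok : forall v, mem v a -> rel r v m -> forall z z', rel g v z -> rel g' v z' -> z = z').
    { intros v Hv Rv z z' Hz Hz'; apply NNPP; intros Nz; apply (Hmin v); [|exact Rv].
      apply Hb; split; [exact Hv|]; exists v, z; split; [exact Hz|]; exists v, z'; auto. }
    destruct (A m y1 R1) as [_ [A1 A2]], (A' m y2 R2) as [_ [A1' A2']].
    apply Ne, ext; intros z; split; intros Hz.
    + destruct (A1 z Hz) as [v [Hv [Rv Gv]]], (A2' v Hv Rv) as [z' [Hz' Gv']].
      rewrite (ok v Hv Rv z z' Gv Gv'); exact Hz'.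
    + destruct (A1' z Hz) as [v [Hv [Rv Gv]]], (A2 v Hv Rv) as [z' [Hz' Gv']].
      rewrite <- (ok v Hv Rv z' z Gv' Gv); exact Hz'.
Qed.

Lemma At_cover a r s : wf a r -> sub s a ->
  (forall u, mem u s -> exists g, At a r g /\ exists y, mem y (fld g) /\ rel g u y) ->
  exists h, At a r h /\ forall u, mem u s -> exists y, rel h u y.
Proof.
  intros W Hs H.
  destruct (coll (fun u g => At a r g /\ exists u' y, rel g u' y /\ u' = u) s) as [c Hc].
  { dsolve; apply Def_At; tsolve. }
  { intros u Hu; destruct (H u Hu) as [g [A [y [_ Hy]]]]; exists g; split; [exact A|]; exists u, y; auto. }
  destruct (sep (fun g => At a r g) c) as [X HX]; [apply Def_At; tsolve|].
  exists (un X); split.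
  - intros u y Hu; apply rel_un in Hu as [g [Hg Hu]]; apply HX in Hg as [Hgc Ag].
    assert (gX : mem g X) by (apply HX; auto).
    destruct (Ag u y Hu) as [H1 [H2 H3]]; split; [exact H1|]; split.
    + intros z Hz; destruct (H2 z Hz) as [v [Hv [Rv Gv]]]; exists v; split; [exact Hv|]; split; [exact Rv|].
      apply rel_un; exists g; auto.
    + intros v Hv Rv; destruct (H3 v Hv Rv) as [z [Hz Gv]]; exists z; split; [exact Hz|].
      apply rel_un; exists g; auto.
  - intros u Hu; destruct (Hc u Hu) as [g [Hg [Ag [u' [y [Hy ->]]]]]].
    exists y; apply rel_un; exists g; split; [apply HX; auto|exact Hy].
Qed.

(** The points reached by some attempt form a set by Sigma1-separation. At an [r]-minimal unreached
    point [u] the attempts below [u] can be united and extended by the set of their values, so no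
    point is unreached. *)
Theorem collapse a r : wf a r ->
  exists f, At a r f /\ forall u, mem u a -> exists y, rel f u y.
Proof.
  intros W.
  destruct (ssep (fun u g => At a r g /\ exists u' y, rel g u' y /\ u' = u) a) as [good Hg].
  { dsolve; apply Def_At; tsolve. }
  assert (cover : forall s, sub s good -> exists h, At a r h /\ forall u, mem u s -> exists y, rel h u y).
  { intros s Hs; apply At_cover; [exact W| |].
    - intros u Hu; apply Hs, Hg in Hu; tauto.
    - intros u Hu; apply Hs, Hg in Hu as [_ [g [A [u' [y [Hy ->]]]]]].
      exists g; split; [exact A|]; exists y; split; [apply (rel_fld g u y Hy)|exact Hy]. }
  assert (all : forall u, mem u a -> mem u good).
  { intros u0 Hu0; apply NNPP; intros N.
    destruct (sep (fun u => ~ mem u good) a) as [b Hb]; [dsolve|].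
    destruct (W b) as [u [Hu Hmin]].
    { intros z Hz; apply Hb in Hz; tauto. }
    { exists u0; apply Hb; auto. }
    apply Hb in Hu as [Hua Hu].
    destruct (sep (fun v => rel r v u) a) as [s Hs]; [dsolve|].
    destruct (cover s) as [h [Ah Ch]].
    { intros v Hv; apply Hs in Hv as [Hva Rv]; apply NNPP; intros Nv; apply (Hmin v); [apply Hb; auto|exact Rv]. }
    destruct (sep (fun z => exists v y, rel h v y /\ (mem v s /\ z = y)) (fld h)) as [y Hy]; [dsolve|].
    assert (Hy' : forall z, mem z y <-> exists v, mem v s /\ rel h v z).
    { intros z; rewrite Hy; split.
      - intros [_ [v [z' [H1 [H2 ->]]]]]; exists v; auto.
      - intros [v [H1 H2]]; split; [apply (rel_fld h v z H2)|]; exists v, z; auto. }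
    apply Hu, Hg; split; [exact Hua|]; exists (bun h (sg (op u y))).
    assert (R : forall v z, rel (bun h (sg (op u y))) v z <-> rel h v z \/ (v = u /\ z = y)).
    { intros v z; rewrite !rel_op, in_bun, in_sg; split; intros [H|H]; auto.
      - apply op_inj in H; auto.
      - right; destruct H; subst; reflexivity. }
    split.
    - intros v z Hv; apply R in Hv as [Hv|[-> ->]].
      + destruct (Ah v z Hv) as [H1 [H2 H3]]; split; [exact H1|]; split.
        * intros q Hq; destruct (H2 q Hq) as [w [Hw1 [Hw2 Hw3]]]; exists w; rewrite R; auto.
        * intros w Hw Rw; destruct (H3 w Hw Rw) as [q [Hq1 Hq2]]; exists q; rewrite R; auto.
      + split; [exact Hua|]; split.
        * intros q Hq; apply Hy' in Hq as [w [Hw1 Hw2]]; apply Hs in Hw1 as [Hw Rw]; exists w; rewrite R; auto.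
        * intros w Hw Rw; destruct (Ch w) as [q Hq]; [apply Hs; auto|].
          exists q; rewrite R; split; [apply Hy'; exists w; split; [apply Hs; auto|exact Hq]|auto].
    - exists u, y; split; [apply R; auto|reflexivity]. }
  destruct (cover good) as [h [Ah Ch]]; [intros z; auto|].
  exists h; split; [exact Ah|]; intros u Hu; apply Ch, all, Hu.
Qed.

(** ** Ordinals *)

Definition ord a : Prop := trans a /\
  forall x, mem x a -> forall y, mem y a -> mem x y \/ x = y \/ mem y x.

Lemma Def_ord {G : form -> Prop} {FG : fclass G} {C : M -> Prop} n (a : ctx M n -> M) :
  term C n a -> Def G C n (fun e => ord (a e)).
Proof. intros Ha; unfold ord; dsolve. Qed.

(** A membership-minimal element of [a] outside [c] has exactly the elements of [c]. *)
Lemma ord_initial a c : ord a -> trans c -> sub c a -> c = a \/ mem c a.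
Proof.
  intros [Ta La] Tc S; destruct (classic (sub a c)) as [S'|N].
  - left; apply ext; intros z; split; auto.
  - right; apply not_all_ex_not in N as [z0 N]; apply imply_to_and in N as [H1 H2].
    destruct (sep (fun x => ~ mem x c) a) as [b Hb]; [dsolve|].
    destruct (found b) as [m [Hm Hmin]]; [exists z0; apply Hb; auto|].
    apply Hb in Hm as [Hma Hmc]; replace c with m; [exact Hma|].
    apply ext; intros z; split; intros Hz.
    + apply NNPP; intros Nz; apply (Hmin z Hz), Hb; split; [exact (Ta m Hma z Hz)|exact Nz].
    + destruct (La z (S z Hz) m Hma) as [H|[->|H]]; [exact H|contradiction|].
      exfalso; exact (Hmc (Tc z Hz m H)).
Qed.

Lemma ord_cmp a b : ord a -> ord b -> sub a b \/ mem b a.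
Proof.
  intros Oa Ob; destruct (sep (fun x => mem x b) a) as [c Hc]; [dsolve|].
  assert (Tc : trans c).
  { intros x Hx y Hy; apply Hc in Hx as [H1 H2]; apply Hc; split;
      [exact (proj1 Oa x H1 y Hy)|exact (proj1 Ob x H2 y Hy)]. }
  destruct (ord_initial b c Ob Tc) as [E|Hb]; [intros z Hz; apply Hc in Hz; tauto| |].
  - subst c; destruct (ord_initial a b Oa (proj1 Ob)) as [<-|H]; [intros z Hz; apply Hc in Hz; tauto| |auto].
    left; intros z; auto.
  - destruct (ord_initial a c Oa Tc) as [E|Ha]; [intros z Hz; apply Hc in Hz; tauto| |].
    + subst c; left; intros z Hz; apply Hc in Hz; tauto.
    + exfalso; apply (no_cycle1 c), Hc; auto.
Qed.

Lemma ord_mem a b : ord a -> mem b a -> ord b.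
Proof.
  intros [Ta La] Hb; split.
  - intros y Hy z Hz; assert (Hya := Ta b Hb y Hy); assert (Hza := Ta y Hya z Hz).
    destruct (La z Hza b Hb) as [H|[->|H]]; [exact H| |].
    + exfalso; exact (no_cycle2 b y Hz Hy).
    + exfalso; exact (no_cycle3 b z y H Hz Hy).
  - intros x Hx y Hy; apply La; apply (Ta b Hb); assumption.
Qed.

Lemma Surj_mono f a a' c : sub a a' -> Surj f a c -> Surj f a' c.
Proof.
  intros S [F H]; split; [exact F|]; intros y Hy; destruct (H y Hy) as [u [Hu Ru]]; exists u; auto.
Qed.

(** Collapsing a well-order of [c] yields an ordinal; the collapse [g] and its inverse [f] are the
    two surjections. Ordinals thereby measure the size of every set. *)
Theorem ord_enum c : exists a f g, ord a /\ Surj f a c /\ Surj g c a.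
Proof.
  destruct (m_wo M HM c) as [r [_ [Ir [Tr [To Le]]]]].
  assert (W : wf c r).
  { intros s Hs Ne; destruct (Le s Hs Ne) as [m [Hm Lm]]; exists m; split; [exact Hm|].
    intros z Hz Rz; destruct (Lm z Hz) as [<-|Rm]; [exact (Ir m (Hs m Hm) Rz)|].
    apply (Ir m (Hs m Hm)), (Tr m (Hs m Hm) z (Hs z Hz) m (Hs m Hm) Rm Rz). }
  destruct (collapse c r W) as [g [A T]].
  assert (Fg : fnl g) by (intros u y y'; apply (At_unique c r g g W A A)).
  destruct (sep (fun y => exists u y', rel g u y' /\ y' = y) (fld g)) as [a Ha]; [dsolve|].
  assert (Ha' : forall y, mem y a <-> exists u, rel g u y).
  { intros y; rewrite Ha; split; [intros [_ [u [y' [H ->]]]]; eauto|].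
    intros [u H]; split; [apply (rel_fld g u y H)|eauto]. }
  destruct (mkrel (fun y u => rel g u y) a c) as [f [_ Hf]]; [dsolve|].
  assert (step : forall u v y z, rel g u y -> rel g v z -> rel r u v -> mem y z).
  { intros u v y z Hu Hv R; destruct (A v z Hv) as [_ [_ A3]].
    destruct (A3 u (proj1 (A u y Hu)) R) as [y' [Hy' Gu]]; rewrite (Fg u y y' Hu Gu); exact Hy'. }
  exists a, f, g; split; [split|split; [split|split]].
  - intros y Hy z Hz; apply Ha' in Hy as [u Hu]; destruct (A u y Hu) as [_ [A2 _]].
    destruct (A2 z Hz) as [v [_ [_ Gv]]]; apply Ha'; eauto.
  - intros x Hx y Hy; apply Ha' in Hx as [u Hu]; apply Ha' in Hy as [v Hv].
    destruct (To u (proj1 (A u x Hu)) v (proj1 (A v y Hv))) as [R|[<-|R]].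
    + left; exact (step u v x y Hu Hv R).
    + right; left; exact (Fg u x y Hu Hv).
    + right; right; exact (step v u y x Hv Hu R).
  - intros y u u' Hu Hu'; apply Hf in Hu as [_ [Uc Gu]]; apply Hf in Hu' as [_ [Uc' Gu']].
    destruct (To u Uc u' Uc') as [R|[E|R]];
      [exfalso; exact (no_cycle1 y (step u u' y y Gu Gu' R))|exact E
      |exfalso; exact (no_cycle1 y (step u' u y y Gu' Gu R))].
  - intros u Hu; destruct (T u Hu) as [y Gy]; exists y; split; [apply Ha'; eauto|].
    apply Hf; split; [apply Ha'; eauto|auto].
  - exact Fg.
  - intros y Hy; apply Ha' in Hy as [u Hu]; exists u; split; [apply (A u y Hu)|exact Hu].
Qed.

Lemma Surj_tight f a c : Surj f a c -> exists f', sub f' (prod a c) /\ Surj f' a c /\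
  forall u y, rel f' u y -> mem u a /\ mem y c /\ rel f u y.
Proof.
  intros [F S]; destruct (mkrel (fun u y => rel f u y) a c) as [f' [S' H']]; [dsolve|].
  exists f'; split; [exact S'|]; split; [split|].
  - intros u y y' H1 H2; apply H' in H1, H2; apply (F u); tauto.
  - intros y Hy; destruct (S y Hy) as [u [Hu R]]; exists u; split; [exact Hu|apply H'; auto].
  - intros u y H; apply H', H.
Qed.

(* Two enumerations [f], [f'] of transitive sets with the same pulled-back membership relation agree. *)
Lemma surj_rigid f f' d c : trans c -> Surj f d c -> fnl f' ->
  (forall u y, rel f u y -> mem y c) ->
  (forall u y, rel f u y -> exists y', rel f' u y') ->
  (forall v u z y z' y', rel f v z -> rel f u y -> rel f' v z' -> rel f' u y' -> mem z y -> mem z' y') ->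
  (forall u y y' z', rel f u y -> rel f' u y' -> mem z' y' ->
     exists v z, rel f v z /\ rel f' v z' /\ mem z y) ->
  forall u y, rel f u y -> rel f' u y.
Proof.
  intros Tc [Ff Sf] Ff' Rf Tot E1 E2.
  assert (H : forall y, mem y c -> forall u y0, rel f u y0 -> y0 = y -> forall u' y', rel f' u' y' -> u' = u -> y' = y).
  { apply (mem_ind (fun y => forall u y0, rel f u y0 -> y0 = y -> forall u' y', rel f' u' y' -> u' = u -> y' = y)).
    - dsolve.
    - intros y Hy IH u y0 Hu -> u' y' Hu' ->; apply ext; intros z; split; intros Hz.
      + destruct (E2 u y y' z Hu Hu' Hz) as [v [z0 [Hv [Hv' Hz0]]]].
        rewrite (IH z0 Hz0 (Tc y Hy z0 Hz0) v z0 Hv eq_refl v z Hv' eq_refl); exact Hz0.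
      + destruct (Sf z (Tc y Hy z Hz)) as [v [Hv Rv]], (Tot v z Rv) as [z' Rv'].
        rewrite <- (IH z Hz (Tc y Hy z Hz) v z Rv eq_refl v z' Rv' eq_refl).
        exact (E1 v u z y z' y' Rv Hu Rv' Hu' Hz). }
  intros u y Hu; destruct (Tot u y Hu) as [y' Hu'].
  rewrite <- (H y (Rf u y Hu) u y Hu eq_refl u y' Hu' eq_refl); exact Hu'.
Qed.

End Sets.

Section Sizes.
Context {M : structure} (HM : most M).
Implicit Types x y z a b c d f g q r s t u v w : M.

Local Notation emp := (emp HM).
Local Notation pr := (pr HM).
Local Notation sg := (sg HM).
Local Notation pw := (pw HM).
Local Notation op := (op HM).
Local Notation prod := (prod HM).
Local Notation fld := (fld HM).

(** ** The set of all transitive images of a given set *)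

(* The diagonal of [E] records the domain of [f], which may be partial. *)
Definition coded d E f t : Prop :=
  (trans t /\ Surj f d t /\ forall u y, rel f u y -> mem u d /\ mem y t) /\
  forall u, mem u d -> forall v, mem v d ->
    (rel E u v <-> exists u1 y, rel f u1 y /\ exists v1 z, rel f v1 z /\
       ((u1 = u /\ v1 = v) /\ (mem y z \/ u = v))).

(** On the domain recorded by the diagonal, [E] determines which value is an element of which, so
    [surj_rigid] identifies the two enumerations. *)
Lemma coded_sub d E f t f' t' : coded d E f t -> coded d E f' t' -> sub t t'.
Proof.
  intros [[Tt [Sf Rf]] Ef] [[Tt' [Sf' Rf']] Ef'].
  assert (H : forall u y, rel f u y -> rel f' u y).
  { apply (surj_rigid HM f f' d t); [exact Tt|exact Sf|apply Sf'|apply Rf| | |].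
    - intros u y Hu; assert (Hd := proj1 (Rf u y Hu)).
      assert (E0 : rel E u u) by (apply (Ef u Hd u Hd); exists u, y; split; [exact Hu|]; exists u, y; auto).
      apply (Ef' u Hd u Hd) in E0 as [u1 [y1 [R1 [u2 [y2 [_ [[-> _] _]]]]]]]; eauto.
    - intros v u z y z' y' Hv Hu Hv' Hu' Hz.
      assert (E0 : rel E v u).
      { apply (Ef v (proj1 (Rf v z Hv)) u (proj1 (Rf u y Hu))); exists v, z; split; [exact Hv|]; exists u, y; auto. }
      apply (Ef' v (proj1 (Rf v z Hv)) u (proj1 (Rf u y Hu))) in E0
        as [v1 [z1 [R1 [u1 [y1 [R2 [[-> ->] [H| ->]]]]]]]].
      + rewrite (proj1 Sf' v z' z1 Hv' R1), (proj1 Sf' u y' y1 Hu' R2); exact H.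
      + rewrite (proj1 Sf u z y Hv Hu) in Hz; destruct (no_cycle1 HM y Hz).
    - intros u y y' z' Hu Hu' Hz'.
      destruct (proj2 Sf' z') as [v [Hvd Hv']].
      { exact (Tt' y' (proj2 (Rf' u y' Hu')) z' Hz'). }
      assert (E0 : rel E v u).
      { apply (Ef' v Hvd u (proj1 (Rf u y Hu))); exists v, z'; split; [exact Hv'|]; exists u, y'; auto. }
      apply (Ef v Hvd u (proj1 (Rf u y Hu))) in E0 as [v1 [z1 [R1 [u1 [y1 [R2 [[-> ->] [H| ->]]]]]]]].
      + exists v, z1; rewrite (proj1 Sf u y y1 Hu R2); auto.
      + rewrite (proj1 Sf' u z' y' Hv' Hu') in Hz'; destruct (no_cycle1 HM y' Hz'). }
  intros y Hy; destruct (proj2 Sf y Hy) as [u [_ Hu]]; apply (Rf' u y), H, Hu.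
Qed.

(** A transitive image of [d] is determined by its code, a relation on [d]. The codes form a set by
    Sigma1-separation, and collection over it bounds the images. *)
Lemma images_set d : exists h, forall t f, trans t -> Surj f d t -> mem t h.
Proof.
  assert (D : D0 2 (fun e : ctx M 2 => exists f t, isop (snd e) f t /\ coded d (snd (fst e)) f t)).
  { unfold coded; dsolve. }
  destruct (ssep HM (fun E q => exists f t, isop q f t /\ coded d E f t) (pw (prod d d)) D) as [X HX].
  destruct (coll HM (fun E q => exists f t, isop q f t /\ coded d E f t) X D) as [c Hc].
  { intros E HE; apply HX, HE. }
  exists (fld c); intros t f Tt Sf.
  destruct (mkrel HM (fun u y => rel f u y) d t) as [f1 [_ Hf1]]; [dsolve|].
  destruct (mkrel HM (fun u v => exists u1 y, rel f1 u1 y /\ exists v1 z, rel f1 v1 z /\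
       ((u1 = u /\ v1 = v) /\ (mem y z \/ u = v))) d d) as [E [SE HE]]; [dsolve|].
  assert (CE : coded d E f1 t).
  { split; [split; [exact Tt|split; [split|]]|].
    - intros u y y' H1 H2; apply Hf1 in H1, H2; apply (proj1 Sf u); tauto.
    - intros y Hy; destruct (proj2 Sf y Hy) as [u [Hu Ru]]; exists u; split; [exact Hu|apply Hf1; auto].
    - intros u y H; apply Hf1 in H; tauto.
    - intros u Hu v Hv; rewrite HE; tauto. }
  destruct (Hc E) as [q [Hq [f' [t' [Ho C']]]]].
  { apply HX; split; [apply (in_pw HM), SE|]; exists (op f1 t), f1, t; split; [apply (isop_op HM); reflexivity|exact CE]. }
  replace t with t'; [apply (rel_fld HM c f' t'); exists q; auto|].
  apply (ext HM); intros z; split; [apply (coded_sub d E f' t' f1 t)|apply (coded_sub d E f1 t f' t')]; assumption.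
Qed.

(** ** Closure under pairing *)

Definition pclosed a : Prop := forall x, mem x a -> forall y, mem y a -> exists p, mem p a /\ ispair p x y.

Lemma Def_pclosed {G : form -> Prop} {FG : fclass G} {C : M -> Prop} n (a : ctx M n -> M) :
  term C n a -> Def G C n (fun e => pclosed (a e)).
Proof. intros Ha; unfold pclosed; dsolve. Qed.

Lemma pclosed_pr a x y : pclosed a -> mem x a -> mem y a -> mem (pr x y) a.
Proof. intros H Hx Hy; destruct (H x Hx y Hy) as [p [Hp E]]; apply (ispair_pr HM) in E; subst; exact Hp. Qed.

Lemma pclosed_op a x y : pclosed a -> mem x a -> mem y a -> mem (op x y) a.
Proof. intros H Hx Hy; repeat (apply pclosed_pr; auto). Qed.

Lemma succ_inj (m n n' : M) : issucc m n -> issucc m n' -> n = n'.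
Proof.
  intros H H'; apply NNPP; intros N.
  assert (H1 : mem n n') by (destruct (proj1 (H' n)); [apply H; auto|assumption|congruence]).
  assert (H2 : mem n' n) by (destruct (proj1 (H n')); [apply H'; auto|assumption|congruence]).
  exact (no_cycle2 HM n n' H1 H2).
Qed.

Lemma Def_issucc {G : form -> Prop} {FG : fclass G} {C : M -> Prop} n (m a : ctx M n -> M) :
  term C n m -> term C n a -> Def G C n (fun e => issucc (m e) (a e)).
Proof.
  intros Hm Ha.
  apply (Def_ext n (fun e => (mem (a e) (m e) /\ forall w, mem w (a e) -> mem w (m e)) /\
     forall w, mem w (m e) -> mem w (a e) \/ w = a e)).
  - intros e; split.
    + intros [[H1 H2] H3] w; split; [apply H3|]; intros [H| ->]; auto.
    + intros H; repeat split; [apply H; auto|intros w Hw; apply H; auto|intros w; apply H].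
  - dsolve.
Qed.

(** Two injections of [q] into itself with disjoint ranges. They pack two subsets of a product with
    left factor [q] into one, which provides codes for pairs without recursion on the natural
    numbers of the model. *)
Record doubling q F0 F1 : Prop := {
  db_emp : mem emp q;
  db_tot0 : forall a, mem a q -> exists b, rel F0 a b;
  db_tot1 : forall a, mem a q -> exists b, rel F1 a b;
  db_fun0 : fnl F0;
  db_fun1 : fnl F1;
  db_ran0 : forall a b, rel F0 a b -> mem a q /\ mem b q;
  db_ran1 : forall a b, rel F1 a b -> mem a q /\ mem b q;
  db_inj0 : forall a a' b, rel F0 a b -> rel F0 a' b -> a = a';
  db_inj1 : forall a a' b, rel F1 a b -> rel F1 a' b -> a = a';
  db_dis : forall a a' b, rel F0 a b -> rel F1 a' b -> False }.

(* For an inductive set [i], the maps a |-> S[a] and a |-> S[a] + {0} are injections of the power set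
   of [i] into itself with disjoint ranges. *)
Lemma doubling_ex i : inductive i -> exists F0 F1, doubling (pw i) F0 F1.
Proof.
  intros [[o [Ho Eo]] Si].
  assert (So : forall n, ~ issucc o n) by (intros n H; apply (Eo n), H; auto).
  set (G0 := fun a b => (forall n, mem n a -> exists m, mem m b /\ issucc m n) /\
     (forall m, mem m b -> exists n, mem n a /\ issucc m n)).
  set (G1 := fun a b => mem o b /\ (forall n, mem n a -> exists m, mem m b /\ issucc m n) /\
     (forall m, mem m b -> m = o \/ exists n, mem n a /\ issucc m n)).
  destruct (mkrel HM G0 (pw i) (pw i)) as [F0 [_ H0]]; [unfold G0; dsolve; apply Def_issucc; tsolve|].
  destruct (mkrel HM G1 (pw i) (pw i)) as [F1 [_ H1]]; [unfold G1; dsolve; apply Def_issucc; tsolve|].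
  assert (sx : forall m m' n : M, issucc m n -> issucc m' n -> m = m').
  { intros m m' n E E'; apply (ext HM); intros z; rewrite (E z), (E' z); tauto. }
  exists F0, F1; split.
  - apply (in_pw HM); intros z Hz; destruct (in_emp HM z Hz).
  - intros a Ha; destruct (sep HM (fun m => exists n, mem n a /\ issucc m n) i) as [b Hb];
      [dsolve; apply Def_issucc; tsolve|].
    exists b; apply H0; split; [exact Ha|]; split; [apply (in_pw HM); intros z Hz; apply Hb in Hz; tauto|].
    split; [|intros m Hm; apply Hb in Hm; tauto].
    intros n Hn; apply (in_pw HM) in Ha; destruct (Si n (Ha n Hn)) as [m [Hm Sm]]; exists m.
    split; [apply Hb; eauto|exact Sm].
  - intros a Ha; destruct (sep HM (fun m => m = o \/ exists n, mem n a /\ issucc m n) i) as [b Hb];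
      [dsolve; apply Def_issucc; tsolve|].
    exists b; apply H1; split; [exact Ha|]; split; [apply (in_pw HM); intros z Hz; apply Hb in Hz; tauto|].
    split; [apply Hb; auto|]; split; [|intros m Hm; apply Hb in Hm; tauto].
    intros n Hn; apply (in_pw HM) in Ha; destruct (Si n (Ha n Hn)) as [m [Hm Sm]]; exists m.
    split; [apply Hb; eauto|exact Sm].
  - intros a b b' E E'; apply H0 in E as [_ [_ [E1 E2]]]; apply H0 in E' as [_ [_ [E1' E2']]].
    apply (ext HM); intros m; split; intros Hm.
    + destruct (E2 m Hm) as [n [Hn S1]], (E1' n Hn) as [m' [Hm' S2]]; rewrite (sx m m' n S1 S2); exact Hm'.
    + destruct (E2' m Hm) as [n [Hn S1]], (E1 n Hn) as [m' [Hm' S2]]; rewrite (sx m m' n S1 S2); exact Hm'.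
  - intros a b b' E E'; apply H1 in E as [_ [_ [E0 [E1 E2]]]]; apply H1 in E' as [_ [_ [E0' [E1' E2']]]].
    apply (ext HM); intros m; split; intros Hm.
    + destruct (E2 m Hm) as [-> |[n [Hn S1]]]; [exact E0'|].
      destruct (E1' n Hn) as [m' [Hm' S2]]; rewrite (sx m m' n S1 S2); exact Hm'.
    + destruct (E2' m Hm) as [-> |[n [Hn S1]]]; [exact E0|].
      destruct (E1 n Hn) as [m' [Hm' S2]]; rewrite (sx m m' n S1 S2); exact Hm'.
  - intros a b E; apply H0 in E; tauto.
  - intros a b E; apply H1 in E; tauto.
  - assert (K : forall a a' b, rel F0 a b -> rel F0 a' b -> sub a a').
    { intros a a' b E E'; apply H0 in E as [_ [_ [E1 E2]]]; apply H0 in E' as [_ [_ [E1' E2']]].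
      intros n Hn; destruct (E1 n Hn) as [m [Hm S1]], (E2' m Hm) as [n' [Hn' S2]].
      rewrite (succ_inj m n n' S1 S2); exact Hn'. }
    intros a a' b E E'; apply (ext HM); intros z; split; [apply (K a a' b)|apply (K a' a b)]; auto.
  - assert (K : forall a a' b, rel F1 a b -> rel F1 a' b -> sub a a').
    { intros a a' b E E'; apply H1 in E as [_ [_ [_ [E1 E2]]]]; apply H1 in E' as [_ [_ [_ [E1' E2']]]].
      intros n Hn; destruct (E1 n Hn) as [m [Hm S1]], (E2' m Hm) as [-> |[n' [Hn' S2]]].
      - destruct (So n S1).
      - rewrite (succ_inj m n n' S1 S2); exact Hn'. }
    intros a a' b E E'; apply (ext HM); intros z; split; [apply (K a a' b)|apply (K a' a b)]; auto.
  - intros a a' b E E'; apply H0 in E as [_ [_ [_ E2]]]; apply H1 in E' as [_ [_ [E0 _]]].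
    destruct (E2 o E0) as [n [_ S1]]; exact (So n S1).
Qed.

Section Codes.
Context (t q F0 F1 : M) (Tt : trans t) (DB : doubling q F0 F1).

(** Disjoint sum of the relations [x] and [y], rows being moved along [F0] and [F1]. It will stand
    for the unordered pair of what [x] and [y] stand for. *)
Definition isP z x y : Prop :=
  (forall b w, rel z b w -> (exists a b', rel F0 a b' /\ (b' = b /\ rel x a w)) \/
                            (exists a b', rel F1 a b' /\ (b' = b /\ rel y a w))) /\
  (forall a w, rel x a w -> exists a' b, rel F0 a' b /\ (a' = a /\ rel z b w)) /\
  (forall a w, rel y a w -> exists a' b, rel F1 a' b /\ (a' = a /\ rel z b w)).

(** Base code of an element [x] of [t]: the relation whose only pair is [op emp x]. *)
Definition isB z x : Prop := exists p, mem p z /\ (isop p emp x /\ forall p', mem p' z -> p' = p).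

Let s := pw (prod q t).

Lemma Def_isP {G : form -> Prop} {FG : fclass G} n (z x y : ctx M n -> M) :
  term full n z -> term full n x -> term full n y -> Def G full n (fun e => isP (z e) (x e) (y e)).
Proof. intros Hz Hx Hy; unfold isP; dsolve. Qed.

Lemma Def_isB {G : form -> Prop} {FG : fclass G} n (z x : ctx M n -> M) :
  term full n z -> term full n x -> Def G full n (fun e => isB (z e) (x e)).
Proof. intros Hz Hx; unfold isB; dsolve. Qed.

Lemma in_s z : mem z s <-> forall p, mem p z -> exists u, mem u q /\ exists y, mem y t /\ isop p u y.
Proof.
  unfold s; rewrite (in_pw HM); split; intros H p Hp; specialize (H p Hp); apply (mem_prod HM); exact H.
Qed.

Lemma s_rel_ext z z' : mem z s -> mem z' s -> (forall u y, rel z u y <-> rel z' u y) -> z = z'.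
Proof.
  intros Hz Hz' E; rewrite in_s in Hz, Hz'; apply (ext HM); intros p; split; intros Hp.
  - destruct (Hz p Hp) as [u [_ [y [_ Ho]]]]; apply (isop_op HM) in Ho; subst p.
    apply (rel_op HM), E, (rel_op HM), Hp.
  - destruct (Hz' p Hp) as [u [_ [y [_ Ho]]]]; apply (isop_op HM) in Ho; subst p.
    apply (rel_op HM), E, (rel_op HM), Hp.
Qed.

Lemma isP_ex x y : mem x s -> mem y s -> exists z, mem z s /\ isP z x y.
Proof.
  intros Hx Hy.
  assert (R : forall z, mem z s -> forall u w, rel z u w -> mem u q /\ mem w t).
  { intros z Hz u w Hr; apply (rel_op HM) in Hr; unfold s in Hz; apply (in_pw HM) in Hz.
    apply (op_in_prod HM), Hz, Hr. }
  destruct (mkrel HM (fun b w => (exists a b', rel F0 a b' /\ (b' = b /\ rel x a w)) \/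
                            (exists a b', rel F1 a b' /\ (b' = b /\ rel y a w))) q t) as [z [Sz Hz]]; [dsolve|].
  exists z; split; [apply (in_pw HM), Sz|]; split; [|split].
  - intros b w H; apply Hz in H; tauto.
  - intros a w H; destruct (R x Hx a w H) as [Ha Hw]; destruct (db_tot0 _ _ _ DB a Ha) as [b Hb].
    exists a, b; split; [exact Hb|]; split; [reflexivity|]; apply Hz.
    split; [apply (db_ran0 _ _ _ DB a b Hb)|]; split; [exact Hw|]; left; exists a, b; auto.
  - intros a w H; destruct (R y Hy a w H) as [Ha Hw]; destruct (db_tot1 _ _ _ DB a Ha) as [b Hb].
    exists a, b; split; [exact Hb|]; split; [reflexivity|]; apply Hz.
    split; [apply (db_ran1 _ _ _ DB a b Hb)|]; split; [exact Hw|]; right; exists a, b; auto.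
Qed.

Lemma isP_fun z z' x y : mem z s -> mem z' s -> isP z x y -> isP z' x y -> z = z'.
Proof.
  assert (K : forall z z', isP z x y -> isP z' x y -> forall b w, rel z b w -> rel z' b w).
  { intros u u' [A1 _] [_ [A2 A3]] b w H; destruct (A1 b w H) as [[a [b' [E [-> R]]]]|[a [b' [E [-> R]]]]].
    - destruct (A2 a w R) as [a' [b1 [E' [-> R']]]]; rewrite (db_fun0 _ _ _ DB a b b1 E E'); exact R'.
    - destruct (A3 a w R) as [a' [b1 [E' [-> R']]]]; rewrite (db_fun1 _ _ _ DB a b b1 E E'); exact R'. }
  intros Hz Hz' H H'; apply s_rel_ext; auto; intros u w; split; apply K; auto.
Qed.

Lemma isP_inj z x y x' y' : mem x s -> mem y s -> mem x' s -> mem y' s ->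
  isP z x y -> isP z x' y' -> x = x' /\ y = y'.
Proof.
  assert (K : forall x y x' y', isP z x y -> isP z x' y' ->
    (forall a w, rel x a w -> rel x' a w) /\ (forall a w, rel y a w -> rel y' a w)).
  { intros u v u' v' [_ [A2 A3]] [A1 _]; split; intros a w H.
    - destruct (A2 a w H) as [a' [b [E [-> R]]]].
      destruct (A1 b w R) as [[a' [b' [E' [-> R']]]]|[a' [b' [E' [-> R']]]]].
      + rewrite (db_inj0 _ _ _ DB a a' b E E'); exact R'.
      + destruct (db_dis _ _ _ DB a a' b E E').
    - destruct (A3 a w H) as [a' [b [E [-> R]]]].
      destruct (A1 b w R) as [[a' [b' [E' [-> R']]]]|[a' [b' [E' [-> R']]]]].
      + destruct (db_dis _ _ _ DB a' a b E' E).
      + rewrite (db_inj1 _ _ _ DB a a' b E E'); exact R'. }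
  intros Hx Hy Hx' Hy' H H'; split; apply s_rel_ext; auto; intros u w; split; intros R.
  - apply (K x y x' y' H H'), R.
  - apply (K x' y' x y H' H), R.
  - apply (K x y x' y' H H'), R.
  - apply (K x' y' x y H' H), R.
Qed.

Lemma isB_eq z x : isB z x <-> z = sg (op emp x).
Proof.
  split.
  - intros [p [Hp [Ho H]]]; apply (isop_op HM) in Ho; subst p; apply (ext HM); intros w; rewrite (in_sg HM).
    split; [apply H|intros ->; exact Hp].
  - intros ->; exists (op emp x); rewrite (in_sg HM); split; [reflexivity|]; split; [apply (isop_op HM); reflexivity|].
    intros p; apply (in_sg HM).
Qed.

Lemma isB_inj z x x' : isB z x -> isB z x' -> x = x'.
Proof.
  intros H H'; apply isB_eq in H, H'; subst z.
  assert (E : mem (op emp x) (sg (op emp x'))) by (rewrite <- H'; apply (in_sg HM); reflexivity).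
  apply (in_sg HM), (op_inj HM) in E; tauto.
Qed.

(** A base code has a single row, whereas the sum of two nonempty codes has rows in both disjoint
    ranges. *)
Lemma isB_isP z x u v : mem u s -> mem v s -> (exists p, mem p u /\ p = p) -> (exists p, mem p v /\ p = p) ->
  isB z x -> isP z u v -> False.
Proof.
  intros Hu Hv [p [Hp _]] [p' [Hp' _]] HB [_ [A2 A3]]; rewrite in_s in Hu, Hv; apply isB_eq in HB; subst z.
  destruct (Hu p Hp) as [a [_ [w [_ Ho]]]], (Hv p' Hp') as [a' [_ [w' [_ Ho']]]].
  destruct (A2 a w) as [a1 [b [E [-> R]]]]; [exists p; auto|].
  destruct (A3 a' w') as [a1 [b' [E' [-> R']]]]; [exists p'; auto|].
  apply (rel_op HM), (in_sg HM), (op_inj HM) in R as [-> _].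
  apply (rel_op HM), (in_sg HM), (op_inj HM) in R' as [-> _].
  exact (db_dis _ _ _ DB a a' _ E E').
Qed.

Lemma isB_s x : mem x t -> mem (sg (op emp x)) s.
Proof.
  intros Hx; apply in_s; intros p Hp; apply (in_sg HM) in Hp; subst p.
  exists emp; split; [apply (db_emp _ _ _ DB)|]; exists x; split; [exact Hx|apply (isop_op HM); reflexivity].
Qed.

Definition pcl b : Prop := (forall x, mem x t -> exists z, mem z b /\ isB z x) /\
  forall u, mem u b -> forall v, mem v b -> exists z, mem z b /\ isP z u v.

(** [B] is the intersection of all closed subsets of [s]. Its codes with a given definable property
    form such a subset when the property is inherited, whence induction on codes. *)
Lemma codes_ex : exists B, sub B s /\ pcl B /\
  forall P : M -> Prop, D0 1 (fun e => P (snd e)) ->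
    (forall x z, mem x t -> isB z x -> P z) ->
    (forall u v z, mem u B -> mem v B -> P u -> P v -> isP z u v -> P z) ->
    forall z, mem z B -> P z.
Proof.
  assert (D : forall n (b : ctx M n -> M), term full n b -> D0 n (fun e => pcl (b e))).
  { intros n b Hb; unfold pcl; dsolve; first [apply Def_isB|apply Def_isP]; tsolve. }
  destruct (sep HM (fun z => forall b, mem b (pw s) -> pcl b -> mem z b) s) as [B HB].
  { dsolve; apply D; tsolve. }
  assert (PB : pcl B).
  { split.
    - intros x Hx; exists (sg (op emp x)); split; [|apply isB_eq; reflexivity].
      apply HB; split; [apply isB_s, Hx|]; intros b _ [C1 _]; destruct (C1 x Hx) as [z [Hz E]].
      apply isB_eq in E; subst z; exact Hz.
    - intros u Hu v Hv; apply HB in Hu as [Us Hu]; apply HB in Hv as [Vs Hv].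
      destruct (isP_ex u v Us Vs) as [z [Hz E]]; exists z; split; [|exact E].
      apply HB; split; [exact Hz|]; intros b Hb Cb.
      destruct (proj2 Cb u (Hu b Hb Cb) v (Hv b Hb Cb)) as [z' [Hz' E']].
      rewrite (isP_fun z z' u v); auto; apply (in_pw HM) in Hb; auto. }
  exists B; split; [intros z Hz; apply HB in Hz; tauto|]; split; [exact PB|].
  intros P DP PB1 PB2 z Hz.
  destruct (sep HM P B DP) as [b Hb].
  apply HB in Hz as [_ Hz]; apply (Hb z), (Hz b).
  - apply (in_pw HM); intros w Hw; apply Hb in Hw as [Hw _]; apply HB in Hw; tauto.
  - split.
    + intros x Hx; destruct (proj1 PB x Hx) as [w [Hw E]]; exists w; split; [apply Hb; split; [exact Hw|eauto]|exact E].
    + intros u Hu v Hv; apply Hb in Hu as [Hu Pu]; apply Hb in Hv as [Hv Pv].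
      destruct (proj2 PB u Hu v Hv) as [w [Hw E]]; exists w; split; [apply Hb; split; [exact Hw|]|exact E].
      exact (PB2 u v w Hu Hv Pu Pv E).
Qed.

(** The codes receive a membership relation: base codes imitate membership in [t], and the sum of
    [u] and [v] has exactly [u] and [v] as elements. The collapse is a pair-closed transitive set
    above [t], presented as an image of a subset of [s], so that good classes are closed under this
    operation. *)
Lemma pair_closure_codes : exists Z f B, (trans Z /\ sub t Z /\ pclosed Z) /\ Surj f B Z /\ sub B s.
Proof.
  destruct codes_ex as [B [SB [[PB1 PB2] Ind]]].
  assert (NE : forall z, mem z B -> exists p, mem p z /\ p = p).
  { apply Ind; [dsolve| |].
    - intros x z _ [p [Hp _]]; exists p; auto.
    - intros u v z Hu Hv [p [Hp _]] _ [_ [A2 _]].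
      apply SB in Hu; rewrite in_s in Hu; destruct (Hu p Hp) as [a [_ [w [_ Ho]]]].
      destruct (A2 a w) as [a1 [b [_ [_ [p' [Hp' _]]]]]]; [exists p; auto|exists p'; auto]. }
  assert (BP : forall z x u v, mem u B -> mem v B -> isB z x -> isP z u v -> False).
  { intros z x u v Hu Hv; apply isB_isP; auto. }
  set (EE := fun u w => (exists x, mem x t /\ exists x', mem x' t /\ (isB w x /\ isB u x' /\ mem x' x)) \/
       exists v, mem v B /\ (isP w u v \/ isP w v u)).
  destruct (mkrel HM EE B B) as [E [_ HE]].
  { unfold EE; dsolve; first [apply Def_isB|apply Def_isP]; tsolve. }
  (* A set of codes without [E]-minimal element is shown to avoid every code, by induction on codes;
     base codes need a further induction on membership in [t]. *)
  assert (W : wf B E).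
  { intros X SX [w0 Hw0]; apply NNPP; intros N.
    assert (N' : forall m, mem m X -> exists z, mem z X /\ rel E z m).
    { intros m Hm; apply NNPP; intros N1; apply N; exists m; split; [exact Hm|].
      intros z Hz R; apply N1; eauto. }
    refine (Ind (fun z => ~ mem z X) _ _ _ w0 (SX w0 Hw0) Hw0); [dsolve| |].
    - intros x z Hx; revert x Hx z.
      assert (H : forall x, mem x t -> forall z, mem z X -> ~ isB z x).
      { apply (mem_ind HM (fun x => forall z, mem z X -> ~ isB z x)).
        - dsolve; apply Def_isB; tsolve.
        - intros x Hx IH z Hz EB; destruct (N' z Hz) as [u [Hu R]].
          apply HE in R as [_ [_ [[x1 [H1 [x' [H2 [B1 [B2 Hx']]]]]]|[v [Hv [P|P]]]]]].
          + rewrite (isB_inj z x1 x B1 EB) in Hx'; exact (IH x' Hx' H2 u Hu B2).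
          + exact (BP z x u v (SX u Hu) Hv EB P).
          + exact (BP z x v u Hv (SX u Hu) EB P). }
      intros x Hx z EB Hz; exact (H x Hx z Hz EB).
    - intros u v z Hu Hv Nu Nv P Hz; destruct (N' z Hz) as [u' [Hu' R]].
      apply HE in R as [Hb [_ [[x1 [H1 [x' [H2 [B1 _]]]]]|[v' [Hv' [P'|P']]]]]].
      + exact (BP z x1 u v Hu Hv B1 P).
      + destruct (isP_inj z u v u' v') as [-> _]; auto.
      + destruct (isP_inj z u v v' u') as [_ ->]; auto. }
  destruct (collapse HM B E W) as [f [A Tot]].
  assert (Ff : fnl f) by (intros u y y'; apply (At_unique HM B E f f W A A)).
  destruct (sep HM (fun y => exists u y', rel f u y' /\ y' = y) (fld f)) as [Z HZ0]; [dsolve|].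
  assert (HZ : forall y, mem y Z <-> exists u, rel f u y).
  { intros y; rewrite HZ0; split; [intros [_ [u [y' [H ->]]]]; eauto|].
    intros [u H]; split; [apply (rel_fld HM f u y H)|eauto]. }
  (* The base code of [x] collapses to [x] itself, so [t] is included in the collapse. *)
  assert (fB : forall x, mem x t -> forall w y, rel f w y -> isB w x -> y = x).
  { apply (mem_ind HM (fun x => forall w y, rel f w y -> isB w x -> y = x)).
    - dsolve; apply Def_isB; tsolve.
    - intros x Hx IH w y Hw EB; destruct (A w y Hw) as [HwB [A2 A3]].
      apply (ext HM); intros z; split; intros Hz.
      + destruct (A2 z Hz) as [v [Hv [R Rv]]].
        apply HE in R as [_ [_ [[x1 [H1 [x' [H2 [B1 [B2 Hx']]]]]]|[v' [Hv' [P|P]]]]]].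
        * rewrite (isB_inj w x1 x B1 EB) in Hx'; rewrite (IH x' Hx' H2 v z Rv B2); exact Hx'.
        * destruct (BP w x v v' Hv Hv' EB P).
        * destruct (BP w x v' v Hv' Hv EB P).
      + destruct (PB1 z (Tt x Hx z Hz)) as [v [Hv B2]].
        destruct (A3 v Hv) as [z' [Hz' Rv]].
        { apply HE; split; [exact Hv|]; split; [exact HwB|]; left; exists x; split; [exact Hx|].
          exists z; split; [exact (Tt x Hx z Hz)|auto]. }
        rewrite (IH z Hz (Tt x Hx z Hz) v z' Rv B2) in Hz'; exact Hz'. }
  exists Z, f, B; split; [split; [|split]|split; [split|exact SB]].
  - intros y Hy z Hz; apply HZ in Hy as [u Hu]; destruct (A u y Hu) as [_ [A2 _]].
    destruct (A2 z Hz) as [v [_ [_ Rv]]]; apply HZ; eauto.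
  - intros x Hx; destruct (PB1 x Hx) as [w [Hw EB]], (Tot w Hw) as [y Hy].
    rewrite <- (fB x Hx w y Hy EB); apply HZ; eauto.
  - intros x Hx y Hy; apply HZ in Hx as [u Hu]; apply HZ in Hy as [v Hv].
    assert (HuB := proj1 (A u x Hu)); assert (HvB := proj1 (A v y Hv)).
    destruct (PB2 u HuB v HvB) as [w [Hw P]], (Tot w Hw) as [p Hp].
    exists p; split; [apply HZ; eauto|]; destruct (A w p Hp) as [_ [A2 A3]]; intros z; split.
    + intros Hz; destruct (A2 z Hz) as [v' [Hv' [R Rv']]].
      apply HE in R as [_ [_ [[x1 [H1 [x' [H2 [B1 _]]]]]|[v'' [Hv'' [P'|P']]]]]].
      * destruct (BP w x1 u v HuB HvB B1 P).
      * destruct (isP_inj w u v v' v'') as [<- _]; auto; left; exact (Ff u z x Rv' Hu).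
      * destruct (isP_inj w u v v'' v') as [_ <-]; auto; right; exact (Ff v z y Rv' Hv).
    + intros [-> | ->].
      * destruct (A3 u HuB) as [z [Hz Rz]]; [apply HE; split; [exact HuB|]; split; [exact Hw|]; right; eauto|].
        rewrite (Ff u x z Hu Rz); exact Hz.
      * destruct (A3 v HvB) as [z [Hz Rz]]; [apply HE; split; [exact HvB|]; split; [exact Hw|]; right; eauto|].
        rewrite (Ff v y z Hv Rz); exact Hz.
  - exact Ff.
  - intros y Hy; apply HZ in Hy as [u Hu]; exists u; split; [apply (A u y Hu)|exact Hu].
Qed.

End Codes.

Lemma pair_closure i t : inductive i -> trans t ->
  exists Z f B, (trans Z /\ sub t Z /\ pclosed Z) /\ Surj f B Z /\ sub B (pw (prod (pw i) t)).
Proof.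
  intros Hi Tt; destruct (doubling_ex i Hi) as [F0 [F1 DB]].
  exact (pair_closure_codes t (pw i) F0 F1 Tt DB).
Qed.

Lemma pair_closed_around x : exists Z, trans Z /\ pclosed Z /\ mem x Z.
Proof.
  destruct (m_inf M HM) as [i Hi], (trans_around HM x) as [t [Tt Hx]].
  destruct (pair_closure i t Hi Tt) as [Z [f [B [[H1 [H2 H3]] _]]]]; exists Z; auto.
Qed.

End Sizes.

(** * Downward Löwenheim-Skolem with collapse *)

(** The formulae whose solvability the Tarski-Vaught test must transfer; a universal quantifier
    contributes the search for a counterexample. *)
Fixpoint wits (a : form) : list form :=
  match a with
  | Fal | Eq _ _ | Mem _ _ => []
  | Imp a b | And a b | Or a b => wits a ++ wits b
  | All a => Not a :: wits a
  | Ex a => a :: wits a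
  end.

Lemma tarski_vaught (M : structure) (A Z : M -> Prop) : (forall x, A x -> Z x) ->
  forall p, (forall a, In a (wits p) -> forall v, (forall k, A (v k)) ->
     (exists w, Z w /\ satR M Z (w .: v) a) -> exists w, A w /\ satR M Z (w .: v) a) ->
  forall v, (forall k, A (v k)) -> satR M A v p <-> satR M Z v p.
Proof.
  intros AZ.
  assert (sc : forall x v, A x -> (forall k, A (v k)) -> forall k, A ((x .: v) k)) by (intros x v Hx Hv [|k]; cbn; auto).
  induction p as [|m n|m n|a IHa b IHb|a IHa b IHb|a IHa b IHb|a IHa|a IHa]; intros TV v Hv; cbn in *.
  1-3: tauto.
  1-3: rewrite IHa, IHb; [tauto| | | |]; auto; intros c Hc; apply TV, in_or_app; auto.
  - assert (IH : forall v, (forall k, A (v k)) -> satR M A v a <-> satR M Z v a) by (apply IHa; auto).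
    split; intros H x Hx.
    + apply NNPP; intros N; destruct (TV (Not a)) with (v := v) as [w [Aw Nw]]; auto.
      { exists x; split; [exact Hx|exact N]. }
      apply Nw, IH; auto.
    + apply IH; auto.
  - assert (IH : forall v, (forall k, A (v k)) -> satR M A v a <-> satR M Z v a) by (apply IHa; auto).
    split.
    + intros [x [Hx H]]; exists x; split; [auto|]; apply IH; auto.
    + intros H; destruct (TV a (or_introl eq_refl) v Hv H) as [w [Aw Hw]].
      exists w; split; [exact Aw|]; apply IH; auto.
Qed.

(* One formula whose witnesses, for suitable values of the extra variables, are those of the
   formulas of [l]: the [i]-th conjunct is active when variable [n + i] equals the last one. *)
Definition star (n : nat) (l : list form) : form :=
  bigand (map (fun i => Imp (Eq (S (n + i)) (S (n + length l))) (nth i l Fal)) (seq 0 (length l))).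

(** Makes the [i]-th conjunct of [star] the only active one: the reference position [n + m] and
    position [n + i] get [p1], all others from [n] on get [p0]. *)
Definition sel {X} (n i m : nat) (p0 p1 : X) (v : nat -> X) (k : nat) : X :=
  if k <? n then v k else if orb (k =? n + i) (k =? n + m) then p1 else p0.

Lemma satR_star (M : structure) Z (v : nat -> M) w n l i p0 p1 : p0 <> p1 ->
  (forall a, In a l -> closed_at (S n) a) -> i < length l ->
  satR M Z (w .: sel n i (length l) p0 p1 v) (star n l) <-> satR M Z (w .: v) (nth i l Fal).
Proof.
  intros Ne Hc Hi; unfold star; rewrite satR_bigand.
  assert (E : forall j, j < length l -> satR M Z (w .: sel n i (length l) p0 p1 v) (nth j l Fal) <->
    satR M Z (w .: v) (nth j l Fal)).
  { intros j Hj; apply (satR_closed M Z _ (S n)); [apply Hc, nth_In, Hj|].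
    intros [|k] Hk; cbn; [reflexivity|]; unfold sel; replace (k <? n) with true; [reflexivity|].
    symmetry; apply Nat.ltb_lt; lia. }
  assert (S1 : forall k, n <= k -> sel n i (length l) p0 p1 v k = if orb (k =? n + i) (k =? n + length l) then p1 else p0).
  { intros k Hk; unfold sel; replace (k <? n) with false; [reflexivity|]; symmetry; apply Nat.ltb_ge; lia. }
  split.
  - intros H; apply E; [exact Hi|].
    apply (H (Imp (Eq (S (n + i)) (S (n + length l))) (nth i l Fal))).
    + apply in_map_iff; exists i; split; [reflexivity|apply in_seq; lia].
    + cbn; rewrite !S1 by lia; rewrite !Nat.eqb_refl, Bool.orb_true_r; reflexivity.
  - intros H a Ha; apply in_map_iff in Ha as [j [<- Hj]]; apply in_seq in Hj; cbn.
    rewrite !S1 by lia; rewrite Nat.eqb_refl, Bool.orb_true_r.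
    destruct (Nat.eq_dec j i) as [->|Nj]; [intros _; apply E; auto|].
    replace (n + j =? n + i) with false by (symmetry; apply Nat.eqb_neq; lia).
    replace (n + j =? n + length l) with false by (symmetry; apply Nat.eqb_neq; lia).
    cbn; intros F; destruct (Ne F).
Qed.

Definition app {X} (n : nat) (u s : nat -> X) (k : nat) : X := if k <? n then u k else s (k - n).

Lemma app_S {X} n (u s : nat -> X) : app (S n) u s = app n u (u n .: s).
Proof.
  extensionality k; unfold app.
  destruct (Nat.ltb_spec k (S n)), (Nat.ltb_spec k n); try lia; try reflexivity.
  - replace (k - n) with 0 by lia; cbn; f_equal; lia.
  - replace (k - n) with (S (k - S n)) by lia; reflexivity.
Qed.

Lemma satR_iso (M : structure) (K L : M -> Prop) (p : M -> M -> Prop) :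
  (forall x, K x -> exists y, L y /\ p x y) -> (forall y, L y -> exists x, K x /\ p x y) ->
  (forall x x' y y', p x y -> p x' y' -> (x = x' <-> y = y')) ->
  (forall x x' y y', p x y -> p x' y' -> (mem x x' <-> mem y y')) ->
  forall a v w, (forall k, p (v k) (w k)) -> satR M K v a <-> satR M L w a.
Proof.
  intros T S E I; induction a as [|m n|m n|a IHa b IHb|a IHa b IHb|a IHa b IHb|a IHa|a IHa]; intros v w H; cbn.
  - tauto.
  - apply E; auto.
  - apply I; auto.
  - rewrite (IHa v w H), (IHb v w H); tauto.
  - rewrite (IHa v w H), (IHb v w H); tauto.
  - rewrite (IHa v w H), (IHb v w H); tauto.
  - split.
    + intros F y Ly; destruct (S y Ly) as [x [Kx P]]; apply (IHa (x .: v)); [|auto]; intros [|k]; cbn; auto.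
    + intros F x Kx; destruct (T x Kx) as [y [Ly P]]; apply (IHa _ (y .: w)); [|auto]; intros [|k]; cbn; auto.
  - split.
    + intros [x [Kx F]]; destruct (T x Kx) as [y [Ly P]]; exists y; split; [exact Ly|].
      apply (IHa (x .: v)); [|exact F]; intros [|k]; cbn; auto.
    + intros [y [Ly F]]; destruct (S y Ly) as [x [Kx P]]; exists x; split; [exact Kx|].
      apply (IHa _ (y .: w)); [|exact F]; intros [|k]; cbn; auto.
Qed.

Section Hull.
Context {M : structure} (HM : most M).
Implicit Types x y z a b c d f g q r w : M.

Local Notation emp := (emp HM).
Local Notation sg := (sg HM).
Local Notation pw := (pw HM).
Local Notation op := (op HM).
Local Notation prod := (prod HM).
Local Notation fld := (fld HM).

(** Iterated pair with entries from [u (n-1)] down to [u 0] and an arbitrary last component, so that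
    every element codes the empty tuple. *)
Fixpoint tup (n : nat) (u : nat -> M) x : Prop :=
  match n with 0 => True | S n => exists x', isop x (u n) x' /\ tup n u x' end.

Lemma tup_ext n : forall u u' x, (forall k, k < n -> u k = u' k) -> tup n u x -> tup n u' x.
Proof.
  induction n as [|n IH]; intros u u' x E; cbn; [auto|].
  intros [x' [Ho Ht]]; exists x'; rewrite <- E by lia; split; [exact Ho|].
  apply (IH u); [intros; apply E; lia|exact Ht].
Qed.

Lemma tup_inj n : forall u u' x, tup n u x -> tup n u' x -> forall k, k < n -> u k = u' k.
Proof.
  induction n as [|n IH]; intros u u' x; cbn; [lia|].
  intros [x1 [O1 T1]] [x2 [O2 T2]] k Hk; apply (isop_op HM) in O1, O2; rewrite O1 in O2.
  apply (op_inj HM) in O2 as [E1 E2]; subst x2.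
  destruct (Nat.eq_dec k n) as [->|]; [exact E1|apply (IH u u' x1 T1 T2); lia].
Qed.

(** The entries are reached from [X] by bounded quantifiers, one pair at a time, and each is added
    to the assignment before [b] is evaluated in [Z]. *)
Lemma Def_tup (Z : M) (b : form) n : forall m X (s : nat -> ctx M m -> M), term full m X -> (forall k, term full m (s k)) ->
  D0 m (fun e => exists u, tup n u (X e) /\ satR M (fun x => mem x Z) (app n u (fun k => s k e)) b).
Proof.
  induction n as [|n IH]; intros m X s HX Hs.
  - apply (Def_ext m (fun e => satR M (fun x => mem x Z) (fun k => s k e) b)).
    + intros e; assert (E : forall u : nat -> M, app 0 u (fun k => s k e) = fun k => s k e).
      { intros u; extensionality k; unfold app; cbn; f_equal; lia. }
      split; [intros H; exists (fun _ => emp); rewrite E; cbn; auto|intros [u [_ H]]; rewrite E in H; exact H].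
    + apply (Def_satR m s (fun _ => Z)); [auto|exact Hs|tsolve].
  - apply (Def_ext m (fun e => exists a x', isop (X e) a x' /\
      exists u, tup n u x' /\ satR M (fun x => mem x Z) (app n u (a .: fun k => s k e)) b)).
    + intros e; split.
      * intros [a [x' [Ho [u [Ht H]]]]].
        assert (E : app n u (a .: fun k => s k e) = app (S n) (fun k => if k =? n then a else u k) (fun k => s k e)).
        { rewrite app_S, Nat.eqb_refl; extensionality k; unfold app.
          destruct (Nat.ltb_spec k n); [|reflexivity]; replace (k =? n) with false; [reflexivity|].
          symmetry; apply Nat.eqb_neq; lia. }
        exists (fun k => if k =? n then a else u k); rewrite <- E; split; [|exact H].
        exists x'; rewrite Nat.eqb_refl; split; [exact Ho|]; apply (tup_ext n u); [|exact Ht].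
        intros k Hk; replace (k =? n) with false; [reflexivity|]; symmetry; apply Nat.eqb_neq; lia.
      * intros [u [[x' [Ho Ht]] H]]; rewrite app_S in H; exists (u n), x'; split; [exact Ho|]; exists u; auto.
    + apply (Def_exop m X (fun e a x' => exists u, tup n u x' /\
        satR M (fun x => mem x Z) (app n u (a .: fun k => s k e)) b)); [exact HX|].
      apply (Def_ext (S (S m)) (fun e => exists u, tup n u (snd e) /\
        satR M (fun x => mem x Z) (app n u (fun k => ((fun e' : ctx M (S (S m)) => snd (fst e')) .: fun k (e' : ctx M (S (S m))) => s k (fst (fst e'))) k e)) b)).
      * intros e; rewrite (scons_map (fun t : ctx M (S (S m)) -> M => t e)); tauto.
      * apply (IH (S (S m)) (fun e => snd e)); [tsolve|].
        intros [|k]; [tsolve|]; cbn; apply (term_w2 m (s k)), Hs.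
Qed.

Context (t Z : M) (Tt : trans t) (Pt : pclosed t) (TZ : trans Z) (PZ : pclosed Z) (tZ : sub t Z).
Context (x0 : M) (Hx0 : mem x0 t).

(** Distinct tags in [t] for the three kinds of term: an element of [t], a pair, and an application
    of the function [k]. *)
Let e0 := emp.
Let e1 := sg emp.
Let e2 := sg (sg emp).

Lemma e0_t : mem e0 t.
Proof.
  destruct (found HM t) as [m [Hm Hmin]]; [eauto|].
  replace e0 with m; [exact Hm|]; apply (ext HM); intros z; split; intros Hz.
  - destruct (Hmin z Hz (Tt m Hm z Hz)).
  - destruct (in_emp HM z Hz).
Qed.
Lemma e1_t : mem e1 t.
Proof. apply pclosed_pr; auto; apply e0_t. Qed.
Lemma e2_t : mem e2 t.
Proof. apply pclosed_pr; auto; apply e1_t. Qed.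
Lemma sg_emp x : sg x <> emp.
Proof. intros E; apply (in_emp HM x); rewrite <- E; apply (in_sg HM); reflexivity. Qed.
Lemma e01 : e0 <> e1.
Proof. intros E; symmetry in E; exact (sg_emp _ E). Qed.
Lemma e02 : e0 <> e2.
Proof. intros E; symmetry in E; exact (sg_emp _ E). Qed.
Lemma e12 : e1 <> e2.
Proof.
  intros E; assert (H : mem (sg emp) (sg emp)) by (unfold e1, e2 in E; rewrite E at 2; apply (in_sg HM); reflexivity).
  exact (no_cycle1 HM _ H).
Qed.

(* The hull of [t] under pairing and the function [k], with its elements coded by terms in [t]. *)
Lemma hull_ex k : fnl k -> (forall x w, rel k x w -> mem w Z) ->
  exists R, fnl R /\ (forall u a, rel R u a -> mem u t /\ mem a Z) /\
    (forall x, mem x t -> exists u, rel R u x) /\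
    (forall u a v b, rel R u a -> rel R v b -> exists c, rel R c (op a b)) /\
    (forall u a w, rel R u a -> rel k a w -> exists c, rel R c w).
Proof.
  intros Fk Rk.
  set (cl := fun R => (forall x, mem x t -> exists c, mem c t /\ (isop c e0 x /\ rel R c x)) /\
    (forall u a, rel R u a -> forall v b, rel R v b -> exists d, mem d t /\ exists c, mem c t /\ exists q, mem q Z /\
       (isop d u v /\ isop c e1 d /\ isop q a b /\ rel R c q)) /\
    (forall u a, rel R u a -> forall x w, rel k x w -> a = x -> exists c, mem c t /\ (isop c e2 u /\ rel R c w))).
  (* [R] is the least relation between codes and values closed under the three rules, formed as an
     intersection inside the product of [t] and [Z]. *)
  destruct (sep HM (fun p => forall R, mem R (pw (prod t Z)) -> cl R -> mem p R) (prod t Z)) as [R HR].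
  { unfold cl; dsolve. }
  assert (HR' : forall u a, rel R u a <-> mem u t /\ mem a Z /\ forall R', mem R' (pw (prod t Z)) -> cl R' -> rel R' u a).
  { intros u a; rewrite (rel_op HM), HR, (op_in_prod HM); split; intros H.
    - destruct H as [[H1 H2] H3]; split; [exact H1|]; split; [exact H2|]; intros R' E1 E2; apply (rel_op HM); auto.
    - destruct H as [H1 [H2 H3]]; split; [auto|]; intros R' E1 E2; apply (rel_op HM); auto. }
  assert (C0 : forall x, mem x t -> rel R (op e0 x) x).
  { intros x Hx; apply HR'; split; [apply pclosed_op; auto; apply e0_t|]; split; [auto|].
    intros R' _ [A _]; destruct (A x Hx) as [c [_ [Ho H]]]; apply (isop_op HM) in Ho; subst c; exact H. }
  assert (C1 : forall u a v b, rel R u a -> rel R v b -> rel R (op e1 (op u v)) (op a b)).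
  { intros u a v b Hu Hv; apply HR' in Hu as [Hu1 [Hu2 Hu3]]; apply HR' in Hv as [Hv1 [Hv2 Hv3]].
    apply HR'; split; [repeat apply pclosed_op; auto; apply e1_t|]; split; [apply pclosed_op; auto|].
    intros R' E1 E2; destruct (proj1 (proj2 E2) u a (Hu3 R' E1 E2) v b (Hv3 R' E1 E2)) as [d [_ [c [_ [q [_ [O1 [O2 [O3 H]]]]]]]]].
    apply (isop_op HM) in O1, O2, O3; subst; exact H. }
  assert (C2 : forall u a w, rel R u a -> rel k a w -> rel R (op e2 u) w).
  { intros u a w Hu Hk; apply HR' in Hu as [Hu1 [Hu2 Hu3]].
    apply HR'; split; [apply pclosed_op; auto; apply e2_t|]; split; [eauto|].
    intros R' E1 E2; destruct (proj2 (proj2 E2) u a (Hu3 R' E1 E2) a w Hk eq_refl) as [c [_ [Ho H]]].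
    apply (isop_op HM) in Ho; subst; exact H. }
  assert (RI : forall P : M -> M -> Prop, D0 2 (fun e => P (snd (fst e)) (snd e)) ->
    (forall x, mem x t -> P (op e0 x) x) ->
    (forall u a v b, rel R u a -> P u a -> rel R v b -> P v b -> P (op e1 (op u v)) (op a b)) ->
    (forall u a w, rel R u a -> P u a -> rel k a w -> P (op e2 u) w) ->
    forall u a, rel R u a -> P u a).
  { intros P DP P0 P1 P2.
    destruct (mkrel HM (fun u a => rel R u a /\ P u a) t Z) as [R' [S' H']]; [dsolve; exact DP|].
    assert (CL : cl R').
    { split; [|split].
      - intros x Hx; exists (op e0 x); assert (H := C0 x Hx); assert (H1 := proj1 (HR' _ _) H).
        split; [apply H1|]; split; [apply (isop_op HM); reflexivity|]; apply H'; intuition.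
      - intros u a Hu v b Hv; apply H' in Hu as [_ [_ [Hu Pu]]]; apply H' in Hv as [_ [_ [Hv Pv]]].
        assert (H := C1 u a v b Hu Hv); assert (H1 := proj1 (HR' _ _) H).
        exists (op u v); split; [apply pclosed_op; auto; [apply HR' in Hu|apply HR' in Hv]; tauto|].
        exists (op e1 (op u v)); split; [apply H1|]; exists (op a b); split; [apply H1|].
        rewrite !(isop_op HM); repeat split; auto; apply H'; split; [apply H1|]; split; [apply H1|]; split; [exact H|].
        exact (P1 u a v b Hu Pu Hv Pv).
      - intros u a Hu x w Hk <-; apply H' in Hu as [_ [_ [Hu Pu]]].
        assert (H := C2 u a w Hu Hk); assert (H1 := proj1 (HR' _ _) H).
        exists (op e2 u); split; [apply H1|]; split; [apply (isop_op HM); reflexivity|].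
        apply H'; split; [apply H1|]; split; [apply H1|]; split; [exact H|]; exact (P2 u a w Hu Pu Hk). }
    intros u a Hu; apply HR' in Hu as [_ [_ Hu]]; specialize (Hu R').
    apply H' in Hu; [tauto|apply (in_pw HM), S'|exact CL]. }
  (* Inversion: the tag of a code tells which rule produced it. Functionality of [R] follows by
     induction. *)
  assert (INV : forall u a, rel R u a -> (mem a t /\ isop u e0 a) \/
     (exists u1 a1, rel R u1 a1 /\ exists u2 a2, rel R u2 a2 /\ ((exists d, mem d t /\ (isop d u1 u2 /\ isop u e1 d)) /\ isop a a1 a2)) \/
     (exists u1 a1, rel R u1 a1 /\ exists x w, rel k x w /\ (a1 = x /\ w = a /\ isop u e2 u1))).
  { apply RI; [dsolve| | |].
    - intros x Hx; left; split; [exact Hx|apply (isop_op HM); reflexivity].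
    - intros u a v b Hu _ Hv _; right; left; exists u, a; split; [exact Hu|]; exists v, b; split; [exact Hv|].
      split; [|apply (isop_op HM); reflexivity]; exists (op u v).
      split; [apply pclosed_op; auto; [apply HR' in Hu|apply HR' in Hv]; tauto|]; rewrite !(isop_op HM); auto.
    - intros u a w Hu _ Hk; right; right; exists u, a; split; [exact Hu|]; exists a, w; split; [exact Hk|].
      repeat split; auto; apply (isop_op HM); reflexivity. }
  exists R; split; [|split; [|split; [|split]]].
  - assert (FU : forall u a, rel R u a -> forall u' a', rel R u' a' -> u' = u -> a' = a).
    { apply (RI (fun u a => forall u' a', rel R u' a' -> u' = u -> a' = a)); [dsolve| | |].
      - intros x Hx u' a' H ->; apply INV in H as [[_ O]|[[u1 [a1 [_ [u2 [a2 [_ [[d [_ [_ O]]] _]]]]]]]|[u1 [a1 [_ [x' [w [_ [_ [_ O]]]]]]]]]].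
        + apply (isop_op HM), (op_inj HM) in O as [_ E]; auto.
        + apply (isop_op HM), (op_inj HM) in O as [E _]; destruct (e01 E).
        + apply (isop_op HM), (op_inj HM) in O as [E _]; destruct (e02 E).
      - intros u a v b Hu IHu Hv IHv u' a' H ->.
        apply INV in H as [[_ O]|[[u1 [a1 [R1 [u2 [a2 [R2 [[d [_ [O1 O]]] O2]]]]]]]|[u1 [a1 [_ [x' [w [_ [_ [_ O]]]]]]]]]].
        + apply (isop_op HM), (op_inj HM) in O as [E _]; symmetry in E; destruct (e01 E).
        + apply (isop_op HM), (op_inj HM) in O as [_ E]; apply (isop_op HM) in O1, O2; subst d a'.
          apply (op_inj HM) in E as [<- <-]; rewrite (IHu u a1 R1 eq_refl), (IHv v a2 R2 eq_refl); reflexivity.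
        + apply (isop_op HM), (op_inj HM) in O as [E _]; destruct (e12 E).
      - intros u a w Hu IHu Hk u' a' H ->.
        apply INV in H as [[_ O]|[[u1 [a1 [R1 [u2 [a2 [R2 [[d [_ [O1 O]]] O2]]]]]]]|[u1 [a1 [R1 [x' [w' [Hk' [E1 [E2 O]]]]]]]]]].
        + apply (isop_op HM), (op_inj HM) in O as [E _]; symmetry in E; destruct (e02 E).
        + apply (isop_op HM), (op_inj HM) in O as [E _]; symmetry in E; destruct (e12 E).
        + apply (isop_op HM), (op_inj HM) in O as [_ E]; subst u1 x' w'.
          rewrite (IHu u a1 R1 eq_refl) in Hk'; exact (Fk a a' w Hk' Hk). }
    intros u y y' H H'; symmetry; exact (FU u y H u y' H' eq_refl).
  - intros u a H; apply HR' in H; tauto.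
  - intros x Hx; eauto.
  - intros u a v b Hu Hv; eauto.
  - intros u a w Hu Hk; eauto.
Qed.

(** A single Skolem function suffices: it takes a tuple to the least witness, in a well-order of
    [Z], of the combined formula [star], the choice of subformula being part of the tuple. *)
Lemma elementary_hull (p : form) : exists R, fnl R /\ (forall u a, rel R u a -> mem u t /\ mem a Z) /\
  (forall x, mem x t -> exists u, rel R u x) /\
  forall v, (forall k, exists u, rel R u (v k)) ->
    satR M (fun x => exists u, rel R u x) v p <-> satR M (fun x => mem x Z) v p.
Proof.
  destruct (m_wo M HM Z) as [r [_ [Ir [Tr [To Le]]]]].
  set (l := wits p).
  assert (Cl : exists n, forall a : form, In a l -> closed_at (S n) a).
  { clearbody l; induction l as [|a l [n IH]]; [exists 0; intros a []|].
    destruct (closed_at_ex a) as [m Hm]; exists (n + m); intros b [<-|Hb].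
    - apply (closed_at_mono _ m); [lia|exact Hm].
    - apply (closed_at_mono _ (S n)); [lia|auto]. }
  destruct Cl as [n Cl].
  (* Tuples have [n] parameters, [length l] selectors and one reference entry. *)
  set (N := n + S (length l)).
  assert (Cstar : closed_at (S N) (star n l)).
  { unfold star.
    assert (G : forall l', (forall i, In i l' -> i < length l) ->
      closed_at (S N) (bigand (map (fun i => Imp (Eq (S (n + i)) (S (n + length l))) (nth i l Fal)) l'))).
    { induction l' as [|i l' IH]; intros Hl'; cbn; [auto|].
      assert (Hi : i < length l) by (apply Hl'; cbn; auto).
      split; [split|apply IH; intros j Hj; apply Hl'; cbn; auto].
      - unfold N; lia.
      - apply (closed_at_mono _ (S n)); [unfold N; lia|apply Cl, nth_In, Hi]. }
    apply G; intros i Hi; apply in_seq in Hi; lia. }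
  (* The witness variable moves from position 0 to position [N], behind the tuple. *)
  set (b := ren (N .: fun k => k) (star n l)).
  set (zz := fun x => mem x Z).
  set (Q := fun x w => exists u, tup N u x /\ satR M zz (app N u (fun _ => w)) b).
  assert (DQ : forall m (X W : ctx M m -> M), term full m X -> term full m W -> D0 m (fun e => Q (X e) (W e))).
  { intros m X W HX HW; exact (Def_tup Z b N m X (fun _ => W) HX (fun _ => HW)). }
  assert (Qv : forall x v w, tup N v x -> Q x w <-> satR M zz (w .: v) (star n l)).
  { intros x v w Hx.
    assert (E : forall u, (forall k, k < N -> u k = v k) ->
      satR M zz (app N u (fun _ => w)) b <-> satR M zz (w .: v) (star n l)).
    { intros u Hu; unfold b; rewrite satR_ren; apply (satR_closed M zz _ (S N)); [exact Cstar|].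
      intros [|k] Hk; cbn; unfold app.
      - rewrite Nat.ltb_irrefl; reflexivity.
      - replace (k <? N) with true; [apply Hu; lia|]; symmetry; apply Nat.ltb_lt; lia. }
    split.
    - intros [u [Hu H]]; apply (E u); [intros k Hk; apply (tup_inj N u v x); auto|exact H].
    - intros H; exists v; split; [exact Hx|apply E; auto]. }
  destruct (mkrel HM (fun x w => Q x w /\ forall w', mem w' Z -> Q x w' -> w = w' \/ rel r w w') Z Z) as [k [_ Hk]].
  { dsolve; apply DQ; tsolve. }
  destruct (hull_ex k) as [R [FR [RR [R0 [R1 R2]]]]].
  { intros x w w' H H'; apply Hk in H as [_ [Hw [H1 H2]]]; apply Hk in H' as [_ [Hw' [H1' H2']]].
    destruct (H2 w' Hw' H1') as [|L]; [assumption|]; destruct (H2' w Hw H1) as [|L']; [congruence|].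
    destruct (Ir w Hw); exact (Tr w Hw w' Hw' w Hw L L'). }
  { intros x w H; apply Hk in H; tauto. }
  exists R; split; [exact FR|]; split; [exact RR|]; split; [exact R0|].
  apply (tarski_vaught M (fun x => exists u, rel R u x) zz); [intros x [u Hu]; apply (RR u x Hu)|].
  intros a Ha v Hv [w [Zw Hw]].
  destruct (In_nth l a Fal Ha) as [i [Hi Ei]].
  set (v' := sel n i (length l) e0 e1 v).
  assert (Sv : forall w, satR M zz (w .: v') (star n l) <-> satR M zz (w .: v) a).
  { intros w'; rewrite <- Ei; apply (satR_star M zz v w' n l i e0 e1 e01 Cl Hi). }
  assert (Hv' : forall k, exists u, rel R u (v' k)).
  { intros j; unfold v', sel; destruct (j <? n); [apply Hv|].
    destruct (orb (j =? n + i) (j =? n + length l)); apply R0; [apply e1_t|apply e0_t]. }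
  assert (Hx : forall m, exists x u, rel R u x /\ tup m v' x).
  { induction m as [|m [x [u [Hu Hx]]]].
    - destruct (R0 e0 e0_t) as [u Hu]; exists e0, u; cbn; auto.
    - destruct (Hv' m) as [u1 Hu1], (R1 u1 (v' m) u x Hu1 Hu) as [c Hc].
      exists (op (v' m) x), c; split; [exact Hc|]; exists x; split; [apply (isop_op HM); reflexivity|exact Hx]. }
  destruct (Hx N) as [x [u [Hu Tx]]].
  destruct (sep HM (fun w => Q x w) Z) as [s Hs]; [apply DQ; tsolve|].
  destruct (Le s) as [m [Hm Lm]].
  { intros z Hz; apply Hs in Hz; tauto. }
  { exists w; apply Hs; split; [exact Zw|]; apply (Qv x v' w Tx), Sv, Hw. }
  apply Hs in Hm as [Zm Qm].
  destruct (R2 u x m Hu) as [c Hc].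
  { apply Hk; split; [apply (RR u x Hu)|]; split; [exact Zm|]; split; [exact Qm|].
    intros w' Zw' Qw'; apply Lm, Hs; auto. }
  exists m; split; [eauto|]; apply Sv, (Qv x v' m Tx), Qm.
Qed.

Lemma lowenheim_skolem (p : form) (v : nat -> M) : (forall k, mem (v k) t) ->
  satR M (fun x => mem x Z) v p ->
  exists c f, trans c /\ sub t c /\ Surj f t c /\ satR M (fun x => mem x c) v p.
Proof.
  intros Hv Hp.
  (* Extensionality is carried along with [p], so that the hull is extensional and its collapse
     injective. *)
  destruct (elementary_hull (And p ax_ext)) as [R [FR [RR [R0 EH]]]].
  set (A := fun x => exists u, rel R u x).
  destruct (proj2 (EH v (fun k => R0 (v k) (Hv k)))) as [HpA ExtA].
  { split; [exact Hp|]; intros a Ha b Hb H; apply (ext HM); intros z; split; intros Hz; apply (H z); auto.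
    - exact (TZ a Ha z Hz).
    - exact (TZ b Hb z Hz). }
  assert (ExtA' : forall a b, A a -> A b -> (forall z, A z -> mem z a <-> mem z b) -> a = b).
  { intros a b Ha Hb H; apply (ExtA a Ha b Hb); intros z Hz; apply H, Hz. }
  destruct (sep HM (fun x => exists u x', rel R u x' /\ x' = x) Z) as [As HAs]; [dsolve|].
  assert (HA : forall x, mem x As <-> A x).
  { intros x; rewrite HAs; split; [intros [_ [u [x' [H ->]]]]; exists u; exact H|].
    intros [u H]; split; [apply (RR u x H)|exists u, x; auto]. }
  destruct (mkrel HM (fun a b => mem a b) As As) as [E [_ HE]]; [dsolve|].
  assert (W : wf As E).
  { intros s Hs Ne; destruct (found HM s Ne) as [m [Hm Hmin]]; exists m; split; [exact Hm|].
    intros z Hz R'; apply HE in R' as [_ [_ R']]; exact (Hmin z R' Hz). }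
  destruct (collapse HM As E W) as [g [At Tot]].
  assert (Fg : fnl g) by (intros u y y'; apply (At_unique HM As E g g W At At)).
  destruct (sep HM (fun y => exists u y', rel g u y' /\ y' = y) (fld g)) as [c Hc0]; [dsolve|].
  assert (Hc : forall y, mem y c <-> exists u, rel g u y).
  { intros y; rewrite Hc0; split; [intros [_ [u [y' [H ->]]]]; eauto|].
    intros [u H]; split; [apply (rel_fld HM g u y H)|eauto]. }
  assert (inj : forall a, mem a As -> forall u y, rel g u y -> u = a ->
    forall u' y', rel g u' y' -> y = y' -> u = u').
  { apply (mem_ind HM (fun a => forall u y, rel g u y -> u = a ->
      forall u' y', rel g u' y' -> y = y' -> u = u')).
    - dsolve.
    - intros a Ha IH u y Hu -> u' y' Hu' <-.
      destruct (At a y Hu) as [_ [A2 A3]], (At u' y Hu') as [Hu'A [A2' A3']].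
      apply ExtA'; [apply HA, Ha|apply HA, Hu'A|]; intros z Hz; apply HA in Hz; split; intros Hza.
      + destruct (A3 z Hz) as [q [Hq Gq]]; [apply HE; auto|].
        destruct (A2' q Hq) as [z' [Hz' [Ez' Gz']]]; apply HE in Ez' as [_ [_ Ez']].
        rewrite (IH z Hza Hz z q Gq eq_refl z' q Gz' eq_refl); exact Ez'.
      + destruct (A3' z Hz) as [q [Hq Gq]]; [apply HE; auto|].
        destruct (A2 q Hq) as [z' [Hz' [Ez' Gz']]]; apply HE in Ez' as [_ [_ Ez']].
        rewrite <- (IH z' Ez' Hz' z' q Gz' eq_refl z q Gq eq_refl); exact Ez'. }
  (* [t] is transitive and contained in the hull, so the collapse fixes it pointwise, and with it
     the parameters of [p]. *)
  assert (fixt : forall x, mem x t -> forall u y, rel g u y -> u = x -> y = x).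
  { apply (mem_ind HM (fun x => forall u y, rel g u y -> u = x -> y = x)); [dsolve|].
    intros x Hx IH u y Hu ->; destruct (At x y Hu) as [HxA [A2 A3]]; apply (ext HM); intros z; split; intros Hz.
    - destruct (A2 z Hz) as [w [Hw [Ew Gw]]]; apply HE in Ew as [_ [_ Ew]].
      rewrite (IH w Ew (Tt x Hx w Ew) w z Gw eq_refl); exact Ew.
    - assert (HzA : mem z As) by (apply HA, R0, (Tt x Hx z Hz)).
      destruct (A3 z HzA) as [q [Hq Gq]]; [apply HE; auto|].
      rewrite (IH z Hz (Tt x Hx z Hz) z q Gq eq_refl) in Hq; exact Hq. }
  assert (gt : forall x, mem x t -> rel g x x).
  { intros x Hx; destruct (Tot x) as [y Hy]; [apply HA, R0, Hx|].
    rewrite (fixt x Hx x y Hy eq_refl) in Hy; exact Hy. }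
  destruct (mkrel HM (fun u y => exists u' a, rel R u' a /\ (u' = u /\ exists a' y', rel g a' y' /\ (a' = a /\ y' = y))) t c)
    as [f [_ Hf]]; [dsolve|].
  exists c, f; split; [|split; [|split]].
  - intros y Hy z Hz; apply Hc in Hy as [u Hu]; destruct (At u y Hu) as [_ [A2 _]].
    destruct (A2 z Hz) as [w [_ [_ Gw]]]; apply Hc; eauto.
  - intros x Hx; apply Hc; exists x; auto.
  - split.
    + intros u y y' H H'; apply Hf in H as [_ [_ [u1 [a [R1 [-> [a1 [y1 [G1 [-> ->]]]]]]]]]].
      apply Hf in H' as [_ [_ [u2 [a' [R2 [-> [a2 [y2 [G2 [-> ->]]]]]]]]]].
      rewrite (FR u a' a R2 R1) in G2; exact (Fg a y y' G1 G2).
    + intros y Hy; assert (Hy' := Hy); apply Hc in Hy' as [a Ga].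
      destruct (proj1 (HA a) (proj1 (At a y Ga))) as [u Hu]; exists u; split; [apply (RR u a Hu)|].
      apply Hf; split; [apply (RR u a Hu)|]; split; [exact Hy|]; exists u, a; split; [exact Hu|].
      split; [reflexivity|]; exists a, y; auto.
  - apply (satR_iso M A (fun x => mem x c) (fun x y => rel g x y)) with (v := v); [| | | | |exact HpA].
    + intros x Hx; apply HA in Hx; destruct (Tot x Hx) as [y Hy]; exists y; split; [apply Hc; eauto|exact Hy].
    + intros y Hy; apply Hc in Hy as [x Hx]; exists x; split; [apply HA, (At x y Hx)|exact Hx].
    + intros x x' y y' H H'; split; [intros <-; exact (Fg x y y' H H')|].
      intros <-; exact (inj x (proj1 (At x y H)) x y H eq_refl x' y H' eq_refl).
    + intros x x' y y' H H'; destruct (At x' y' H') as [Hx' [A2 A3]]; assert (Hx := proj1 (At x y H)); split; intros Hm.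
      * destruct (A3 x Hx) as [q [Hq Gq]]; [apply HE; auto|]; rewrite (Fg x y q H Gq); exact Hq.
      * destruct (A2 y Hm) as [w [Hw [Ew Gw]]]; apply HE in Ew as [_ [_ Ew]].
        rewrite (inj x Hx x y H eq_refl w y Gw eq_refl); exact Ew.
    + intros j; apply gt, Hv.
Qed.

End Hull.

(** * Classes satisfying MOST *)

Section KClass.
Context {M : structure} (HM : most M).
Implicit Types x y z c d f g q r w : M.

Local Notation emp := (emp HM).
Local Notation pr := (pr HM).
Local Notation sg := (sg HM).
Local Notation un := (un HM).
Local Notation bun := (bun HM).
Local Notation pw := (pw HM).
Local Notation prod := (prod HM).

(** The good classes. Closure under subsets is left to transitivity and power sets. [k_img] asks for
    one member bounding all transitive images of a given member, which is what collection inside the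
    class relies on. *)
Record kclass (K : M -> Prop) : Prop := {
  k_tr : forall x y, K y -> mem x y -> K x;
  k_pr : forall x y, K x -> K y -> K (pr x y);
  k_un : forall x, K x -> K (un x);
  k_pw : forall x, K x -> K (pw x);
  k_surj : forall x f c, K x -> trans c -> Surj f x c -> K c;
  k_inf : exists i, K i /\ inductive i;
  k_img : forall s, K s -> exists h, K h /\ forall t f, trans t -> Surj f s t -> mem t h;
  k_trans : forall x, K x -> exists t, K t /\ trans t /\ mem x t }.

(** The witnesses of the existential block are packed into [z] by iterated pairing, so a transitive
    set containing [z] contains them all. *)
Lemma sigma1_reflect a : Sigma1 a -> forall v : nat -> M, sat M v a ->
  exists z, forall Z, trans Z -> mem z Z -> (forall k, mem (v k) Z) -> satR M (fun x => mem x Z) v a.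
Proof.
  induction 1 as [a Ha|a _ IH]; intros v H.
  - exists emp; intros Z TZ _ Hv; apply Delta0_abs; auto.
    intros x y Hy Hx; exact (TZ y Hy x Hx).
  - destruct H as [x H]; destruct (IH _ H) as [z Hz]; exists (pr x z); intros Z TZ HZ Hv.
    assert (Hx : mem x Z) by (apply (TZ _ HZ), (in_pr HM); auto).
    exists x; split; [exact Hx|]; apply Hz; [exact TZ|apply (TZ _ HZ), (in_pr HM); auto|].
    intros [|k]; cbn; auto.
Qed.

(** The statement is reflected into a pair-closed transitive [Z] above [t]; the hull of [t] in [Z]
    is then collapsed. Witnesses of unknown size are thereby traded for witnesses no larger than
    [t]. *)
Lemma sigma1_small a t (v : nat -> M) : Sigma1 a -> trans t -> pclosed t -> (forall k, mem (v k) t) ->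
  sat M v a -> exists c f, trans c /\ sub t c /\ Surj f t c /\ satR M (fun x => mem x c) v a.
Proof.
  intros Sa Tt Pt Hv H; destruct (sigma1_reflect a Sa v H) as [z Hz].
  destruct (pair_closed_around HM (pr t z)) as [Z [TZ [PZ HZ]]].
  assert (tZ : sub t Z) by (apply TZ; apply (TZ _ HZ), (in_pr HM); auto).
  apply (lowenheim_skolem HM t Z Tt Pt TZ PZ tZ (v 0) (Hv 0) a v Hv).
  apply Hz; [exact TZ|apply (TZ _ HZ), (in_pr HM); auto|intros k; apply tZ, Hv].
Qed.

Lemma satR_isop (K : M -> Prop) : (forall x y, K y -> mem x y -> K x) ->
  forall (v : nat -> M) (m a b : nat), K (v m) -> K (v a) -> K (v b) ->
  satR M K v (IsOPair m a b) <-> isop (v m) (v a) (v b).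
Proof.
  intros HK.
  assert (P : forall (v : nat -> M) (m a b : nat), K (v m) -> K (v a) -> K (v b) ->
    satR M K v (IsPair m a b) <-> ispair (v m) (v a) (v b)).
  { intros v m a b Hm Ha Hb; cbn; split.
    - intros H w; split; [intros Hw; apply H; eauto|intros [-> | ->]; apply H; auto].
    - intros H w _; apply H. }
  intros v m a b Hm Ha Hb; split.
  - intros [p [Kp [q [Kq [H1 [H2 H3]]]]]]; exists p, q.
    apply P in H1; apply P in H2; apply P in H3; cbn in *; auto.
  - intros [p [q [H1 [H2 H3]]]].
    assert (Kp : K p) by (apply (HK p (v m) Hm), H3; auto).
    assert (Kq : K q) by (apply (HK q (v m) Hm), H3; auto).
    exists p; split; [exact Kp|]; exists q; split; [exact Kq|].
    split; [|split]; apply P; cbn; auto.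
Qed.

Lemma satR_rel (K : M -> Prop) : (forall x y, K y -> mem x y -> K x) ->
  forall (v : nat -> M) (m a b : nat), K (v m) -> K (v a) -> K (v b) ->
  satR M K v (Rel m a b) <-> rel (v m) (v a) (v b).
Proof.
  intros HK v m a b Hm Ha Hb; split.
  - intros [z [Kz [Hz H]]]; exists z; split; [exact Hz|].
    apply (satR_isop K HK (z .: v) 0 (S a) (S b)) in H; cbn; auto.
  - intros [z [Hz H]]; assert (Kz : K z) by (apply (HK z (v m)); auto).
    exists z; split; [exact Kz|]; split; [exact Hz|].
    apply (satR_isop K HK (z .: v) 0 (S a) (S b)); cbn; auto.
Qed.

Context (K : M -> Prop) (HK : kclass K).

Lemma k_sub x y : K y -> sub x y -> K x.
Proof. intros Hy S; apply (k_tr K HK x (pw y)); [apply (k_pw K HK), Hy|apply (in_pw HM), S]. Qed.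

Lemma k_bun x y : K x -> K y -> K (bun x y).
Proof. intros Hx Hy; apply (k_un K HK), (k_pr K HK); assumption. Qed.

Lemma k_prod x y : K x -> K y -> K (prod x y).
Proof.
  intros Hx Hy; apply (k_sub _ (pw (pw (bun x y)))).
  - do 2 apply (k_pw K HK); apply k_bun; assumption.
  - intros z Hz; apply (mem_prod HM) in Hz as [u [Hu [w [Hw Ho]]]]; apply (isop_op HM) in Ho; subst z.
    apply (in_pw HM); intros p Hp; apply (in_pw HM); intros o Ho; apply (in_bun HM).
    apply (in_pr HM) in Hp as [-> | ->]; [apply (in_sg HM) in Ho; subst; auto|].
    apply (in_pr HM) in Ho as [-> | ->]; auto.
Qed.

Lemma k_pclosed x : K x -> exists t, K t /\ trans t /\ pclosed t /\ mem x t.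
Proof.
  intros Hx; destruct (k_trans K HK x Hx) as [t [Kt [Tt Hxt]]], (k_inf K HK) as [i [Ki Hi]].
  destruct (pair_closure HM i t Hi Tt) as [Z [f [B [[TZ [SZ PZ]] [Sf SB]]]]].
  exists Z; split; [|auto].
  apply (k_surj K HK B f Z); [|exact TZ|exact Sf].
  apply (k_sub B (pw (prod (pw i) t))); [|exact SB].
  apply (k_pw K HK), k_prod; [apply (k_pw K HK), Ki|exact Kt].
Qed.

Lemma k_params n (v : nat -> M) : (forall k, K (v k)) ->
  exists t, K t /\ trans t /\ pclosed t /\ forall k, k <= n -> mem (v k) t.
Proof.
  intros Hv.
  assert (H : exists x, K x /\ forall k, k <= n -> mem (v k) x).
  { induction n as [|n [x [Kx Hx]]].
    - exists (sg (v 0)); split; [apply (k_pr K HK); auto|]; intros k Hk; replace k with 0 by lia; apply (in_sg HM); auto.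
    - exists (bun x (sg (v (S n)))); split; [apply k_bun; [exact Kx|apply (k_pr K HK); auto]|].
      intros k Hk; apply (in_bun HM); destruct (Nat.eq_dec k (S n)) as [->|]; [right; apply (in_sg HM); reflexivity|].
      left; apply Hx; lia. }
  destruct H as [x [Kx Hx]], (k_pclosed x Kx) as [t [Kt [Tt [Pt Ht]]]].
  exists t; repeat split; auto; intros k Hk; exact (Tt x Ht _ (Hx k Hk)).
Qed.

(** Repeats the value at [n] beyond [n], so that a whole assignment lies in one set; a formula
    closed at [n] cannot tell the difference. *)
Definition cap (n : nat) (v : nat -> M) (k : nat) : M := v (Nat.min k n).

Lemma satR_cap n L a v : closed_at n a -> satR M L (cap n v) a <-> satR M L v a.
Proof.
  intros Hc; apply (satR_closed M L a n); [exact Hc|]; intros k Hk; unfold cap; f_equal; lia.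
Qed.

Lemma k_sigma1 a v : Sigma1 a -> (forall k, K (v k)) -> satR M K v a <-> sat M v a.
Proof.
  intros Sa Hv; destruct (closed_at_ex a) as [n Hn].
  rewrite <- (satR_cap n K a v Hn), <- (satR_True M a v), <- (satR_cap n _ a v Hn), (satR_True M a (cap n v)).
  split.
  - intros H; apply satR_True; revert H; apply Sigma1_up; auto; [apply (k_tr K HK)|intros k; apply Hv].
  - intros H; destruct (k_params n v Hv) as [t [Kt [Tt [Pt Ht]]]].
    destruct (sigma1_small a t (cap n v) Sa Tt Pt) as [c [f [Tc [Sc [Sf Hc]]]]].
    { intros k; apply Ht; lia. }
    { exact H. }
    assert (Kc : K c) by (apply (k_surj K HK t f c); assumption).
    revert Hc; apply Sigma1_up; auto.
    + intros x y Hy Hx; exact (Tc y Hy x Hx).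
    + apply (k_tr K HK).
    + intros x Hx; exact (k_tr K HK x c Kc Hx).
    + intros k; apply Sc, Ht; lia.
Qed.

(** Let [t] in the class contain [w] and the parameters. By [sigma1_small] each [x] in [w] has a
    witness, perhaps a new one, in a transitive image of [t]; [k_img] puts all these images into one
    member of the class. *)
Lemma k_coll a v w : Delta0 a -> (forall k, K (v k)) -> K w ->
  (forall x, mem x w -> exists y, K y /\ sat M (y .: x .: v) a) ->
  exists c, K c /\ forall x, mem x w -> exists y, mem y c /\ sat M (y .: x .: v) a.
Proof.
  intros Da Hv Kw H; destruct (closed_at_ex a) as [n Hn].
  destruct (k_params (S n) (w .: v)) as [t [Kt [Tt [Pt Ht]]]]; [intros [|k]; cbn; auto|].
  destruct (k_img K HK t Kt) as [h [Kh Hh]], (k_trans K HK h Kh) as [h' [Kh' [Th' Hh']]].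
  exists h'; split; [exact Kh'|]; intros x Hx; destruct (H x Hx) as [y [Ky Hy]].
  assert (Hwt : mem w t) by (apply (Ht 0); lia).
  assert (E : forall y, sat M (y .: x .: cap n v) a <-> sat M (y .: x .: v) a).
  { intros y'; apply (sat_closed M a n); [exact Hn|]; intros [|[|k]] Hk; cbn; auto; unfold cap; f_equal; lia. }
  assert (Hvt : forall k, mem ((x .: cap n v) k) t).
  { intros [|k]; cbn; [exact (Tt w Hwt x Hx)|]; apply (Ht (S (Nat.min k n))); lia. }
  destruct (sigma1_small (Ex a) t (x .: cap n v)) as [c [f [Tc [Sc [Sf Hc]]]]]; auto.
  { apply Sigma1_ex, Sigma1_Delta0, Da. }
  { exists y; apply E, Hy. }
  destruct Hc as [y' [Hy' Sy']]; exists y'; split.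
  - apply (Th' c); [apply (Th' h Hh'), (Hh c f Tc Sf)|exact Hy'].
  - apply E, (Delta0_abs M (fun z => mem z c)); [intros p q Hq Hp; exact (Tc q Hq p Hp)|exact Da| |exact Sy'].
    intros [|k]; cbn; [exact Hy'|]; apply Sc, Hvt.
Qed.

Lemma kclass_Mac a : Mac a -> ~ separation Delta0 a -> forall v, (forall k, K (v k)) -> satR M K v a.
Proof.
  assert (tr := k_tr K HK).
  intros Ha Hs v Hv; destruct Ha as [| | | | | | |a Ha| |].
  - intros x Kx y Ky H; apply (ext HM); intros z; split; intros Hz; apply (H z); eauto.
  - intros x Kx y Ky; exists (pr x y); split; [apply (k_pr K HK); auto|]; intros w _; apply (in_pr HM).
  - destruct (k_inf K HK) as [i [Ki [[o [Ho Eo]] _]]]; exists o; split; [eauto|]; intros z _; apply Eo.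
  - intros x Kx; exists (un x); split; [apply (k_un K HK); auto|]; intros z _; split; intros H.
    + apply (in_un HM) in H as [y [H1 H2]]; exists y; repeat split; eauto.
    + destruct H as [y [_ [H1 H2]]]; apply (in_un HM); eauto.
  - destruct (k_inf K HK) as [i [Ki [[o [Ho Eo]] Si]]]; exists i; split; [exact Ki|]; split.
    + exists o; split; [eauto|]; split; [exact Ho|]; intros z _; apply Eo.
    + intros n Kn Hn; destruct (Si n Hn) as [m [Hm Sm]]; exists m; split; [eauto|]; split; [exact Hm|].
      intros w _; apply Sm.
  - intros x Kx; exists (pw x); split; [apply (k_pw K HK); auto|]; intros z Kz; split; intros H.
    + apply (in_pw HM) in H; intros w _ Hw; exact (H w Hw).
    + apply (in_pw HM); intros w Hw; apply (H w); eauto.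
  - intros x Kx; destruct (k_trans K HK x Kx) as [t [Kt [Tt Hx]]]; exists t; split; [exact Kt|]; split.
    + intros z _ Hz; exact (Tt x Hx z Hz).
    + intros z _ Hz w _ Hw; exact (Tt z Hz w Hw).
  - destruct (Hs Ha).
  - intros x Kx [z [_ Hz]]; destruct (found HM x) as [y [Hy Hmin]]; [exists z; exact Hz|].
    exists y; split; [eauto|]; split; [exact Hy|]; intros w _ Hw Hw'; exact (Hmin w Hw Hw').
  - intros x Kx; destruct (m_wo M HM x) as [r [W1 [W2 [W3 [W4 W5]]]]].
    assert (Kr : K r).
    { apply (k_sub r (prod x x)); [apply k_prod; assumption|].
      intros z Hz; destruct (W1 z Hz) as [y [Hy [w [Hw Ho]]]]; apply (mem_prod HM); eauto. }
    exists r; split; [exact Kr|].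
    split; [|split; [|split; [|split]]].
    + intros z Kz Hz; destruct (W1 z Hz) as [y [Hy [w [Hw Ho]]]].
      assert (Ky : K y) by eauto; assert (Kw : K w) by eauto.
      exists y; split; [exact Ky|]; split; [exact Hy|]; exists w; split; [exact Kw|]; split; [exact Hw|].
      exact (proj2 (satR_isop K tr (w .: y .: z .: r .: x .: v) 2 1 0 Kz Ky Kw) Ho).
    + intros y Ky Hy R.
      exact (W2 y Hy (proj1 (satR_rel K tr (y .: r .: x .: v) 1 0 0 Kr Ky Ky) R)).
    + intros y Ky Hy z Kz Hz w Kw Hw R1 R2.
      apply (proj2 (satR_rel K tr (w .: z .: y .: r .: x .: v) 3 2 0 Kr Ky Kw)).
      apply (W3 y Hy z Hz w Hw).
      * exact (proj1 (satR_rel K tr (w .: z .: y .: r .: x .: v) 3 2 1 Kr Ky Kz) R1).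
      * exact (proj1 (satR_rel K tr (w .: z .: y .: r .: x .: v) 3 1 0 Kr Kz Kw) R2).
    + intros y Ky Hy z Kz Hz; destruct (W4 y Hy z Hz) as [R|[E|R]].
      * left; exact (proj2 (satR_rel K tr (z .: y .: r .: x .: v) 2 1 0 Kr Ky Kz) R).
      * right; left; exact E.
      * right; right; exact (proj2 (satR_rel K tr (z .: y .: r .: x .: v) 2 0 1 Kr Kz Ky) R).
    + intros s Ks Hs' [z [_ Hz]]; destruct (W5 s) as [m [Hm Lm]].
      * intros q Hq; apply (Hs' q); [apply (tr q s); auto|exact Hq].
      * exists z; exact Hz.
      * assert (Km : K m) by (apply (tr m s); auto).
        exists m; split; [exact Km|]; split; [exact Hm|]; intros q Kq Hq.
        destruct (Lm q Hq) as [E|R]; [left; exact E|right].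
        exact (proj2 (satR_rel K tr (q .: m .: s .: r .: x .: v) 3 1 0 Kr Km Kq) R).
Qed.

Theorem kclass_MOST : models (substructure M K) MOST.
Proof.
  assert (Sep : forall b, separation Sigma1 b -> forall v, sat (substructure M K) v b).
  { intros b [n [a [Sa [_ ->]]]]; apply sep_instance_sat; intros v [w Kw].
    destruct (m_ssep M HM a Sa (fun k => proj1_sig (v k)) w) as [y Hy].
    assert (Ky : K y) by (apply (k_sub y w Kw); intros z Hz; apply Hy in Hz; tauto).
    exists (exist _ y Ky); intros [x Kx]; cbn; rewrite Hy, sat_substructure, scons_map.
    rewrite k_sigma1; [tauto|exact Sa|]; intros [|k]; cbn; [exact Kx|apply (proj2_sig (v k))]. }
  split.
  - destruct (k_inf K HK) as [i [Ki _]]; constructor; exact (exist _ i Ki).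
  - intros a [b Hb|b Hb|b Hb] v.
    (* A Delta0-separation axiom is treated as an instance of Sigma1-separation. *)
    + destruct (classic (separation Delta0 b)) as [[n [c [Dc E]]]|N].
      * apply Sep; exists n, c; split; [constructor; exact Dc|exact E].
      * apply sat_substructure, kclass_Mac; [exact Hb|exact N|intros k; apply (proj2_sig (v k))].
    + apply Sep, Hb.
    + revert v; destruct Hb as [n [c [Dc [_ ->]]]]; apply coll_instance_sat; intros v [w Kw] H.
      destruct (k_coll c (fun k => proj1_sig (v k)) w Dc (fun k => proj2_sig (v k)) Kw) as [h [Kh Hh]].
      { intros x Hx; assert (Kx : K x) by exact (k_tr K HK x w Kw Hx).
        destruct (H (exist _ x Kx) Hx) as [[y Ky] Hy].
        rewrite sat_substructure, !scons_map in Hy; exists y; split; [exact Ky|].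
        apply (Delta0_abs M K (k_tr K HK) c Dc) in Hy; [exact Hy|].
        intros [|[|k]]; cbn; auto; apply (proj2_sig (v k)). }
      exists (exist _ h Kh); intros [x Kx] Hx; destruct (Hh x Hx) as [y [Hy Sy]].
      assert (Ky : K y) by exact (k_tr K HK y h Kh Hy).
      exists (exist _ y Ky); split; [exact Hy|].
      rewrite sat_substructure, !scons_map; apply (Delta0_abs M K (k_tr K HK) c Dc); [|exact Sy].
      intros [|[|k]]; cbn; auto; apply (proj2_sig (v k)).
Qed.

End KClass.

(** * The fixed initial segment of an automorphism *)

Lemma Delta0P_abs (M : structure) (K : M -> Prop) :
  (forall x y, K y -> mem x y -> K x) -> (forall x y, K y -> sub x y -> K x) ->
  forall a, Delta0P a -> forall v, (forall k, K (v k)) -> satR M K v a <-> sat M v a.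
Proof.
  intros HK HS; induction 1 as [|m n|m n|a b _ IHa _ IHb|a b _ IHa _ IHb|a b _ IHa _ IHb|n a _ IH|n a _ IH|n a _ IH|n a _ IH];
    intros v Hv; cbn; try tauto.
  - rewrite IHa, IHb by assumption; tauto.
  - rewrite IHa, IHb by assumption; tauto.
  - rewrite IHa, IHb by assumption; tauto.
  - assert (L : forall x, K x -> forall k, K ((x .: v) k)) by (intros x Hx [|k]; cbn; auto).
    split.
    + intros H x Hx; assert (Kx : K x) by (apply (HK x (v n)); auto); apply IH; auto.
    + intros H x Kx Hx; apply IH; auto.
  - assert (L : forall x, K x -> forall k, K ((x .: v) k)) by (intros x Hx [|k]; cbn; auto).
    split.
    + intros [x [Kx [Hx H]]]; exists x; split; [exact Hx|]; apply IH; auto.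
    + intros [x [Hx H]]; assert (Kx : K x) by (apply (HK x (v n)); auto).
      exists x; split; [exact Kx|]; split; [exact Hx|]; apply IH; auto.
  - assert (L : forall x, K x -> forall k, K ((x .: v) k)) by (intros x Hx [|k]; cbn; auto).
    split.
    + intros H x Hx; assert (Kx : K x) by (apply (HS x (v n)); auto); apply IH; auto.
    + intros H x Kx Hx; apply IH; auto; apply H; intros z Hz; apply Hx; eauto.
  - assert (L : forall x, K x -> forall k, K ((x .: v) k)) by (intros x Hx [|k]; cbn; auto).
    split.
    + intros [x [Kx [Hx H]]]; exists x; split; [intros z Hz; apply Hx; eauto|]; apply IH; auto.
    + intros [x [Hx H]]; assert (Kx : K x) by (apply (HS x (v n)); auto).
      exists x; split; [exact Kx|]; split; [auto|]; apply IH; auto.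
Qed.

(** * Delta0P formulae are decided near their parameters *)

Section Local.
Context {M : structure} (HM : most M).

(* [near V k x]: [k] successive passages to an element or a subset of [x] stay in [V]. *)
Fixpoint near (V : M -> Prop) (k : nat) (x : M) : Prop :=
  match k with
  | 0 => V x
  | S k => (forall y, mem y x -> near V k y) /\ forall y, sub y x -> near V k y
  end.

Lemma near_S V k x : near V (S k) x -> near V k x.
Proof. intros [_ H]; apply H; intros z Hz; exact Hz. Qed.

Lemma near_le V k m x : k <= m -> near V m x -> near V k x.
Proof. intros L; induction L; auto; intros H; apply IHL, near_S, H. Qed.

(** Each bounded quantifier costs one passage to an element or a subset, so some [k] depending only
    on the formula suffices. Over parameters from a fixed set the formula becomes its relativisation
    to a set, hence Delta0, and separation applies to it. *)
Lemma Delta0P_near a : Delta0P a -> exists k, forall V : M -> Prop, (forall x y, V y -> mem x y -> V x) ->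
  forall v, (forall i, near V k (v i)) -> satR M V v a <-> sat M v a.
Proof.
  assert (N0 : forall V k x, near V k x -> V x) by (intros V k x; apply (near_le V 0 k); lia).
  assert (SC : forall V k x v, near V k x -> (forall i, near V (S k) (v i)) -> forall i, near V k ((x .: v) i)).
  { intros V k x v Hx Hv [|i]; cbn; [exact Hx|apply near_S, Hv]. }
  assert (BIN : forall a b : form, (exists k, forall V : M -> Prop, (forall x y, V y -> mem x y -> V x) ->
      forall v, (forall i, near V k (v i)) -> satR M V v a <-> sat M v a) ->
    (exists k, forall V : M -> Prop, (forall x y, V y -> mem x y -> V x) ->
      forall v, (forall i, near V k (v i)) -> satR M V v b <-> sat M v b) ->
    exists k, forall V : M -> Prop, (forall x y, V y -> mem x y -> V x) ->
      forall v, (forall i, near V k (v i)) ->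
      (satR M V v a <-> sat M v a) /\ (satR M V v b <-> sat M v b)).
  { intros a0 b0 [k1 H1] [k2 H2]; exists (k1 + k2); intros V TV v Hv; split;
      [apply H1|apply H2]; auto; intros i; [apply (near_le V k1 (k1 + k2))|apply (near_le V k2 (k1 + k2))]; auto; lia. }
  induction 1 as [|m n|m n|a b _ IHa _ IHb|a b _ IHa _ IHb|a b _ IHa _ IHb|n a _ [k IH]|n a _ [k IH]|n a _ [k IH]|n a _ [k IH]].
  1-3: exists 0; intros V _ v _; cbn; tauto.
  1-3: destruct (BIN a b IHa IHb) as [k H]; exists k; intros V TV v Hv; cbn; destruct (H V TV v Hv); tauto.
  - exists (S k); intros V TV v Hv; cbn; split.
    + intros H x Hx; assert (Nx := proj1 (Hv n) x Hx); apply (IH V TV); auto; apply H; [exact (N0 V k x Nx)|exact Hx].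
    + intros H x _ Hx; assert (Nx := proj1 (Hv n) x Hx); apply (IH V TV); auto.
  - exists (S k); intros V TV v Hv; cbn; split.
    + intros [x [_ [Hx H]]]; assert (Nx := proj1 (Hv n) x Hx); exists x; split; auto; apply (IH V TV); auto.
    + intros [x [Hx H]]; assert (Nx := proj1 (Hv n) x Hx); exists x; split; [exact (N0 V k x Nx)|]; split; auto; apply (IH V TV); auto.
  - exists (S k); intros V TV v Hv; cbn; split.
    + intros H x Hx; assert (Nx := proj2 (Hv n) x Hx); apply (IH V TV); auto; apply H; [exact (N0 V k x Nx)|intros z _; apply Hx].
    + intros H x Vx Hx; assert (Hx' : sub x (v n)) by (intros z Hz; apply Hx; eauto).
      assert (Nx := proj2 (Hv n) x Hx'); apply (IH V TV); auto.
  - exists (S k); intros V TV v Hv; cbn; split.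
    + intros [x [Vx [Hx H]]]; assert (Hx' : sub x (v n)) by (intros z Hz; apply Hx; eauto).
      assert (Nx := proj2 (Hv n) x Hx'); exists x; split; auto; apply (IH V TV); auto.
    + intros [x [Hx H]]; assert (Nx := proj2 (Hv n) x Hx); exists x; split; [exact (N0 V k x Nx)|]; split; auto; apply (IH V TV); auto.
Qed.

(** External iteration, [k] times, of the union and the power set of the union, followed by passage
    to a transitive superset. *)
Lemma near_set k : forall w : M, exists V, trans V /\ forall x, mem x w -> near (fun z => mem z V) k x.
Proof.
  assert (H : forall w : M, exists V, forall V', sub V V' -> forall x, mem x w -> near (fun z => mem z V') k x).
  { induction k as [|k IH]; intros w.
    - exists w; intros V' S x Hx; apply S, Hx.
    - destruct (IH (bun HM (un HM w) (pw HM (un HM w)))) as [V HV]; exists V; intros V' S x Hx; split.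
      + intros y Hy; apply (HV V' S), (in_bun HM); left; apply (in_un HM); eauto.
      + intros y Hy; apply (HV V' S), (in_bun HM); right; apply (in_pw HM); intros z Hz; apply (in_un HM); eauto. }
  intros w; destruct (H w) as [V HV], (m_tco M HM V) as [V' [S T]]; exists V'; auto.
Qed.

Lemma Def_satR2 (V : M) (v : nat -> M) a n (y x : ctx M n -> M) : term full n y -> term full n x ->
  D0 n (fun e => satR M (fun z => mem z V) (y e .: x e .: v) a).
Proof.
  intros Hy Hx.
  apply (Def_ext n (fun e => satR M (fun z => mem z V) (fun k => (y .: x .: fun k _ => v k) k e) a)).
  - intros e; rewrite (scons_map (fun t : ctx M n -> M => t e)), (scons_map (fun t : ctx M n -> M => t e)); tauto.
  - apply (Def_satR n _ (fun _ => V)); [auto| |tsolve].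
    intros [|[|k]]; [exact Hy|exact Hx|]; apply (term_c n (v k)); exact I.
Qed.

End Local.

(** * Sets with pointwise fixed transitive closure *)

Section Fix.
Context {M : structure} (HM : most M) (j : M -> M) (Hj : automorphism M j).
Implicit Types x y z c f g q r s t u w : M.

Local Notation pr := (pr HM).
Local Notation sg := (sg HM).
Local Notation un := (un HM).
Local Notation bun := (bun HM).
Local Notation pw := (pw HM).
Local Notation prod := (prod HM).

(** Equivalent to the defining condition of [Ifix], by [Ifix_iff], but spared the minimality of the
    transitive closure. *)
Definition fixd x : Prop := exists t, trans t /\ mem x t /\ forall y, mem y t -> j y = y.

Lemma j_surj y : exists x, j x = y.
Proof. destruct Hj as [[g [_ H]] _]; eauto. Qed.
Lemma j_inj x y : j x = j y -> x = y.
Proof. destruct Hj as [[g [H _]] _]; intros E; rewrite <- (H x), <- (H y), E; reflexivity. Qed.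
Lemma j_mem x y : mem x y <-> mem (j x) (j y).
Proof. apply Hj. Qed.

Lemma j_pr x y : j (pr x y) = pr (j x) (j y).
Proof.
  apply (ext HM); intros z; destruct (j_surj z) as [w <-].
  rewrite <- j_mem, !(in_pr HM); split; (intros [E|E]; [left|right]); try congruence; apply j_inj, E.
Qed.

Lemma j_rel f x y : rel f x y <-> rel (j f) (j x) (j y).
Proof.
  rewrite !(rel_op HM), j_mem; unfold op, sg; rewrite !j_pr; tauto.
Qed.

Lemma TC_ex x : exists s t, (forall z, mem z s <-> z = x) /\ is_TC M s t.
Proof.
  destruct (trans_around HM x) as [T [TT Hx]].
  destruct (sep HM (fun y => forall u, mem u (pw T) -> trans u -> mem x u -> mem y u) T) as [t Ht]; [dsolve|].
  exists (sg x), t; split; [intros z; apply (in_sg HM)|]; split; [|split].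
  - intros y Hy z Hz; apply Ht in Hy as [H1 H2]; apply Ht; split; [exact (TT y H1 z Hz)|].
    intros u Hu Tu Hxu; exact (Tu y (H2 u Hu Tu Hxu) z Hz).
  - intros z Hz; apply (in_sg HM) in Hz; subst z; apply Ht; auto.
  - intros u Tu Hu y Hy; apply Ht in Hy as [H1 H2].
    (* Minimality is built in only against subsets of [T], so [u] is first intersected with [T]. *)
    destruct (sep HM (fun z => mem z T) u) as [u' Hu']; [dsolve|].
    apply (Hu' y), H2.
    + apply (in_pw HM); intros z Hz; apply Hu' in Hz; tauto.
    + intros a Ha b Hb; apply Hu' in Ha as [A1 A2]; apply Hu'; split; [exact (Tu a A1 b Hb)|exact (TT a A2 b Hb)].
    + apply Hu'; split; [apply Hu, (in_sg HM); reflexivity|exact Hx].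
Qed.

Lemma Ifix_iff x : (forall y, in_TC_singleton M y x -> j y = y) <-> fixd x.
Proof.
  split.
  - intros H; destruct (TC_ex x) as [s [t [Hs Ht]]]; exists t; split; [apply Ht|]; split.
    + apply (proj1 (proj2 Ht)), Hs; reflexivity.
    + intros y Hy; apply H; exists s, t; auto.
  - intros [t [Tt [Hx Ft]]] y [s [t' [Hs [[_ [_ Min]] Hy]]]]; apply Ft, (Min t Tt); [|exact Hy].
    intros z Hz; apply Hs in Hz; subst z; exact Hx.
Qed.

Lemma fixd_tr x y : fixd y -> mem x y -> fixd x.
Proof. intros [t [Tt [Hy Ft]]] Hx; exists t; split; [exact Tt|]; split; [exact (Tt y Hy x Hx)|exact Ft]. Qed.

Lemma fixd_eq x : fixd x -> j x = x.
Proof. intros [t [_ [Hx Ft]]]; apply Ft, Hx. Qed.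

(** The required transitive set consists of [x] and the closures of its elements, carved out of [T]
    by a condition that does not mention [j]. [x] itself is fixed by extensionality. *)
Lemma fixd_sub x : (forall z, mem z x -> fixd z) -> fixd x.
Proof.
  intros H; destruct (trans_around HM x) as [T [TT Hx]].
  destruct (sep HM (fun y => y = x \/ exists z, mem z x /\ forall u, mem u (pw T) -> trans u -> mem z u -> mem y u) T)
    as [t Ht]; [dsolve|].
  exists t; split; [|split].
  - intros y Hy w Hw; apply Ht in Hy as [H1 H2]; apply Ht; split; [exact (TT y H1 w Hw)|].
    right; destruct H2 as [-> |[z [Hz H2]]]; [exists w; auto|].
    exists z; split; [exact Hz|]; intros u Hu Tu Hzu; exact (Tu y (H2 u Hu Tu Hzu) w Hw).
  - apply Ht; auto.
  - intros y Hy; apply Ht in Hy as [H1 [-> |[z [Hz H2]]]].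
    + apply (ext HM); intros w; split; intros Hw.
      * destruct (j_surj w) as [w' <-]; apply j_mem in Hw; rewrite (fixd_eq w' (H w' Hw)); exact Hw.
      * rewrite <- (fixd_eq w (H w Hw)); apply -> j_mem; exact Hw.
    + destruct (H z Hz) as [u [Tu [Hzu Fu]]]; apply Fu.
      destruct (sep HM (fun a => mem a T) u) as [u' Hu']; [dsolve|].
      apply (Hu' y), H2.
      * apply (in_pw HM); intros a Ha; apply Hu' in Ha; tauto.
      * intros a Ha b Hb; apply Hu' in Ha as [A1 A2]; apply Hu'; split; [exact (Tu a A1 b Hb)|exact (TT a A2 b Hb)].
      * apply Hu'; split; [exact Hzu|exact (TT x Hx z Hz)].
Qed.

(* [f] and [j f] collapse the same relation on [x], whose elements are fixed, so they agree. *)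
Lemma fixd_surj x f c : fixd x -> trans c -> Surj f x c -> fixd c.
Proof.
  intros Fx Tc Sf0; destruct (Surj_tight HM f x c Sf0) as [h [_ [Sh Rh]]].
  assert (jr : forall u y, rel h u y -> rel (j h) u (j y)).
  { intros u y H; assert (E : j u = u) by (apply fixd_eq, (fixd_tr u x Fx), (Rh u y H)).
    rewrite <- E; exact (proj1 (j_rel h u y) H). }
  assert (Fj : fnl (j h)).
  { intros u y y' H H'; destruct (j_surj u) as [u0 <-], (j_surj y) as [y0 <-], (j_surj y') as [y1 <-].
    apply j_rel in H, H'; rewrite (proj1 Sh u0 y0 y1 H H'); reflexivity. }
  assert (R : forall u y, rel h u y -> rel (j h) u y).
  { apply (surj_rigid HM h (j h) x c Tc Sh Fj).
    - intros u y H; apply (Rh u y H).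
    - intros u y H; exists (j y); apply jr, H.
    - intros v u z y z' y' Hv Hu Hv' Hu' Hz.
      rewrite (Fj v z' (j z) Hv' (jr v z Hv)), (Fj u y' (j y) Hu' (jr u y Hu)); apply -> j_mem; exact Hz.
    - intros u y y' z' Hu Hu' Hz'; rewrite (Fj u y' (j y) Hu' (jr u y Hu)) in Hz'.
      destruct (j_surj z') as [z <-]; apply j_mem in Hz'.
      destruct (proj2 Sh z) as [v [_ Hv]]; [exact (Tc y (proj1 (proj2 (Rh u y Hu))) z Hz')|].
      exists v, z; auto. }
  apply fixd_sub; intros y Hy; exists c; split; [exact Tc|]; split; [exact Hy|].
  intros z Hz; destruct (proj2 Sh z Hz) as [u [_ Hu]]; exact (Fj u (j z) z (jr u z Hu) (R u z Hu)).
Qed.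

(** For [k_img], the bound of [images_set] is cut down to actual transitive images of [s]; these are
    all in the segment, hence so is the set of them. *)
Lemma fixd_kclass i : fixd i -> inductive i -> kclass HM fixd.
Proof.
  intros Fi Hi; split.
  - apply fixd_tr.
  - intros x y Fx Fy; apply fixd_sub; intros z Hz; apply (in_pr HM) in Hz as [-> | ->]; assumption.
  - intros x Fx; apply fixd_sub; intros z Hz; apply (in_un HM) in Hz as [w [Hw Hz]].
    apply (fixd_tr z w); [apply (fixd_tr w x)|]; assumption.
  - intros x Fx; apply fixd_sub; intros z Hz; apply (in_pw HM) in Hz; apply fixd_sub; intros w Hw.
    apply (fixd_tr w x); auto.
  - apply fixd_surj.
  - eauto.
  - intros s Fs; destruct (images_set HM s) as [h Hh].
    destruct (ssep HM (fun t f => trans t /\ Surj f s t) h) as [h' Hh']; [dsolve|].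
    exists h'; split.
    + apply fixd_sub; intros t Ht; apply Hh' in Ht as [_ [f [Tt Sf]]]; exact (fixd_surj s f t Fs Tt Sf).
    + intros t f Tt Sf; apply Hh'; split; [exact (Hh t f Tt Sf)|eauto].
  - intros x [t [Tt [Hx Ft]]]; exists t; split; [|auto].
    apply fixd_sub; intros z Hz; exists t; auto.
Qed.

(** If the ordinal enumerating a transitive set around [x] were in the segment, that set would be
    too, as its image, and [x] would be fixed. *)
Lemma moved_ord : (exists x, j x <> x) -> exists d, ord d /\ ~ fixd d.
Proof.
  intros [x Nx]; destruct (trans_around HM x) as [t [Tt Hx]], (ord_enum HM t) as [d [f [g [Od [Sf _]]]]].
  exists d; split; [exact Od|]; intros Fd; apply Nx, fixd_eq, (fixd_tr x t); [|exact Hx].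
  exact (fixd_surj d f t Fd Tt Sf).
Qed.

(* Overspill: the set [A] of ordinals below [d] that bound witnesses contains every ordinal of
   [d] outside the fixed segment; if it contained no other, the fixed ordinals would form a set. *)
Lemma fixd_coll i a (v : nat -> M) w : fixd i -> inductive i -> (exists x, j x <> x) ->
  Delta0P a -> (forall k, fixd (v k)) -> fixd w ->
  (forall x, mem x w -> exists y, fixd y /\ sat M (y .: x .: v) a) ->
  exists c, fixd c /\ forall x, mem x w -> exists y, mem y c /\ sat M (y .: x .: v) a.
Proof.
  intros Fi Hi Mv Da Hv Fw H.
  assert (KC := fixd_kclass i Fi Hi).
  destruct (moved_ord Mv) as [d [Od Nd]].
  destruct (images_set HM d) as [h Hh], (closed_at_ex a) as [n Hn].
  destruct (k_params HM fixd KC n v Hv) as [tp [_ [_ [_ Htp]]]].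
  set (v' := cap n v).
  assert (E : forall y x, sat M (y .: x .: v') a <-> sat M (y .: x .: v) a).
  { intros y x; apply (sat_closed M a n); [exact Hn|]; intros [|[|k]] Hk; cbn; auto; unfold v', cap; f_equal; lia. }
  destruct (Delta0P_near (M := M) a Da) as [k Hk].
  (* All candidate witnesses lie in [un h], so the formula may be evaluated in the set [V]. *)
  destruct (near_set HM k (bun (un h) (bun w tp))) as [V [TV HV]].
  assert (loc : forall y x, mem y (un h) -> mem x w -> satR M (fun z => mem z V) (y .: x .: v') a <-> sat M (y .: x .: v) a).
  { intros y x Hy Hx; rewrite <- E; apply Hk; [intros p q Hq Hp; exact (TV q Hq p Hp)|].
    intros [|[|m]]; cbn; apply HV; rewrite !(in_bun HM); auto; right; right; apply Htp; lia. }
  (* The surjection [f] is sought in a power set, which keeps the condition defining [A] Delta0. *)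
  destruct (sep HM (fun b => forall x, mem x w -> exists t, mem t h /\ exists y, mem y t /\
      (trans t /\ (exists f, mem f (pw (prod d (un h))) /\ Surj f b t) /\
       satR M (fun z => mem z V) (y .: x .: v') a)) d) as [A HA].
  { dsolve; apply Def_satR2; tsolve. }
  (* A transitive [t] in the segment is enumerated by an ordinal [e] of the segment; an ordinal [b]
     outside the segment is not an element of [e], so it includes [e] and also maps onto [t]. *)
  assert (big : forall b, mem b d -> ~ fixd b -> mem b A).
  { intros b Hb Nb; apply HA; split; [exact Hb|]; intros x Hx; destruct (H x Hx) as [y [Fy Sy]].
    destruct (k_trans HM fixd KC y Fy) as [t [Ft [Tt Hyt]]], (ord_enum HM t) as [e [f [g [Oe [Sf Sg]]]]].
    assert (Fe : fixd e) by exact (fixd_surj t g e Ft (proj1 Oe) Sg).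
    destruct (Surj_tight HM f e t Sf) as [f' [Sf' [Sur Rf]]].
    assert (eb : sub e b).
    { destruct (ord_cmp HM e b Oe (ord_mem HM d b Od Hb)) as [S|S]; [exact S|].
      destruct Nb; exact (fixd_tr b e Fe S). }
    assert (ed : sub e d) by (intros z Hz; exact (proj1 Od b Hb z (eb z Hz))).
    assert (Ht : mem t h) by exact (Hh t f' Tt (Surj_mono f' e d t ed Sur)).
    exists t; split; [exact Ht|]; exists y; split; [exact Hyt|]; split; [exact Tt|]; split.
    - exists f'; split; [|exact (Surj_mono f' e b t eb Sur)].
      apply (in_pw HM); intros p Hp; apply Sf', (mem_prod HM) in Hp as [u [Hu [z [Hz Ho]]]].
      apply (mem_prod HM); exists u; split; [auto|]; exists z; split; [apply (in_un HM); eauto|exact Ho].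
    - apply loc; [apply (in_un HM); eauto|exact Hx|exact Sy]. }
  destruct (classic (exists b, mem b A /\ fixd b)) as [[b [Hb Fb]]|N].
  - destruct (k_img HM fixd KC b Fb) as [hb [Fhb Hhb]]; exists (un hb); split; [apply (k_un HM fixd KC), Fhb|].
    apply HA in Hb as [_ Hb]; intros x Hx; destruct (Hb x Hx) as [t [Ht [y [Hy [Tt [[f [_ Sf]] Sy]]]]]].
    exists y; split; [apply (in_un HM); exists t; split; [exact (Hhb t f Tt Sf)|exact Hy]|].
    apply loc; [apply (in_un HM); eauto|exact Hx|exact Sy].
  (* The complement [e] of [A] in [d] would consist of the elements of [d] in the segment. It is
     transitive and itself in the segment, so it is neither [d] nor an element of [d]. *)
  - exfalso; destruct (sep HM (fun b => ~ mem b A) d) as [e He]; [dsolve|].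
    assert (Fe' : forall b, mem b e -> fixd b).
    { intros b Hb; apply He in Hb as [H1 H2]; apply NNPP; intros Nb; apply H2, big; assumption. }
    assert (Fe : fixd e) by (apply fixd_sub, Fe').
    assert (Te : trans e).
    { intros b Hb c Hc; assert (Fc := fixd_tr c b (Fe' b Hb) Hc); apply He in Hb as [H1 _]; apply He.
      split; [exact (proj1 Od b H1 c Hc)|]; intros Hc'; apply N; eauto. }
    destruct (ord_initial HM d e Od Te) as [-> |Hed].
    + intros b Hb; apply He in Hb; tauto.
    + exact (Nd Fe).
    + apply (no_cycle1 HM e), He; split; [exact Hed|]; intros He'; apply N; eauto.
Qed.

End Fix.

(** * Axioms as sentences, and the passage from (II) to (I) *)

Lemma closed_at_alls n : forall m a, closed_at (n + m) a -> closed_at m (alls n a).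
Proof.
  induction n as [|n IH]; intros m a H; cbn; [exact H|]; apply IH; rewrite Nat.add_succ_r; exact H.
Qed.

Lemma closed_at_ren_lt a : forall n r b, closed_at n a -> (forall k, k < n -> r k < b) -> closed_at b (ren r a).
Proof.
  induction a as [|p q|p q|a IHa c IHb|a IHa c IHb|a IHa c IHb|a IHa|a IHa];
    intros n r b Hc H; cbn in *; try (destruct Hc; split); eauto.
  - apply (IHa (S n)); [exact Hc|]; intros [|k] Hk; cbn; [lia|]; assert (r k < b) by (apply H; lia); lia.
  - apply (IHa (S n)); [exact Hc|]; intros [|k] Hk; cbn; [lia|]; assert (r k < b) by (apply H; lia); lia.
Qed.

Lemma sentence_sep n a : closed_at (S n) a -> sentence (sep_instance n a).
Proof.
  intros H; apply closed_at_alls; rewrite Nat.add_0_r; cbn.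
  assert (R : closed_at (S (S (S n))) (ren (0 .: fun k => 3 + k) a)).
  { apply (closed_at_ren_lt a (S n)); [exact H|]; intros [|k] Hk; cbn; lia. }
  repeat split; try lia; exact R.
Qed.

Lemma sentence_coll n a : closed_at (S (S n)) a -> sentence (coll_instance n a).
Proof.
  intros H; apply closed_at_alls; rewrite Nat.add_0_r; cbn.
  repeat split; try lia; apply (closed_at_ren_lt a (S (S n))); try exact H; intros [|[|k]] Hk; cbn; lia.
Qed.

Lemma sentence_MOST a : MOST a -> sentence a.
Proof.
  intros [b Hb|b [n [c [_ [Hc ->]]]]|b [n [c [_ [Hc ->]]]]]; [|apply sentence_sep, Hc|apply sentence_coll, Hc].
  destruct Hb as [| | | | | | |b [n [c [_ [Hc ->]]]]| |]; [..|apply sentence_sep, Hc| |];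
    unfold sentence; cbn; repeat split; lia.
Qed.

(** By completeness it suffices that each axiom holds in the fixed segment: as a model of [T], the
    segment excludes a proof of the negation. *)
Theorem Ifix_theory (T : form -> Prop) (M : structure) (j : M -> M) :
  complete T -> proves T ax_infinity ->
  models M MOST -> automorphism M j -> (exists x, j x <> x) -> models (Ifix M j) T ->
  proves_all T (theory_union MOST (collection Delta0P)).
Proof.
  intros Tc Ti MM Aj Mv MT.
  assert (HM := models_most M MM).
  assert (FE : (fun x => forall y, in_TC_singleton M y x -> j y = y) = fixd j).
  { extensionality x; apply propositional_extensionality, (Ifix_iff HM). }
  unfold Ifix in MT; rewrite FE in MT.
  (* The infinite set of the segment is inductive in [M] too, because the segment is transitive. *)
  assert (Hi : exists i, fixd j i /\ inductive i).
  { destruct MT as [[m0] MT]; destruct (models_proves T _ _ (conj (inhabits m0) MT) Ti (fun _ => m0)) as [[i Fi] [[[o Fo] [Ho Eo]] Si]].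
    exists i; split; [exact Fi|]; split.
    - exists o; split; [exact Ho|]; intros z Hz; exact (Eo (exist _ z (fixd_tr j z o Fo Hz)) Hz).
    - intros n Hn; destruct (Si (exist _ n (fixd_tr j n i Fi Hn)) Hn) as [[m Fm] [Hm Sm]].
      exists m; split; [exact Hm|]; intros w; split.
      + intros Hw; destruct (proj1 (Sm (exist _ w (fixd_tr j w m Fm Hw))) Hw) as [H|H]; [left; exact H|right].
        exact (f_equal (@proj1_sig _ _) H).
      + intros Hw; assert (Fw : fixd j w) by (destruct Hw as [Hw| ->]; [apply (fixd_tr j w n); [apply (fixd_tr j n i)|]|apply (fixd_tr j n i)]; assumption).
        apply (proj2 (Sm (exist _ w Fw))); destruct Hw as [Hw| ->]; [left; exact Hw|right].
        cbn; f_equal; apply proof_irrelevance. }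
  destruct Hi as [i [Fi Hi]].
  assert (KM : models (substructure M (fixd j)) MOST) by exact (kclass_MOST HM _ (fixd_kclass HM j Aj i Fi Hi)).
  assert (ok : forall a, sentence a -> (forall v, sat (substructure M (fixd j)) v a) -> proves T a).
  { intros a Sa H; destruct (Tc a Sa) as [P|P]; [exact P|exfalso].
    destruct MT as [[m0] MT]; exact (models_proves T _ _ (conj (inhabits m0) MT) P (fun _ => m0) (H _)). }
  intros a [Ha|[n [b [Db [Hb ->]]]]].
  - apply ok; [apply sentence_MOST, Ha|]; intros v; apply KM, Ha.
  - apply ok; [apply sentence_coll, Hb|]; apply coll_instance_sat; intros v [w Fw] H.
    assert (abs : forall u, (forall k, fixd j (u k)) -> satR M (fixd j) u b <-> sat M u b).
    { apply Delta0P_abs; [apply fixd_tr| |exact Db].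
      intros x y Fy S; apply (fixd_sub HM j Aj); intros z Hz; exact (fixd_tr j z y Fy (S z Hz)). }
    destruct (fixd_coll HM j Aj i b (fun k => proj1_sig (v k)) w Fi Hi Mv Db (fun k => proj2_sig (v k)) Fw) as [c [Fc Hc]].
    { intros x Hx; assert (Fx := fixd_tr j x w Fw Hx); destruct (H (exist _ x Fx) Hx) as [[y Fy] Hy].
      rewrite sat_substructure, !scons_map in Hy; exists y; split; [exact Fy|].
      apply abs in Hy; [exact Hy|]; intros [|[|k]]; cbn; auto; apply (proj2_sig (v k)). }
    exists (exist _ c Fc); intros [x Fx] Hx; destruct (Hc x Hx) as [y [Hy Sy]].
    exists (exist _ y (fixd_tr j y c Fc Hy)); split; [exact Hy|].
    rewrite sat_substructure, !scons_map; apply abs; [|exact Sy].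
    intros [|[|k]]; cbn; auto; [exact (fixd_tr j y c Fc Hy)|apply (proj2_sig (v k))].
Qed.

(** * The types to be realised *)

Definition dform (k : nat) : form :=
  if excluded_middle_informative (Delta0P (form_enum k)) then form_enum k else Fal.

Lemma dform_Delta0P k : Delta0P (dform k).
Proof. unfold dform; destruct (excluded_middle_informative _); [assumption|constructor]. Qed.

Lemma dform_surj a : Delta0P a -> exists k, dform k = a.
Proof.
  intros Ha; destruct (form_enum_surj a) as [k E]; exists k; unfold dform; rewrite E.
  destruct (excluded_middle_informative _); [reflexivity|contradiction].
Qed.

(* Variables: 0 the realisation, 1 a set, 2 and 3 two elements, then two interleaved tuples. *)
Definition tyI (fl P Q R n k : nat) : form :=
  match k with
  | 0 => if fl =? 0 then Mem 0 1 else Imp Fal Fal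
  | S k => Imp (Ex (ren (0 .: S P .: fun i => 5 + 2 * Nat.min i n) (dform k)))
               (Ex (And (Mem 0 (S Q)) (ren (0 .: S R .: fun i => 6 + 2 * Nat.min i n) (dform k))))
  end.

Definition SurjF (f a c : nat) : form :=
  And (All (All (All (Imp (Rel (3 + f) 2 1) (Imp (Rel (3 + f) 2 0) (Eq 1 0))))))
      (AllIn c (ExIn (S a) (Rel (2 + f) 0 1))).

(** Chosen so that its satisfaction unfolds by conversion to [stepU], the relation between
    consecutive links of the chain. *)
Definition StepF (u w : nat) : form :=
  And (Mem u w) (And (Trans w) (And (AllSub u (Mem 0 (S w)))
    (All (All (Imp (Trans 1) (Imp (SurjF 0 (2 + u) 1) (Mem 1 (2 + w)))))))).

(* [ChainF k] says that variable 0 is (u_0, (u_1, ...)) with [StepF] for the first [k] steps. *)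
Fixpoint ChainF (k : nat) : form :=
  match k with
  | 0 => Imp Fal Fal
  | S k => Ex (Ex (And (IsOPair 2 1 0)
             (And (Ex (Ex (And (IsOPair 2 1 0) (StepF 3 1)))) (ChainF k))))
  end.

(** Variable 1 is the set to be placed in the first link. The realisation codes a chain that can be
    read off at every standard stage, while each finite part of the type asks for a finite chain
    only. *)
Definition tyU (k : nat) : form :=
  match k with
  | 0 => Ex (Ex (And (IsOPair 2 1 0) (And (Mem 3 1) (Trans 1))))
  | S k => ChainF k
  end.

(* Variables: 0 the realisation, 1 the set W, 2 the set of parameters, 3 an element, then two
   interleaved tuples. *)
Definition tyJ (n k : nat) : form :=
  match k with
  | 0 => Mem 0 1
  | S k => AllIn 2 (Iff (relf 2 (ren (0 .: 4 .: fun i => 5 + 2 * Nat.min i n) (form_enum k)))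
                        (relf 2 (ren (0 .: 1 .: fun i => 6 + 2 * Nat.min i n) (form_enum k))))
  end.

(* Variables: 0 the realisation, 1 the set W, 2 the set of parameters, 3 the set of candidates, then
   a tuple. *)
Definition tyD (n k : nat) : form :=
  match k with
  | 0 => Ex (Ex (And (IsOPair 2 1 0) (And (Not (Eq 1 0)) (And (Mem 1 5) (Mem 0 5)))))
  | S k => Ex (Ex (And (IsOPair 2 1 0)
      (AllIn 4 (Iff (relf 4 (ren (0 .: 2 .: fun i => 7 + Nat.min i n) (form_enum k)))
                    (relf 4 (ren (0 .: 1 .: fun i => 7 + Nat.min i n) (form_enum k)))))))
  end.

(** The head of the list selects the family and the entries after it are numerical parameters; all
    other lists give a trivially true type. *)
Definition types (j : list nat) (k : nat) : form :=
  match j with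
  | 0 :: fl :: P :: Q :: R :: n :: _ => tyI fl P Q R n k
  | 1 :: _ => tyU k
  | 2 :: n :: _ => tyJ n k
  | 3 :: n :: _ => tyD n k
  | _ => Imp Fal Fal
  end.

Lemma closed_at_relf a : forall w n, w < n -> closed_at n a -> closed_at n (relf w a).
Proof.
  induction a; intros w m Hw H; cbn in *; try (destruct H; split); auto; try lia;
    (split; [lia|apply IHa; [lia|assumption]]).
Qed.

Lemma types_closed : exists g : list nat -> nat, forall j k, closed_at (S (g j)) (types j k).
Proof.
  assert (H : forall j, exists m, forall k, closed_at (S m) (types j k)).
  { intros j; destruct j as [|[|[|[|[|m]]]] j].
    - exists 0; intros k; cbn; auto.
    - destruct j as [|fl [|P [|Q [|R [|n j]]]]]; try (exists 0; intros k; cbn; auto; fail).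
      exists (10 + P + Q + R + 2 * n); intros [|k]; cbn [types tyI].
      + destruct (fl =? 0); cbn; lia.
      + split; cbn; [|split; [lia|]]; apply closed_at_ren; intros [|[|i]]; cbn; lia.
    - exists 1; intros [|k]; cbn [types tyU]; [cbn; lia|].
      apply (closed_at_mono _ 1); [lia|]; induction k as [|k IH]; [cbn; auto|].
      cbn [ChainF]; cbn; repeat split; try lia; apply (closed_at_mono _ 1); auto; lia.
    - destruct j as [|n j]; [exists 0; intros k; cbn; auto|].
      exists (10 + 2 * n); intros [|k]; cbn [types tyJ]; [cbn; lia|].
      cbn; repeat split; try lia; apply closed_at_relf; try lia; apply closed_at_ren; intros [|[|i]]; cbn; lia.
    - destruct j as [|n j]; [exists 0; intros k; cbn; auto|].
      exists (10 + 2 * n); intros [|k]; cbn [types tyD]; [cbn; lia|].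
      cbn; repeat split; try lia; apply closed_at_relf; try lia; apply closed_at_ren; intros [|[|i]]; cbn; lia.
    - exists 0; intros k; cbn; auto. }
  exists (fun j => pick (H j)); intros j; exact (pick_spec (H j)).
Qed.

Definition saturated (N : structure) : Prop := forall j (v : nat -> N),
  (forall K, exists x, forall k, k < K -> sat N (x .: v) (types j k)) ->
  exists x, forall k, sat N (x .: v) (types j k).

Definition il {X} (v w : nat -> X) (k : nat) : X := if Nat.even k then v (Nat.div2 k) else w (Nat.div2 k).

Lemma il_even {X} (v w : nat -> X) k : il v w (2 * k) = v k.
Proof.
  unfold il; replace (Nat.even (2 * k)) with true; [rewrite Nat.div2_double; reflexivity|].
  symmetry; apply Nat.even_spec; exists k; reflexivity.
Qed.

Lemma il_odd {X} (v w : nat -> X) k : il v w (S (2 * k)) = w k.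
Proof.
  unfold il; replace (Nat.even (S (2 * k))) with false; [rewrite Nat.div2_succ_double; reflexivity|].
  rewrite Nat.even_succ, <- Nat.negb_even; replace (Nat.even (2 * k)) with true; [reflexivity|].
  symmetry; apply Nat.even_spec; exists k; reflexivity.
Qed.

(** * A self-embedding onto an initial segment *)

Section Embed.
Context {N : structure} (HM : most N) (e : nat -> N) (e_surj : forall x, exists n, e n = x).
Context (SAT : saturated N).
Context (collP : forall a, Delta0P a -> forall (v : nat -> N) w,
    (forall x, mem x w -> exists y, sat N (y .: x .: v) a) ->
    exists c, forall x, mem x w -> exists y, mem y c /\ sat N (y .: x .: v) a).
Implicit Types x y z c d f g q r t u h : N.

Local Notation emp := (emp HM).
Local Notation pr := (pr HM).
Local Notation sg := (sg HM).
Local Notation bun := (bun HM).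
Local Notation pw := (pw HM).

(** An assignment constant from [n] on is a finite tuple in disguise, so a type can refer to all of
    it by finitely many variables. *)
Definition capd (n : nat) (v : nat -> N) : Prop := forall k, v k = v (Nat.min k n).

Lemma capd_S n v x : capd n v -> capd (S n) (x .: v).
Proof. intros H [|k]; cbn; [reflexivity|apply H]. Qed.

(** One family serves four purposes. [P], [Q] and [R] are positions in [u x] telling which entries
    act as left element, as bound for witnesses and as right element; the realisation is entry 0. *)
Lemma realise_I fl P Q R n h s1 s2 va vb : capd n va -> capd n vb ->
  let u x := x .: h .: s1 .: s2 .: il va vb in
  (forall K, exists x, (fl = 0 -> mem x h) /\ forall k, k < K ->
     (exists y, sat N (y .: u x P .: va) (dform k)) ->
     exists y, mem y (u x Q) /\ sat N (y .: u x R .: vb) (dform k)) ->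
  exists x, (fl = 0 -> mem x h) /\ forall a, Delta0P a ->
     (exists y, sat N (y .: u x P .: va) a) -> exists y, mem y (u x Q) /\ sat N (y .: u x R .: vb) a.
Proof.
  intros Ca Cb u H.
  assert (EA : forall x y k, sat N (y .: u x) (ren (0 .: S P .: fun i => 5 + 2 * Nat.min i n) (dform k))
    <-> sat N (y .: u x P .: va) (dform k)).
  { intros x y k; rewrite sat_ren.
    replace (fun i => (y .: u x) ((0 .: S P .: fun i => 5 + 2 * Nat.min i n) i)) with (y .: u x P .: va); [reflexivity|].
    extensionality i; destruct i as [|[|i]]; [reflexivity|reflexivity|].
    change (va i = il va vb (2 * Nat.min i n)); rewrite il_even; apply Ca. }
  assert (EB : forall x y k, sat N (y .: u x) (ren (0 .: S R .: fun i => 6 + 2 * Nat.min i n) (dform k))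
    <-> sat N (y .: u x R .: vb) (dform k)).
  { intros x y k; rewrite sat_ren.
    replace (fun i => (y .: u x) ((0 .: S R .: fun i => 6 + 2 * Nat.min i n) i)) with (y .: u x R .: vb); [reflexivity|].
    extensionality i; destruct i as [|[|i]]; [reflexivity|reflexivity|].
    change (vb i = il va vb (S (2 * Nat.min i n))); rewrite il_odd; apply Cb. }
  assert (ES : forall x k, sat N (u x) (tyI fl P Q R n (S k)) <->
     ((exists y, sat N (y .: u x P .: va) (dform k)) ->
     exists y, mem y (u x Q) /\ sat N (y .: u x R .: vb) (dform k))).
  { intros x k; cbn [tyI sat]; split.
    - intros H1 [y Hy]; destruct H1 as [y' [H1 H2]]; [exists y; apply EA, Hy|].
      exists y'; split; [exact H1|apply EB, H2].
    - intros H1 [y Hy]; destruct H1 as [y' [H1 H2]]; [exists y; apply EA, Hy|].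
      exists y'; split; [exact H1|apply EB, H2]. }
  assert (E0 : forall x, sat N (u x) (tyI fl P Q R n 0) <-> (fl = 0 -> mem x h)).
  { intros x; cbn [tyI]; destruct (Nat.eqb_spec fl 0); cbn; tauto. }
  destruct (SAT [0; fl; P; Q; R; n] (h .: s1 .: s2 .: il va vb)) as [x Hx].
  - intros K; destruct (H K) as [x [H1 H2]]; exists x; intros [|k] Hk.
    + apply E0, H1.
    + apply ES, H2; lia.
  - exists x; split; [apply E0, (Hx 0)|]; intros a Ha; destruct (dform_surj a Ha) as [k <-].
    apply ES, (Hx (S k)).
Qed.

(** The one-sided condition gives equivalence for Delta0P formulae by negation, while the bound on
    witnesses keeps the copy of the model below [c]. *)
Definition Inv (va vb : nat -> N) c : Prop := forall a, Delta0P a ->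
  (exists y, sat N (y .: va) a) -> exists y, mem y c /\ sat N (y .: vb) a.

Lemma Inv_iff va vb c a : Inv va vb c -> Delta0P a -> sat N va a <-> sat N vb a.
Proof.
  intros I Ha.
  assert (K : forall b, Delta0P b -> sat N va b -> sat N vb b).
  { intros b Hb H; destruct (I (ren S b) (Delta0P_ren b Hb S)) as [y [_ Hy]].
    - exists (va 0); rewrite sat_ren; exact H.
    - rewrite sat_ren in Hy; exact Hy. }
  split; [apply K, Ha|]; intros H; apply NNPP; intros F.
  apply (K (Not a)); [constructor; [exact Ha|constructor]|exact F|exact H].
Qed.

(** Used when the slots for new elements are filled by repeated ones, as in the search for a new
    bound. *)
Lemma Inv_drop x y va vb c : (forall a, Delta0P a -> (exists z, sat N (z .: x .: va) a) ->
  exists z, mem z c /\ sat N (z .: y .: vb) a) -> Inv va vb c.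
Proof.
  intros H a Ha [z Hz].
  assert (E : forall z x (v : nat -> N), sat N (z .: x .: v) (ren (0 .: fun i => S (S i)) a) <-> sat N (z .: v) a).
  { intros; rewrite sat_ren, scons_map; cbn; tauto. }
  destruct (H (ren (0 .: fun i => S (S i)) a) (Delta0P_ren a Ha _)) as [w [Hw Sw]].
  - exists z; apply E, Hz.
  - exists w; split; [exact Hw|]; apply E in Sw; exact Sw.
Qed.

Definition decide (P : Prop) : bool := if excluded_middle_informative P then true else false.
Lemma decideP P : decide P = true <-> P.
Proof. unfold decide; destruct (excluded_middle_informative P); split; auto; discriminate. Qed.

Lemma finite_witness {X : Type} (l : list X) (P : X -> N -> Prop) :
  (forall k, In k l -> exists y, P k y) -> exists c, forall k, In k l -> exists y, mem y c /\ P k y.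
Proof.
  induction l as [|k l IH]; intros H; [exists emp; intros k []|].
  destruct IH as [c Hc]; [intros m Hm; apply H; cbn; auto|].
  destruct (H k) as [y Hy]; [cbn; auto|].
  exists (bun c (sg y)); intros m [<-|Hm].
  - exists y; split; [apply (in_bun HM); right; apply (in_sg HM); reflexivity|exact Hy].
  - destruct (Hc m Hm) as [z [Hz Pz]]; exists z; split; [apply (in_bun HM); auto|exact Pz].
Qed.

(** For finitely many formulae, their witnesses and [x] are put into one set. That such a set exists
    is an existential Delta0P fact, so [Inv] produces one in [c], and its elements are in [c] by
    transitivity. *)
Lemma forth n va vb c x : capd n va -> capd n vb -> trans c -> Inv va vb c ->
  exists y, Inv (x .: va) (y .: vb) c.
Proof.
  intros Ca Cb Tc I.
  (* Entry 2 is the given [x], entry 3 the bound [c], entry 0 the element sought. *)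
  destruct (realise_I 1 2 3 0 n emp x c va vb Ca Cb) as [y [_ Hy]]; [|exists y; exact Hy].
  intros K.
  set (S := filter (fun k => decide (exists y, sat N (y .: x .: va) (dform k))) (seq 0 K)).
  set (phi := ExIn 0 (bigand (map (fun k => ExIn 1 (ren (0 .: 1 .: fun i => 3 + i) (dform k))) S))).
  assert (Dphi : Delta0P phi).
  { constructor; apply Delta0P_bigand; intros a Ha; apply in_map_iff in Ha as [k [<- _]].
    constructor; apply Delta0P_ren, dform_Delta0P. }
  assert (Ephi : forall Y (v : nat -> N), sat N (Y .: v) phi <-> exists z, mem z Y /\ forall k, In k S ->
    exists y, mem y Y /\ sat N (y .: z .: v) (dform k)).
  { assert (E : forall (y z Y : N) v k, sat N (y .: z .: Y .: v) (ren (0 .: 1 .: fun i => 3 + i) (dform k)) <->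
       sat N (y .: z .: v) (dform k)) by (intros; rewrite sat_ren, !scons_map; cbn; tauto).
    intros Y v; unfold phi; cbn [ExIn sat]; split.
    - intros [z [Hz H]]; exists z; split; [exact Hz|]; intros k Hk.
      rewrite sat_bigand in H; destruct (H _ (in_map _ _ _ Hk)) as [y [Hy Sy]].
      exists y; split; [exact Hy|]; apply E in Sy; exact Sy.
    - intros [z [Hz H]]; exists z; split; [exact Hz|]; apply sat_bigand; intros a Ha.
      apply in_map_iff in Ha as [k [<- Hk]]; destruct (H k Hk) as [y [Hy Sy]].
      exists y; split; [exact Hy|]; apply E, Sy. }
  destruct (finite_witness S (fun k y => sat N (y .: x .: va) (dform k))) as [Y0 HY0].
  { intros k Hk; apply filter_In in Hk as [_ Hk]; apply (proj1 (decideP _)) in Hk; exact Hk. }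
  destruct (I phi Dphi) as [Y [HY SY]].
  { exists (bun Y0 (sg x)); apply Ephi; exists x; split; [apply (in_bun HM); right; apply (in_sg HM); reflexivity|].
    intros k Hk; destruct (HY0 k Hk) as [y [Hy Sy]]; exists y; split; [apply (in_bun HM); auto|exact Sy]. }
  apply Ephi in SY as [z [Hz SY]]; exists z; split; [discriminate|].
  intros k Hk Hl; destruct (SY k) as [y [Hy Sy]].
  { apply filter_In; split; [apply in_seq; lia|apply (proj2 (decideP _)); exact Hl]. }
  exists y; split; [exact (Tc Y HY y Hy)|exact Sy].
Qed.

(** If every subset of [va i] failed, each would satisfy, with some witness, one of finitely many
    formulae that [d] does not satisfy with a witness in [c]. Delta0P-collection bounds these
    witnesses; the resulting Delta0P statement about all subsets passes to [vb i] with a bound in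
    [c], and applied to [d] it is absurd. *)
Lemma back n va vb c i d : capd n va -> capd n vb -> trans c -> Inv va vb c -> sub d (vb i) ->
  exists x, Inv (x .: va) (d .: vb) c.
Proof.
  intros Ca Cb Tc I Hd.
  destruct (realise_I 0 0 3 2 n (pw (va i)) d c va vb Ca Cb) as [x [_ Hx]]; [|exists x; exact Hx].
  intros K; apply NNPP; intros F.
  set (S := filter (fun k => decide (~ exists y, mem y c /\ sat N (y .: d .: vb) (dform k))) (seq 0 K)).
  set (psi := bigor (map dform S)).
  assert (Dpsi : Delta0P psi).
  { apply Delta0P_bigor; intros a Ha; apply in_map_iff in Ha as [k [<- _]]; apply dform_Delta0P. }
  set (phi := AllSub (Datatypes.S i) (ExIn 1 (ren (0 .: 1 .: fun i => 3 + i) psi))).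
  assert (Dphi : Delta0P phi) by (constructor; constructor; apply Delta0P_ren, Dpsi).
  assert (Ephi : forall Y (v : nat -> N), sat N (Y .: v) phi <-> forall z, sub z (v i) ->
    exists y, mem y Y /\ sat N (y .: z .: v) psi).
  { assert (E : forall (y z Y : N) v, sat N (y .: z .: Y .: v) (ren (0 .: 1 .: fun i => 3 + i) psi) <->
       sat N (y .: z .: v) psi) by (intros; rewrite sat_ren, !scons_map; cbn; tauto).
    intros Y v; unfold phi; cbn [AllSub ExIn sat]; split.
    - intros H z Hz; destruct (H z Hz) as [y [Hy Sy]]; exists y; split; [exact Hy|]; apply E in Sy; exact Sy.
    - intros H z Hz; destruct (H z Hz) as [y [Hy Sy]]; exists y; split; [exact Hy|]; apply E, Sy. }
  destruct (collP psi Dpsi va (pw (va i))) as [Y HY].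
  { intros x Hx; apply NNPP; intros Nx; apply F; exists x; split; [auto|].
    intros k Hk [y Hy]; apply NNPP; intros Nk; apply Nx; exists y; apply sat_bigor; exists (dform k); split; [|exact Hy].
    apply in_map, filter_In; split; [apply in_seq; lia|apply (proj2 (decideP _)); exact Nk]. }
  destruct (I phi Dphi) as [Y' [HY' SY']].
  { exists Y; apply Ephi; intros z Hz; apply HY, (in_pw HM), Hz. }
  destruct (proj1 (Ephi Y' vb) SY' d Hd) as [y [Hy Sy]].
  apply sat_bigor in Sy as [a [Ha Sy]]; apply in_map_iff in Ha as [k [<- Hk]].
  apply filter_In in Hk as [_ Hk]; apply (proj1 (decideP _)) in Hk; apply Hk; exists y; split; [exact (Tc Y' HY' y Hy)|exact Sy].
Qed.

(** If no element of [h] can serve as new bound, saturation makes finitely many formulae responsible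
    for all failures; [a] says that these have witnesses in the proposed bound. *)
Lemma shrink_or n va vb h : capd n va -> capd n vb ->
  (exists x, mem x h /\ Inv va vb x) \/
  exists a, Delta0P a /\ (exists c0, forall c, sub c0 c -> sat N (c .: va) a) /\
    forall x, mem x h -> ~ sat N (x .: vb) a.
Proof.
  intros Ca Cb.
  destruct (classic (exists x, mem x h /\ Inv va vb x)) as [|F]; [auto|right].
  assert (G : exists K, forall x, mem x h -> exists k, k < K /\
    (exists y, sat N (y .: va 0 .: va) (dform k)) /\ ~ exists y, mem y x /\ sat N (y .: vb 0 .: vb) (dform k)).
  { apply NNPP; intros G; apply F.
    (* Entries 4 and 5 are [va 0] and [vb 0], dummies for left and right element; the bound itself,
       entry 0, is what is sought. *)
    destruct (realise_I 0 4 0 5 n h emp emp va vb Ca Cb) as [x [Hx Ix]].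
    - intros K; apply NNPP; intros FK; apply G; exists K; intros x Hx; apply NNPP; intros Nx; apply FK.
      exists x; split; [auto|]; intros k Hk H1; apply NNPP; intros H2; apply Nx; exists k; auto.
    - exists x; split; [auto|]; exact (Inv_drop (va 0) (vb 0) va vb x Ix). }
  destruct G as [K HK].
  set (S := filter (fun k => decide (exists y, sat N (y .: va 0 .: va) (dform k))) (seq 0 K)).
  exists (bigand (map (fun k => ExIn 0 (ren (0 .: 2 .: fun i => 2 + i) (dform k))) S)).
  assert (E : forall (y c : N) v k, sat N (y .: c .: v) (ren (0 .: 2 .: fun i => 2 + i) (dform k)) <->
       sat N (y .: v 0 .: v) (dform k)) by (intros; rewrite sat_ren, !scons_map; cbn; tauto).
  split; [|split].
  - apply Delta0P_bigand; intros a Ha; apply in_map_iff in Ha as [k [<- _]].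
    constructor; apply Delta0P_ren, dform_Delta0P.
  - destruct (finite_witness S (fun k y => sat N (y .: va 0 .: va) (dform k))) as [c0 Hc0].
    { intros k Hk; apply filter_In in Hk as [_ Hk]; apply (proj1 (decideP _)) in Hk; exact Hk. }
    exists c0; intros c Hc; apply sat_bigand; intros a Ha; apply in_map_iff in Ha as [k [<- Hk]].
    destruct (Hc0 k Hk) as [y [Hy Sy]]; exists y; split; [exact (Hc y Hy)|apply E, Sy].
  - intros x Hx Sx; rewrite sat_bigand in Sx; destruct (HK x Hx) as [k [Hk [H1 H2]]]; apply H2.
    destruct (Sx (ExIn 0 (ren (0 .: 2 .: fun i => 2 + i) (dform k)))) as [y [Hy Sy]].
    + apply in_map_iff; exists k; split; [reflexivity|]; apply filter_In; split; [apply in_seq; lia|].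
      apply (proj2 (decideP _)), H1.
    + exists y; split; [exact Hy|]; apply E in Sy; exact Sy.
Qed.

Definition nice x : Prop := trans x /\ pclosed x.
(** Consecutive bounds are a power set step apart: the second back and forth stores traces on one
    bound as elements of the previous one. *)
Definition below x c : Prop := mem x c /\ forall s, sub s x -> mem s c.

Lemma nice_above c0 : exists c, nice c /\ sub c0 c.
Proof.
  destruct (pair_closed_around HM c0) as [c [Tc [Pc Hc]]]; exists c; split; [split; assumption|exact (Tc c0 Hc)].
Qed.

(** If no candidate works, a large enough nice set on the left satisfies the formula that all
    candidates fail; an ordinal [a] mapping onto it is added to the tuple. Its counterpart [b] maps
    onto a nice [c'] below [c] satisfying that formula, so [c'] is not a candidate and fails [B]. *)
Lemma shrink n va vb c (B : N -> Prop) h : capd n va -> capd n vb -> nice c -> Inv va vb c ->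
  (forall x, mem x h <-> mem x c /\ (nice x /\ below x c /\ B x)) ->
  (exists c', (nice c' /\ below c' c /\ B c') /\ Inv va vb c') \/
  exists a b, Inv (a .: va) (b .: vb) c /\ ord b /\
    exists c' g, nice c' /\ below c' c /\ Surj g b c' /\ ~ B c'.
Proof.
  intros Ca Cb [Tc Pc] I Hh; destruct (shrink_or n va vb h Ca Cb) as [[x [Hx Ix]]|[psi [Dpsi [[c0 Hc0] Npsi]]]].
  - left; exists x; split; [apply Hh in Hx; tauto|exact Ix].
  - right; destruct (nice_above c0) as [c1 [[Tc1 Pc1] Sc1]], (ord_enum HM c1) as [a [g [_ [Oa [Sg _]]]]].
    destruct (forth n va vb c a Ca Cb Tc I) as [b Ib]; exists a, b; split; [exact Ib|].
    set (T := fun e : ctx N 4 => let g := snd e in let c' := snd (fst e) in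
      let a := snd (fst (fst e)) in let Y := snd (fst (fst (fst e))) in
      (trans c' /\ pclosed c') /\ (ord a /\ Surj g a c') /\ forall s, sub s c' -> mem s Y).
    assert (DT : Def Delta0P pure 4 T).
    { unfold T; dsolve; [apply Def_pclosed; tsolve|apply Def_ord; tsolve|].
      apply Def_allsub; [intros; constructor; assumption|tsolve|dsolve]. }
    destruct (Def_pure Delta0P 4 T DT) as [a4 [D4 H4]].
    set (chi := ExIn 0 (ExIn 1 (And (ren (0 .: 1 .: 3 .: 2 .: fun i => i) a4) (ren (1 .: fun i => 4 + i) psi)))).
    assert (Dchi : Delta0P chi) by (repeat constructor; apply Delta0P_ren; assumption).
    assert (Echi : forall Y a (v : nat -> N), sat N (Y .: a .: v) chi <-> exists c', mem c' Y /\ exists g, mem g Y /\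
      T (tt, Y, a, c', g) /\ sat N (c' .: v) psi).
    { assert (E1 : forall (g c' Y a : N) v, sat N (g .: c' .: Y .: a .: v) (ren (0 .: 1 .: 3 .: 2 .: fun i => i) a4) <-> T (tt, Y, a, c', g)).
      { intros g0 c' Y a0 v; rewrite sat_ren, !scons_map; apply (H4 (tt, Y, a0, c', g0)). }
      assert (E2 : forall (g c' Y a : N) v, sat N (g .: c' .: Y .: a .: v) (ren (1 .: fun i => 4 + i) psi) <-> sat N (c' .: v) psi).
      { intros; rewrite sat_ren, !scons_map; cbn; tauto. }
      intros Y a0 v; unfold chi; cbn [ExIn sat]; split.
      - intros [c' [Hc' [g0 [Hg [H1 H2]]]]]; exists c'; split; [exact Hc'|]; exists g0; split; [exact Hg|].
        split; [apply E1 in H1; exact H1|apply E2 in H2; exact H2].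
      - intros [c' [Hc' [g0 [Hg [H1 H2]]]]]; exists c'; split; [exact Hc'|]; exists g0; split; [exact Hg|].
        split; [apply E1, H1|apply E2, H2]. }
    destruct (Ib chi Dchi) as [Y [HY SY]].
    { exists (bun (pr c1 g) (pw c1)); apply Echi; exists c1; split; [apply (in_bun HM); left; apply (in_pr HM); auto|].
      exists g; split; [apply (in_bun HM); left; apply (in_pr HM); auto|]; split; [|apply Hc0, Sc1].
      unfold T; cbn [fst snd].
      split; [split; assumption|]; split; [split; assumption|]; intros s Hs; apply (in_bun HM); right; apply (in_pw HM), Hs. }
    apply Echi in SY as [c' [Hc' [g' [Hg' [HT Hpsi]]]]].
    unfold T in HT; cbn [fst snd] in HT; destruct HT as [[Tc' Pc'] [[Ob Sg'] Sub]].
    assert (Bc : below c' c) by (split; [exact (Tc Y HY c' Hc')|intros s Hs; exact (Tc Y HY s (Sub s Hs))]).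
    split; [exact Ob|]; exists c', g'; split; [split; assumption|]; split; [exact Bc|]; split; [exact Sg'|].
    intros HB; apply (Npsi c'); [|exact Hpsi]; apply Hh; split; [exact (proj1 Bc)|]; split; [split; assumption|]; auto.
Qed.

Lemma below_nice_set c (B : N -> N -> Prop) : trans c -> D0 2 (fun e => B (snd (fst e)) (snd e)) ->
  exists h, forall x, mem x h <-> mem x c /\ (nice x /\ below x c /\ exists f, B x f).
Proof.
  intros Tc DB.
  destruct (ssep HM (fun x f => (trans x /\ pclosed x) /\ ((mem x c /\ forall s, mem s (pw c) -> sub s x -> mem s c) /\ B x f)) c)
    as [h Hh]; [dsolve; apply Def_pclosed; tsolve|].
  exists h; intros x; rewrite Hh; split.
  - intros [Hx [f [H1 [[H2 H3] H4]]]]; split; [exact Hx|]; split; [exact H1|]; split; [|eauto].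
    split; [exact H2|]; intros s Hs; apply H3; [|exact Hs]; apply (in_pw HM); intros z Hz; exact (Tc x Hx z (Hs z Hz)).
  - intros [Hx [H1 [[H2 H3] [f H4]]]]; split; [exact Hx|]; exists f; split; [exact H1|]; split; [|exact H4].
    split; [exact H2|]; intros s _; apply H3.
Qed.

Lemma shrink_plain n va vb c : capd n va -> capd n vb -> nice c -> Inv va vb c ->
  exists c', nice c' /\ below c' c /\ Inv va vb c'.
Proof.
  intros Ca Cb Nc I; destruct (below_nice_set c (fun x f => f = f) (proj1 Nc)) as [h Hh]; [dsolve|].
  destruct (shrink n va vb c (fun x => exists f : N, f = f) h Ca Cb Nc I Hh) as [[c' [[H1 [H2 _]] H3]]|[a [b [_ [_ [c' [g [_ [_ [_ H]]]]]]]]]].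
  - exists c'; auto.
  - destruct H; exists emp; reflexivity.
Qed.

(** In the second case [b] maps onto a set that [o] does not map onto, so [b] is not included in [o]
    and must have [o] as an element. *)
Lemma shrink_ord n va vb c o : capd n va -> capd n vb -> nice c -> Inv va vb c -> ord o ->
  (exists c', nice c' /\ below c' c /\ Inv va vb c' /\ exists f, Surj f o c') \/
  exists a b, Inv (a .: va) (b .: vb) c /\ mem o b.
Proof.
  intros Ca Cb Nc I Oo; destruct (below_nice_set c (fun x f => Surj f o x) (proj1 Nc)) as [h Hh]; [dsolve|].
  destruct (shrink n va vb c (fun x => exists f, Surj f o x) h Ca Cb Nc I Hh) as [[c' [[H1 [H2 H3]] H4]]|[a [b [Ib [Ob [c' [g [_ [_ [Sg NB]]]]]]]]]].
  - left; exists c'; auto.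
  - right; exists a, b; split; [exact Ib|]; destruct (ord_cmp HM b o Ob Oo) as [S|S]; [|exact S].
    destruct NB; exists g; exact (Surj_mono g b o c' S Sg).
Qed.

Record st : Type := St { sa : nat -> N; sb : nat -> N; sc : N; sn : nat }.
Definition good (s : st) : Prop := capd (sn s) (sa s) /\ capd (sn s) (sb s) /\ nice (sc s) /\ Inv (sa s) (sb s) (sc s).
Definition ext_st (s s' : st) : Prop :=
  (forall i, exists i', sa s' i' = sa s i /\ sb s' i' = sb s i) /\ (sc s' = sc s \/ below (sc s') (sc s)).

Lemma good_cons s x y : good s -> Inv (x .: sa s) (y .: sb s) (sc s) ->
  good (St (x .: sa s) (y .: sb s) (sc s) (S (sn s))) /\ ext_st s (St (x .: sa s) (y .: sb s) (sc s) (S (sn s))).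
Proof.
  intros [G1 [G2 [G3 G4]]] I; split.
  - split; [apply capd_S, G1|]; split; [apply capd_S, G2|]; split; assumption.
  - split; [|left; reflexivity]; intros i; exists (S i); split; reflexivity.
Qed.

Lemma good_shrink s c : good s -> nice c -> below c (sc s) -> Inv (sa s) (sb s) c ->
  good (St (sa s) (sb s) c (sn s)) /\ ext_st s (St (sa s) (sb s) c (sn s)).
Proof.
  intros [G1 [G2 [G3 G4]]] Nc Bc I; split; [split; [|split; [|split]]; assumption|].
  split; [intros i; exists i; split; reflexivity|right; exact Bc].
Qed.

Lemma below_trans c c' c'' : trans c -> below c'' c' -> below c' c -> below c'' c.
Proof.
  intros Tc [H1 H2] [H3 H4]; split; [exact (Tc c' H3 c'' H1)|intros s Hs; exact (Tc c' H3 s (H2 s Hs))].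
Qed.

Lemma ext_trans s s' s'' : good s -> ext_st s s' -> ext_st s' s'' -> ext_st s s''.
Proof.
  intros [_ [_ [[Tc _] _]]] [A1 A2] [B1 B2]; split.
  - intros i; destruct (A1 i) as [i' [E1 E2]], (B1 i') as [i'' [E3 E4]]; exists i''; split; congruence.
  - destruct A2 as [A2|A2], B2 as [B2|B2].
    + left; congruence.
    + right; rewrite <- A2; exact B2.
    + right; rewrite B2; exact A2.
    + right; exact (below_trans (sc s) (sc s') (sc s'') Tc B2 A2).
Qed.

(** The element [p] is used in three ways: as a new left entry, as an old right entry whose subset
    [q] must be reached, and, if an ordinal, as one to be swallowed by the copy or mapped onto the
    new bound. *)
Definition step_at (p q : N) (s s' : st) : Prop :=
  (forall i, exists i', sa s' i' = sa s i /\ sb s' i' = sb s i) /\ below (sc s') (sc s) /\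
  (exists i, sa s' i = p) /\
  (forall i, sub q (sb s i) -> p = sb s i -> exists i', sb s' i' = q) /\
  (ord p -> (exists f, Surj f p (sc s')) \/ exists i, mem p (sb s' i)).

(** The second component of [m] is only a counter: each pair recurs at arbitrarily late stages,
    after the entry concerned has appeared. *)
Definition step (m : nat) : st -> st -> Prop :=
  step_at (e (fst (of_nat (fst (of_nat m))))) (e (snd (of_nat (fst (of_nat m))))).

Lemma step_ex m s : good s -> exists s', good s' /\ step m s s'.
Proof.
  intros G; unfold step; generalize (e (fst (of_nat (fst (of_nat m))))) as p, (e (snd (of_nat (fst (of_nat m))))) as q.
  intros p q.
  destruct (forth (sn s) (sa s) (sb s) (sc s) p) as [y Iy]; try apply G.
  destruct (good_cons s p y G Iy) as [G1 X1]; set (s1 := St (p .: sa s) (y .: sb s) (sc s) (S (sn s))) in *.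
  assert (B2 : exists s2, good s2 /\ ext_st s1 s2 /\ forall i, sub q (sb s i) -> p = sb s i -> exists i', sb s2 i' = q).
  { destruct (classic (exists i, sub q (sb s i) /\ p = sb s i)) as [[i [Hq _]]|F].
    - destruct (back (sn s1) (sa s1) (sb s1) (sc s1) (S i) q) as [x Ix]; try apply G1; [exact Hq|].
      destruct (good_cons s1 x q G1 Ix) as [G2 X2]; eexists; split; [exact G2|]; split; [exact X2|].
      intros _ _ _; exists 0; reflexivity.
    - exists s1; split; [exact G1|]; split; [split; [intros i; exists i; auto|left; reflexivity]|].
      intros i H1 H2; destruct F; eauto. }
  destruct B2 as [s2 [G2 [X2 Bk]]].
  assert (B3 : exists s3, good s3 /\ ext_st s2 s3 /\ (ord p -> (exists f, Surj f p (sc s3)) \/ exists i, mem p (sb s3 i))).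
  { destruct (classic (ord p)) as [Op|Np].
    - destruct (shrink_ord (sn s2) (sa s2) (sb s2) (sc s2) p) as [[c' [H1 [H2 [H3 H4]]]]|[a [b [Ib Hb]]]]; try apply G2; [exact Op| |].
      + destruct (good_shrink s2 c' G2 H1 H2 H3) as [G3 X3]; eexists; split; [exact G3|]; split; [exact X3|]; auto.
      + destruct (good_cons s2 a b G2 Ib) as [G3 X3]; eexists; split; [exact G3|]; split; [exact X3|].
        intros _; right; exists 0; exact Hb.
    - exists s2; split; [exact G2|]; split; [split; [intros i; exists i; auto|left; reflexivity]|tauto]. }
  destruct B3 as [s3 [G3 [X3 Od]]].
  (* A last plain shrink puts the new bound strictly below the old one, whatever the earlier tasks
     did. *)
  destruct (shrink_plain (sn s3) (sa s3) (sb s3) (sc s3)) as [c [Nc [Bc Ic]]]; try apply G3.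
  destruct (good_shrink s3 c G3 Nc Bc Ic) as [G4 X4]; set (s4 := St (sa s3) (sb s3) c (sn s3)) in *.
  exists s4; split; [exact G4|].
  assert (X13 := ext_trans s1 s2 s3 G1 X2 X3); assert (X03 := ext_trans s s1 s3 G X1 X13).
  split; [|split; [|split; [|split]]].
  - apply X03.
  - destruct (proj2 X03) as [E|E]; [rewrite <- E; exact Bc|].
    exact (below_trans (sc s) (sc s3) c (proj1 (proj1 (proj2 (proj2 G)))) Bc E).
  - destruct (proj1 X13 0) as [i' [E _]]; exists i'; exact E.
  - intros i H1 H2; destruct (Bk i H1 H2) as [i' E], (proj1 X3 i') as [i'' [_ E']]; exists i''; cbn [sb s4]; congruence.
  - intros Op; destruct (Od Op) as [[f Sf]|H]; [left|right; exact H].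
    exists f; split; [apply Sf|]; intros z Hz; apply Sf; exact (proj1 (proj1 (proj2 (proj2 G3))) c (proj1 Bc) z Hz).
Qed.

(** The first bound must contain witnesses for all true existential Delta0P statements about [emp]
    at once, so saturation is needed already here. *)
Lemma init_ex : exists s, good s.
Proof.
  set (v := fun _ : nat => emp).
  assert (Cv : capd 0 v) by (intros k; reflexivity).
  destruct (realise_I 1 4 0 5 0 emp emp emp v v Cv Cv) as [x [_ Hx]].
  - intros K.
    set (S := filter (fun k => decide (exists y, sat N (y .: emp .: v) (dform k))) (seq 0 K)).
    destruct (finite_witness S (fun k y => sat N (y .: emp .: v) (dform k))) as [c Hc].
    { intros k Hk; apply filter_In in Hk as [_ Hk]; apply (proj1 (decideP _)) in Hk; exact Hk. }
    exists c; split; [discriminate|]; intros k Hk H; apply Hc, filter_In; split; [apply in_seq; lia|].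
    apply (proj2 (decideP _)), H.
  - apply Inv_drop in Hx; destruct (nice_above x) as [c [Nc Sc]].
    exists (St v v c 0); split; [exact Cv|]; split; [exact Cv|]; split; [exact Nc|].
    intros a Ha H; destruct (Hx a Ha H) as [y [Hy Sy]]; exists y; split; [exact (Sc y Hy)|exact Sy].
Qed.

Theorem self_embedding : exists (I : N -> N -> Prop) (c : nat -> N),
  (forall a, exists b, I a b) /\
  (forall a (v w : nat -> N), Delta0P a -> (forall k, I (v k) (w k)) -> sat N v a <-> sat N w a) /\
  (forall a b d, I a b -> sub d b -> exists a', I a' d) /\
  (forall a b n, I a b -> mem b (c n)) /\
  (forall n, nice (c n) /\ below (c (S n)) (c n)) /\
  (forall o, ord o -> (exists a b, I a b /\ mem o b) \/ exists n f, Surj f o (c n)).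
Proof.
  destruct init_ex as [s0 G0], (sequence_of_steps good step s0 G0 step_ex) as [F [_ HF]].
  assert (G : forall n, good (F n)) by (intros n; apply HF).
  assert (mono : forall n m i, n <= m -> exists i', sa (F m) i' = sa (F n) i /\ sb (F m) i' = sb (F n) i).
  { intros n m i L; induction L as [|m L [i' [E1 E2]]]; [exists i; auto|].
    destruct (proj1 (proj2 (HF m)) i') as [i'' [E3 E4]]; exists i''; split; congruence. }
  assert (task : forall p q n : nat, exists m, n <= m /\ fst (of_nat m) = to_nat (p, q)).
  { intros p q n; exists (to_nat (to_nat (p, q), n)); rewrite cancel_of_to; split; [|reflexivity].
    pose proof (to_nat_non_decreasing (to_nat (p, q)) n) as L; revert L.
    generalize (to_nat (to_nat (p, q), n)); intros k L; lia. }
  assert (stepE : forall m p q : nat, fst (of_nat m) = to_nat (p, q) -> step_at (e p) (e q) (F m) (F (S m))).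
  { intros m p q Hm; pose proof (proj2 (HF m)) as H; unfold step in H; rewrite Hm, cancel_of_to in H; exact H. }
  set (I := fun a b => exists n i, sa (F n) i = a /\ sb (F n) i = b).
  assert (cdec : forall n m z, n <= m -> mem z (sc (F m)) -> mem z (sc (F n))).
  { intros n m z L; induction L as [|m L IH]; [auto|]; intros Hz; apply IH.
    exact (proj1 (proj1 (proj2 (proj2 (G m)))) _ (proj1 (proj1 (proj2 (proj2 (HF m))))) z Hz). }
  exists I, (fun n => sc (F n)); split; [|split; [|split; [|split; [|split]]]].
  - intros a; destruct (e_surj a) as [p <-], (task p 0 0) as [m [_ Hm]].
    destruct (stepE m p 0 Hm) as [_ [_ [[i Hi] _]]].
    exists (sb (F (S m)) i), (S m), i; auto.
  - intros a v w Da H; destruct (closed_at_ex a) as [n Hn].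
    assert (R : exists (m : nat) (r : nat -> nat), forall k, k < n -> sa (F m) (r k) = v k /\ sb (F m) (r k) = w k).
    { clear Hn; induction n as [|n [m [r Hr]]]; [exists 0, (fun k => k); intros k Hk; lia|].
      destruct (H n) as [m' [i [E1 E2]]].
      assert (L : forall k, exists i', (k < n -> sa (F (m + m')) i' = v k /\ sb (F (m + m')) i' = w k) /\
         (k = n -> sa (F (m + m')) i' = v k /\ sb (F (m + m')) i' = w k)).
      { intros k; destruct (Nat.eq_dec k n) as [->|Ne].
        - destruct (mono m' (m + m') i) as [i' [E3 E4]]; [lia|]; exists i'; split; [lia|intros _; split; congruence].
        - destruct (mono m (m + m') (r k)) as [i' [E3 E4]]; [lia|]; exists i'; split; [|lia].
          intros Hk; destruct (Hr k Hk); split; congruence. }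
      exists (m + m'), (fun k => pick (L k)); intros k Hk; destruct (pick_spec (L k)) as [L1 L2].
      destruct (Nat.eq_dec k n); [apply L2; assumption|apply L1; lia]. }
    destruct R as [m [r Hr]].
    rewrite (sat_closed N a n v (fun k => sa (F m) (r k)) Hn), (sat_closed N a n w (fun k => sb (F m) (r k)) Hn);
      [|intros k Hk; symmetry; apply (Hr k Hk)|intros k Hk; symmetry; apply (Hr k Hk)].
    rewrite <- (sat_ren N a (sa (F m)) r), <- (sat_ren N a (sb (F m)) r); apply (Inv_iff _ _ (sc (F m))); [apply (G m)|apply Delta0P_ren, Da].
  - intros a b d [n [i [<- <-]]] Hd.
    destruct (e_surj (sb (F n) i)) as [p Ep], (e_surj d) as [q Eq], (task p q n) as [m [L Hm]].
    destruct (mono n m i L) as [i' [_ E]].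
    destruct (stepE m p q Hm) as [_ [_ [_ [Bk _]]]]; rewrite Ep, Eq in Bk.
    destruct (Bk i') as [i'' E']; [rewrite E; exact Hd|symmetry; exact E|].
    exists (sa (F (S m)) i''), (S m), i''; auto.
  - intros a b n [m [i [<- <-]]]; destruct (mono m (n + m) i) as [i' [E1 E2]]; [lia|].
    apply (cdec n (n + m)); [lia|]; rewrite <- E2.
    (* That something equals entry [i'] is an existential fact, so by [Inv] it has a witness in the
       bound; this witness is the right entry. *)
    destruct (proj2 (proj2 (proj2 (G (n + m)))) (Eq 0 (S i'))) as [y [Hy Ey]]; [constructor|exists (sa (F (n + m)) i'); reflexivity|].
    cbn in Ey; subst y; exact Hy.
  - intros n; split; [apply (G n)|apply HF].
  - intros o Oo; destruct (e_surj o) as [p Ep], (task p 0 0) as [m [_ Hm]].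
    destruct (stepE m p 0 Hm) as [_ [_ [_ [_ Od]]]]; rewrite Ep in Od.
    destruct (Od Oo) as [[f Sf]|[i Hi]].
    + right; exists (S m), f; exact Sf.
    + left; exists (sa (F (S m)) i), (sb (F (S m)) i); split; [exists (S m), i; auto|exact Hi].
Qed.

End Embed.

Section Segment.
Context {N : structure} (HM : most N) (I : N -> N -> Prop) (c : nat -> N).
Context (I_tot : forall a, exists b, I a b).
Context (I_sat : forall a (v w : nat -> N), Delta0P a -> (forall k, I (v k) (w k)) -> sat N v a <-> sat N w a).
Context (I_sub : forall a b d, I a b -> sub d b -> exists a', I a' d).
Context (I_c : forall a b n, I a b -> mem b (c n)).
Context (c_nice : forall n, nice (c n) /\ below (c (S n)) (c n)).
Implicit Types x y z d f g p q r u h : N.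

Local Notation emp := (emp HM).
Local Notation pr := (pr HM).
Local Notation sg := (sg HM).
Local Notation pw := (pw HM).
Local Notation op := (op HM).
Local Notation prod := (prod HM).

(** * The initial segment as a class *)

Definition seg x : Prop := exists a, I a x.

Lemma I_eq a b a' b' : I a b -> I a' b' -> (a = a' <-> b = b').
Proof.
  intros H H'; apply (I_sat (Eq 0 1) (a .: fun _ => a') (b .: fun _ => b')); [constructor|].
  intros [|k]; assumption.
Qed.

Lemma I_mem a b a' b' : I a b -> I a' b' -> (mem a a' <-> mem b b').
Proof.
  intros H H'; apply (I_sat (Mem 0 1) (a .: fun _ => a') (b .: fun _ => b')); [constructor|].
  intros [|k]; assumption.
Qed.

Fixpoint Ictx n : ctx N n -> ctx N n -> Prop :=
  match n with 0 => fun _ _ => True | S n => fun e e' => Ictx n (fst e) (fst e') /\ I (snd e) (snd e') end.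

Lemma I_pure n (P : ctx N n -> Prop) : Def Delta0P pure n P -> forall e e', Ictx n e e' -> P e <-> P e'.
Proof.
  intros D e e' H; destruct (Def_pure Delta0P n P D) as [a [Da Ha]], (I_tot emp) as [b Hb].
  rewrite <- (Ha e (fun _ => emp)), <- (Ha e' (fun _ => b)); apply I_sat; [exact Da|].
  clear -H Hb; revert e e' H; induction n as [|n IH]; intros e e' H k; [exact Hb|].
  destruct H as [H1 H2], k as [|k]; [exact H2|apply IH, H1].
Qed.

Lemma seg_sub x y : seg y -> sub x y -> seg x.
Proof. intros [a H] S; exact (I_sub a y x H S). Qed.

(** The singleton of [x] is a subset of [y], so it has a preimage; that preimage is nonempty, and
    its element is sent to [x]. *)
Lemma seg_tr x y : seg y -> mem x y -> seg x.
Proof.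
  intros Hy Hx; destruct (seg_sub (sg x) y Hy) as [s Hs].
  { intros z Hz; apply (in_sg HM) in Hz; subst; exact Hx. }
  destruct (proj2 (I_pure 1 (fun e => exists z, mem z (snd e) /\ z = z) ltac:(dsolve) (tt, s) (tt, sg x) (conj Logic.I Hs))) as [z [Hz _]].
  { exists x; split; [apply (in_sg HM)|]; reflexivity. }
  destruct (I_tot z) as [b Hb]; apply (I_mem z b s (sg x) Hb Hs), (in_sg HM) in Hz; subst b; exists z; exact Hb.
Qed.

(** The relation [E] that [f] induces on [o] is a subset of the image of a product, so it has a
    preimage [E0], again well-founded. The collapse of [E0] is carried over by [I] and agrees with
    [f] by uniqueness of the collapse. *)
Lemma seg_surj f o t : seg o -> trans t -> Surj f o t -> forall y, mem y t -> seg y.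
Proof.
  intros [o0 Io] Tt Sf0; destruct (Surj_tight HM f o t Sf0) as [f1 [_ [Sf Rf]]].
  set (EE := fun u v => exists u1 y, rel f1 u1 y /\ exists v1 z, rel f1 v1 z /\ ((u1 = u /\ v1 = v) /\ mem y z)).
  destruct (mkrel HM EE o o) as [E [SE HE]]; [unfold EE; dsolve|].
  assert (SegE : seg E).
  { destruct (I_tot (prod o0 o0)) as [p Hp]; apply (seg_sub E p); [exists (prod o0 o0); exact Hp|].
    set (P := fun e : ctx N 2 => forall u, mem u (snd (fst e)) -> forall y, mem y (snd (fst e)) -> exists z, mem z (snd e) /\ isop z u y).
    assert (HP : P (tt, o, p)).
    { apply (I_pure 2 P ltac:(unfold P; dsolve) (tt, o0, prod o0 o0)); [repeat split; assumption|].
      intros u Hu y Hy; cbn in *; exists (op u y); split; [apply (op_in_prod HM); auto|apply (isop_op HM); reflexivity]. }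
    intros z Hz; apply SE, (mem_prod HM) in Hz as [u [Hu [y [Hy Ho]]]].
    destruct (HP u Hu y Hy) as [z' [Hz' Ho']]; apply (isop_op HM) in Ho, Ho'; cbn in Hz'; congruence. }
  assert (W : wf o E).
  { intros s Ss [u0 Hu0].
    destruct (classic (exists u y, mem u s /\ rel f1 u y)) as [[u1 [y1 [Hu1 Ry1]]]|F].
    - destruct (sep HM (fun y => exists u y', rel f1 u y' /\ (mem u s /\ y' = y)) t) as [Y HY]; [dsolve|].
      destruct (found HM Y) as [y [Hy Hmin]].
      { exists y1; apply HY; split; [apply (Rf u1 y1 Ry1)|]; exists u1, y1; auto. }
      apply HY in Hy as [Hyt [u [y' [Ru [Hu ->]]]]]; exists u; split; [exact Hu|]; intros z Hz R.
      apply HE in R as [_ [_ [z1 [a [Ra [v1 [b [Rb [[-> ->] Hab]]]]]]]]].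
      rewrite (proj1 Sf u b y Rb Ru) in Hab; apply (Hmin a Hab), HY.
      split; [apply (Rf z a Ra)|]; exists z, a; auto.
    - exists u0; split; [exact Hu0|]; intros z Hz R; apply HE in R as [_ [_ [z1 [a [Ra [v1 [b [_ [[-> _] _]]]]]]]]].
      apply F; exists z, a; auto. }
  destruct SegE as [E0 IE].
  assert (rl : forall f g u v y z, I f g -> I u v -> I y z -> (rel f u y <-> rel g v z)).
  { intros f' g u v y z H1 H2 H3.
    apply (I_pure 3 (fun e => rel (snd (fst (fst e))) (snd (fst e)) (snd e)) ltac:(dsolve) (tt, f', u, y) (tt, g, v, z)).
    repeat split; assumption. }
  assert (W0 : wf o0 E0).
  { intros s0 Ss0 [u0 Hu0]; destruct (I_tot s0) as [s Is], (I_tot u0) as [u Iu].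
    destruct (W s) as [m [Hm Hmin]].
    - apply (I_pure 2 (fun e => sub (snd (fst e)) (snd e)) ltac:(dsolve) (tt, s0, o0) (tt, s, o)); [repeat split; assumption|exact Ss0].
    - exists u; apply (I_mem u0 u s0 s Iu Is), Hu0.
    - destruct (seg_tr m s (ex_intro _ s0 Is) Hm) as [m0 Im]; exists m0; split; [apply (I_mem m0 m s0 s Im Is), Hm|].
      intros z0 Hz0 R; destruct (I_tot z0) as [z Iz]; apply (Hmin z).
      + apply (I_mem z0 z s0 s Iz Is), Hz0.
      + apply (rl E0 E z0 z m0 m IE Iz Im), R. }
  destruct (collapse HM o0 E0 W0) as [f0 [A0 T0]], (I_tot f0) as [h Ih].
  assert (Ah : At o E h).
  { apply (I_pure 3 (fun e => At (snd (fst (fst e))) (snd (fst e)) (snd e)) ltac:(apply Def_At; tsolve) (tt, o0, E0, f0) (tt, o, E, h));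
      [repeat split; assumption|exact A0]. }
  assert (A1 : At o E f1).
  { intros u y Ru; split; [apply (Rf u y Ru)|]; split.
    - intros z Hz; destruct (proj2 Sf z) as [v [Hv Rv]]; [exact (Tt y (proj1 (proj2 (Rf u y Ru))) z Hz)|].
      exists v; split; [exact Hv|]; split; [|exact Rv].
      apply HE; split; [exact Hv|]; split; [apply (Rf u y Ru)|]; exists v, z; split; [exact Rv|]; exists u, y; auto.
    - intros v Hv R; apply HE in R as [_ [_ [v1 [z [Rz [u1 [y1 [Ry [[-> ->] H]]]]]]]]].
      rewrite (proj1 Sf u y1 y Ry Ru) in H; exists z; auto. }
  intros y Hy; destruct (proj2 Sf y Hy) as [u [Hu Ru]].
  destruct (seg_tr u o (ex_intro _ o0 Io) Hu) as [u0 Iu].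
  destruct (T0 u0) as [y0 R0]; [apply (I_mem u0 u o0 o Iu Io), Hu|].
  destruct (I_tot y0) as [y' Iy]; assert (Rh : rel h u y') by (apply (rl f0 h u0 u y0 y' Ih Iu Iy), R0).
  rewrite (At_unique HM o E f1 h W A1 Ah u y y' Ru Rh); exists y0; exact Iy.
Qed.

Lemma seg_trans x : seg x -> exists t, seg t /\ trans t /\ mem x t.
Proof.
  intros [a Ia]; destruct (trans_around HM a) as [t0 [T0 H0]], (I_tot t0) as [t It].
  exists t; split; [exists t0; exact It|]; split.
  - apply (I_pure 1 (fun e => trans (snd e)) ltac:(dsolve) (tt, t0) (tt, t)); [repeat split; exact It|exact T0].
  - apply (I_mem a x t0 t Ia It), H0.
Qed.

Lemma c_below n m : n <= m -> c n = c m \/ mem (c m) (c n).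
Proof.
  intros L; induction L as [|m L IH]; [auto|]; destruct (c_nice m) as [_ [H _]]; right.
  destruct IH as [-> |IH]; [exact H|exact (proj1 (proj1 (c_nice n)) (c m) IH _ H)].
Qed.

(** * A chain of sets closed under powers and transitive images *)

Context (SAT : saturated N).

Definition stepU (u w : N) : Prop := mem u w /\ trans w /\ (forall s, sub s u -> mem s w) /\
  forall t f, trans t -> Surj f u t -> mem t w.

Lemma stepU_ex u : exists w, stepU u w.
Proof.
  destruct (images_set HM u) as [h Hh], (trans_around HM (pr u (pr (pw u) h))) as [w [Tw Hw]].
  assert (Hu : mem u w) by (apply (Tw _ Hw), (in_pr HM); auto).
  assert (H2 : mem (pr (pw u) h) w) by (apply (Tw _ Hw), (in_pr HM); auto).
  exists w; split; [exact Hu|]; split; [exact Tw|]; split.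
  - intros s Hs; apply (Tw (pw u)); [apply (Tw _ H2), (in_pr HM); auto|apply (in_pw HM), Hs].
  - intros t f Tt Sf; apply (Tw h); [apply (Tw _ H2), (in_pr HM); auto|exact (Hh t f Tt Sf)].
Qed.

Lemma chain_ex K : forall u, exists q, forall k (v : nat -> N), k <= K -> sat N (op u q .: v) (ChainF k).
Proof.
  induction K as [|K IH]; intros u.
  - exists emp; intros k v Hk; replace k with 0 by lia; cbn; tauto.
  - destruct (stepU_ex u) as [w Hw], (IH w) as [q Hq]; exists (op w q); intros [|k] v Hk; [cbn; tauto|].
    exists u, (op w q); split; [exact (proj2 (isop_op HM _ _ _) eq_refl)|]; split.
    + exists w, q; split; [exact (proj2 (isop_op HM _ _ _) eq_refl)|exact Hw].
    + apply Hq; lia.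
Qed.

Definition chainU p : Prop := forall k (v : nat -> N), sat N (p .: v) (ChainF k).

Lemma chainU_step p : chainU p -> exists p', chainU p' /\ exists u w q, isop p u p' /\ isop p' w q /\ stepU u w.
Proof.
  intros H; destruct (H 1 (fun _ => emp)) as [u [p' [Hp [[w [q [Hq Hs]]] _]]]].
  change (isop p u p') in Hp; change (isop p' w q) in Hq.
  exists p'; split; [|exists u, w, q; auto].
  intros k v; destruct (H (S k) v) as [u1 [p1 [H1 [_ H2]]]]; change (isop p u1 p1) in H1.
  apply (isop_op HM) in Hp, H1; rewrite Hp in H1; apply (op_inj HM) in H1 as [<- <-].
  apply (sat_closed N (ChainF k) 1 _ (p' .: v)) in H2; [exact H2| |intros [|i] Hi; [reflexivity|lia]].
  clear; induction k as [|k IH]; [cbn; auto|].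
  cbn [ChainF]; cbn; repeat split; try lia; apply (closed_at_mono _ 1); auto; lia.
Qed.

(** [P n] is the [n]-th tail of the realised code and [U n] its head. The tails are kept because
    each is definable from [P 0], so that a map fixing [P 0] fixes every link. *)
Lemma chain_seq h : exists P U : nat -> N, mem h (U 0) /\ trans (U 0) /\
  (forall n, isop (P n) (U n) (P (S n))) /\ forall n, stepU (U n) (U (S n)).
Proof.
  destruct (SAT [1] (fun _ => h)) as [p Hp].
  - intros K; destruct (trans_around HM h) as [u [Tu Hu]], (chain_ex K u) as [q Hq].
    exists (op u q); intros [|k] Hk.
    + exists u, q; split; [exact (proj2 (isop_op HM _ _ _) eq_refl)|split; assumption].
    + apply Hq; lia.
  - assert (C0 : chainU p).
    { intros k v; apply (sat_closed N (ChainF k) 1 (p .: fun _ => h) (p .: v)); [|intros [|i] Hi; [reflexivity|lia]|exact (Hp (S k))].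
      clear; induction k as [|k IH]; [cbn; auto|].
      cbn [ChainF]; cbn; repeat split; try lia; apply (closed_at_mono _ 1); auto; lia. }
    destruct (sequence_of_steps chainU (fun _ p p' => exists u w q, isop p u p' /\ isop p' w q /\ stepU u w) p C0) as [P [P0 HP]].
    { intros _ s Hs; apply chainU_step, Hs. }
    assert (HU : forall n, exists u, isop (P n) u (P (S n))).
    { intros n; destruct (HP n) as [_ [u [w [q [H _]]]]]; eauto. }
    exists P, (fun n => pick (HU n)).
    destruct (Hp 0) as [u [q [H1 [H2 H3]]]]; change (isop p u q) in H1.
    assert (E0 : pick (HU 0) = u).
    { pose proof (pick_spec (HU 0)) as H; apply (isop_op HM) in H, H1; rewrite <- P0 in H1.
      pose proof (eq_trans (eq_sym H) H1) as H'; apply (op_inj HM) in H' as [E _]; exact E. }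
    split; [rewrite E0; exact H2|]; split; [rewrite E0; exact H3|]; split; [intros n; exact (pick_spec (HU n))|].
    intros n; destruct (HP n) as [_ [u1 [w [q1 [H4 [H5 H6]]]]]].
    pose proof (pick_spec (HU n)) as H; pose proof (pick_spec (HU (S n))) as H'.
    apply (isop_op HM) in H, H', H4, H5.
    pose proof (eq_trans (eq_sym H) H4) as E1; pose proof (eq_trans (eq_sym H') H5) as E2.
    apply (op_inj HM) in E1 as [-> _]; apply (op_inj HM) in E2 as [-> _]; exact H6.
Qed.

Context (P U : nat -> N) (U0_trans : trans (U 0)) (PU : forall n, isop (P n) (U n) (P (S n)))
  (US : forall n, stepU (U n) (U (S n))).
Context (i : N) (Hi : inductive i) (U0_i : mem i (U 0)) (U0_c : mem (c 0) (U 0)).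

Definition KU x : Prop := exists n, mem x (U n).

Lemma U_trans n : trans (U n).
Proof. destruct n; [exact U0_trans|apply (US n)]. Qed.

Lemma U_mono n m x : n <= m -> mem x (U n) -> mem x (U m).
Proof. intros L; induction L as [|m L IH]; [auto|]; intros Hx; exact (U_trans (S m) (U m) (proj1 (US m)) x (IH Hx)). Qed.

Lemma KU_sub n x : sub x (U n) -> KU x.
Proof. intros H; exists (S n); exact (proj1 (proj2 (proj2 (US n))) x H). Qed.

Lemma KU_kclass : kclass HM KU.
Proof.
  split.
  - intros x y [n Hy] Hx; exists n; exact (U_trans n y Hy x Hx).
  - intros x y [n Hx] [m Hy]; apply (KU_sub (n + m)); intros z Hz; apply (in_pr HM) in Hz as [-> | ->];
      [apply (U_mono n)|apply (U_mono m)]; auto; lia.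
  - intros x [n Hx]; apply (KU_sub n); intros z Hz; apply (in_un HM) in Hz as [w [Hw Hz]].
    exact (U_trans n w (U_trans n x Hx w Hw) z Hz).
  - intros x [n Hx]; apply (KU_sub (S n)); intros z Hz; apply (in_pw HM) in Hz; apply (proj1 (proj2 (proj2 (US n))) z); red.
    intros w Hw; exact (U_trans n x Hx w (Hz w Hw)).
  - intros x f d [n Hx] Td Sf; exists (S n); apply (proj2 (proj2 (proj2 (US n))) d f Td).
    exact (Surj_mono f x (U n) d (U_trans n x Hx) Sf).
  - exists i; split; [exists 0; exact U0_i|exact Hi].
  - intros s [n Hs]; exists (U (S n)); split; [exists (S (S n)); exact (proj1 (US (S n)))|].
    intros t f Tt Sf; apply (proj2 (proj2 (proj2 (US n))) t f Tt).
    exact (Surj_mono f s (U n) t (U_trans n s Hs) Sf).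
  - intros x [n Hx]; exists (U n); split; [exists (S n); exact (proj1 (US n))|]; split; [apply U_trans|exact Hx].
Qed.

Lemma KU_c n : KU (c n).
Proof.
  exists 0; destruct (c_below 0 n) as [<-|H]; [lia|exact U0_c|exact (U0_trans (c 0) U0_c _ H)].
Qed.

Lemma KU_seg x : seg x -> KU x.
Proof. intros [a Ha]; exists 0; exact (U0_trans (c 0) U0_c x (I_c a x 0 Ha)). Qed.

(** * An automorphism moving everything above the segment *)

Context (W : N) (TW : trans W) (PW : mem (P 0) W).

Lemma PU_W n : mem (P n) W /\ mem (U n) W.
Proof.
  assert (H : forall n, mem (P n) W -> mem (P (S n)) W /\ mem (U n) W).
  { intros m Hm; pose proof (PU m) as H; apply (isop_op HM) in H; rewrite H in Hm.
    assert (H1 : mem (pr (U m) (P (S m))) W) by (apply (TW _ Hm), (in_pr HM); auto).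
    split; apply (TW _ H1), (in_pr HM); auto. }
  assert (HP : forall m, mem (P m) W) by (induction m as [|m IH]; [exact PW|apply H, IH]).
  split; [apply HP|apply H, HP].
Qed.

Lemma KU_W x : KU x -> mem x W.
Proof. intros [n Hx]; exact (TW (U n) (proj2 (PU_W n)) x Hx). Qed.

Definition inW x : Prop := mem x W.
Local Notation satW := (satR N inW).

Lemma inW_tr x y : inW y -> mem x y -> inW x.
Proof. intros Hy Hx; exact (TW y Hy x Hx). Qed.

(** Agreement is measured in [W], where truth is definable. One parameter from [c m] is enough,
    since [c m] is closed under pairs. *)
Definition same (m : nat) (va vb : nat -> N) : Prop :=
  forall a z, mem z (c m) -> satW (z .: va) a <-> satW (z .: vb) a.

Definition pre (l : list N) (v : nat -> N) : nat -> N := fold_right scons v l.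

Lemma pre_nth l v k d : k < length l -> pre l v k = nth k l d.
Proof. revert k; induction l as [|x l IH]; intros [|k] Hk; cbn in *; try lia; auto; apply IH; lia. Qed.

Lemma pre_tail l v k : pre l v (length l + k) = v k.
Proof. induction l; cbn; auto. Qed.

Lemma c_W m x : mem x (c m) -> inW x.
Proof. intros Hx; exact (TW (c m) (KU_W _ (KU_c m)) x Hx). Qed.

Lemma same_list m va vb : same m va vb -> (forall k, inW (va k)) -> (forall k, inW (vb k)) ->
  forall l, l <> [] -> (forall x, In x l -> mem x (c m)) -> forall a, satW (pre l va) a <-> satW (pre l vb) a.
Proof.
  intros H Ha Hb.
  assert (G : forall n l z, length l = n -> (forall x, In x (z :: l) -> mem x (c m)) ->
    forall a, satW (z .: pre l va) a <-> satW (z .: pre l vb) a).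
  { induction n as [|n IH]; intros [|y l] z El Hl a; try discriminate El.
    - apply H, Hl; cbn; auto.
    - set (b := Ex (Ex (And (IsOPair 2 1 0) (ren (1 .: 0 .: fun i => 3 + i) a)))).
      assert (Hz : mem z (c m)) by (apply Hl; cbn; auto).
      assert (Hy : mem y (c m)) by (apply Hl; cbn; auto).
      assert (Hop : mem (op z y) (c m)) by (apply pclosed_op; auto; apply c_nice).
      assert (E : forall v, satW (op z y .: pre l v) b <-> satW (z .: y .: pre l v) a).
      { intros v; split.
        - intros [z' [Wz [y' [Wy [Ho Sa]]]]].
          apply (proj1 (satR_isop inW inW_tr (y' .: z' .: op z y .: pre l v) 2 1 0 (c_W m _ Hop) Wz Wy)) in Ho.
          cbn in Ho; apply (isop_op HM), (op_inj HM) in Ho as [-> ->].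
          rewrite satR_ren, !scons_map in Sa; exact Sa.
        - intros Sa; exists z; split; [exact (c_W m z Hz)|]; exists y; split; [exact (c_W m y Hy)|]; split.
          + apply (proj2 (satR_isop inW inW_tr (y .: z .: op z y .: pre l v) 2 1 0 (c_W m _ Hop) (c_W m z Hz) (c_W m y Hy))).
            exact (proj2 (isop_op HM _ _ _) eq_refl).
          + rewrite satR_ren, !scons_map; exact Sa. }
      change (satW (z .: y .: pre l va) a <-> satW (z .: y .: pre l vb) a).
      rewrite <- (E va), <- (E vb); apply IH; [cbn in El; lia|].
      intros x [<-|Hx]; [exact Hop|apply Hl; cbn; auto]. }
  intros [|z l] Ne Hl; [destruct Ne; reflexivity|exact (G (length l) l z eq_refl Hl)].
Qed.

(** Imitating [x] for [K] formulae over [c (S m)] means matching [K] traces, subsets of [c (S m)].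
    These are elements of [c m], so the existence of a match is a statement covered by [same m]; one
    level is spent. *)
Lemma forth_J n m va vb x : capd n va -> capd n vb -> (forall k, inW (va k)) -> (forall k, inW (vb k)) ->
  same m va vb -> inW x -> exists y, inW y /\ same (S m) (x .: va) (y .: vb).
Proof.
  intros Ca Cb Wa Wb H Wx; set (d := c (S m)).
  set (u := fun y => y .: W .: d .: x .: il va vb).
  assert (E : forall y k, sat N (u y) (tyJ n (S k)) <->
    forall z, mem z d -> satW (z .: x .: va) (form_enum k) <-> satW (z .: y .: vb) (form_enum k)).
  { intros y k.
    assert (EA : forall z, sat N (z .: u y) (relf 2 (ren (0 .: 4 .: fun i => 5 + 2 * Nat.min i n) (form_enum k))) <-> satW (z .: x .: va) (form_enum k)).
    { intros z; rewrite sat_relf, satR_ren.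
      replace (fun k => (z .: u y) ((0 .: 4 .: fun i => 5 + 2 * Nat.min i n) k)) with (z .: x .: va); [reflexivity|].
      extensionality j; destruct j as [|[|j]]; [reflexivity|reflexivity|].
      change (va j = il va vb (2 * Nat.min j n)); rewrite il_even; apply Ca. }
    assert (EB : forall z, sat N (z .: u y) (relf 2 (ren (0 .: 1 .: fun i => 6 + 2 * Nat.min i n) (form_enum k))) <-> satW (z .: y .: vb) (form_enum k)).
    { intros z; rewrite sat_relf, satR_ren.
      replace (fun k => (z .: u y) ((0 .: 1 .: fun i => 6 + 2 * Nat.min i n) k)) with (z .: y .: vb); [reflexivity|].
      extensionality j; destruct j as [|[|j]]; [reflexivity|reflexivity|].
      change (vb j = il va vb (S (2 * Nat.min j n))); rewrite il_odd; apply Cb. }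
    cbn [tyJ AllIn Iff sat]; split; intros F z Hz; specialize (F z Hz).
    - rewrite EA, EB in F; exact F.
    - rewrite EA, EB; exact F. }
  destruct (SAT [2; n] (W .: d .: x .: il va vb)) as [y Hy].
  - intros K.
    assert (sx : forall k, exists s, forall z, mem z s <-> mem z d /\ satW (z .: x .: va) (form_enum k)).
    { intros k; apply (sep HM (fun z => satW (z .: x .: va) (form_enum k)) d); apply Def_satR2; tsolve. }
    set (sk := fun k => pick (sx k)); assert (Hsk := fun k => pick_spec (sx k) : forall z, mem z (sk k) <-> _).
    set (l := d :: map sk (seq 0 K)).
    (* Variable 0 is a point of [d], 1 the element sought, 2 is [d], 3 to [2 + K] are the traces,
       and the old tuple starts at [3 + K]. *)
    set (chi := Ex (All (Imp (Mem 0 2) (bigand (map (fun k => Iff (ren (0 .: 1 .: fun i => 3 + K + i) (form_enum k)) (Mem 0 (3 + k))) (seq 0 K)))))).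
    assert (Echi : forall v, satW (pre l v) chi <-> exists y, inW y /\ forall z, inW z -> mem z d ->
       forall k, k < K -> (satW (z .: y .: v) (form_enum k) <-> mem z (sk k))).
    { intros v.
      assert (Ek : forall z y k, k < K -> satW (z .: y .: pre l v) (Iff (ren (0 .: 1 .: fun i => 3 + K + i) (form_enum k)) (Mem 0 (3 + k))) <->
         (satW (z .: y .: v) (form_enum k) <-> mem z (sk k))).
      { intros z y k Hk.
        assert (E1 : satW (z .: y .: pre l v) (ren (0 .: 1 .: fun i => 3 + K + i) (form_enum k)) <-> satW (z .: y .: v) (form_enum k)).
        { rewrite satR_ren.
          replace (fun j => (z .: y .: pre l v) ((0 .: 1 .: fun i => 3 + K + i) j)) with (z .: y .: v); [reflexivity|].
          extensionality j; destruct j as [|[|j]]; [reflexivity|reflexivity|].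
          change (v j = pre l v (S K + j)); rewrite <- (pre_tail l v j) at 1; f_equal; f_equal.
          unfold l; cbn; rewrite length_map, length_seq; reflexivity. }
        assert (E2 : satW (z .: y .: pre l v) (Mem 0 (3 + k)) <-> mem z (sk k)).
        { change (mem z (pre l v (S k)) <-> mem z (sk k)).
          rewrite (pre_nth l v (S k) emp) by (unfold l; cbn; rewrite length_map, length_seq; lia).
          unfold l; cbn [nth]; rewrite (nth_indep _ emp (sk 0)) by (rewrite length_map, length_seq; lia).
          rewrite map_nth, seq_nth by lia; tauto. }
        cbn [Iff satR]; rewrite E1; split; (intros [F1 F2]; split; [intros F; apply E2, F1, F|intros F; apply F2, E2, F]). }
      unfold chi; cbn [satR]; split.
      - intros [y [Wy F]]; exists y; split; [exact Wy|]; intros z Wz Hz k Hk; apply Ek; [exact Hk|].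
        specialize (F z Wz Hz); rewrite satR_bigand in F; apply F; apply in_map_iff; exists k; split; [reflexivity|apply in_seq; lia].
      - intros [y [Wy F]]; exists y; split; [exact Wy|]; intros z Wz Hz; apply satR_bigand; intros a Ha.
        apply in_map_iff in Ha as [k [<- Hk]]; apply in_seq in Hk; apply Ek; [lia|apply F; auto; lia]. }
    assert (T : satW (pre l va) chi).
    { apply Echi; exists x; split; [exact Wx|]; intros z _ Hz k _; rewrite (Hsk k); tauto. }
    apply (same_list m va vb H Wa Wb l) in T; [|discriminate|].
    + apply Echi in T as [y [Wy F]]; exists y; intros [|k] Hk; [exact Wy|].
      apply E; intros z Hz; rewrite (F z (c_W (S m) z Hz) Hz k) by lia; rewrite (Hsk k); tauto.
    + destruct (c_nice m) as [_ [B1 B2]]; intros z [<-|Hz]; [exact B1|].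
      apply in_map_iff in Hz as [k [<- _]]; apply B2; intros z Hz; apply (Hsk k) in Hz; tauto.
  - exists y; split; [exact (Hy 0)|]; intros a z Hz; destruct (form_enum_surj a) as [k <-].
    apply (proj1 (E y k) (Hy (S k)) z Hz).
Qed.

(** Pairwise distinct labels lying in every bound, used to keep the formulae apart inside one
    code. *)
Fixpoint num (k : nat) : N := match k with 0 => emp | S k => sg (num k) end.

Lemma sg_inj x y : sg x = sg y -> x = y.
Proof. intros E; apply (in_sg HM); rewrite <- E; apply (in_sg HM); reflexivity. Qed.

Lemma num_inj k : forall l, num k = num l -> k = l.
Proof.
  induction k as [|k IH]; intros [|l] E; cbn in E; auto.
  - symmetry in E; destruct (sg_emp HM _ E).
  - destruct (sg_emp HM _ E).
  - f_equal; apply IH, sg_inj, E.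
Qed.

(* Cantor: the power set of the power set of [c m] has more elements than there are finite
   approximations to types over [c m]. *)
Lemma indiscernible_pair n m va : capd n va -> (forall k, inW (va k)) ->
  exists x y, x <> y /\ mem x (pw (pw (c m))) /\ mem y (pw (pw (c m))) /\
    forall a z, mem z (c m) -> satW (z .: x .: va) a <-> satW (z .: y .: va) a.
Proof.
  intros Ca Wa; set (d := c m); set (Q := pw (pw d)).
  destruct (c_nice m) as [[Td Pd] _]; fold d in Td, Pd.
  assert (numd : forall k, mem (num k) d).
  { destruct (I_tot emp) as [b Ib]; assert (Hb : mem b d) by exact (I_c emp b m Ib).
    induction k as [|k IH]; [exact (e0_t HM d Td b Hb)|exact (pclosed_pr HM d _ _ Pd IH IH)]. }
  set (u := fun p => p .: W .: d .: Q .: va).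
  assert (E : forall p k, sat N (u p) (tyD n (S k)) <-> exists x y, isop p x y /\
    forall z, mem z d -> satW (z .: x .: va) (form_enum k) <-> satW (z .: y .: va) (form_enum k)).
  { intros p k.
    assert (EA : forall z x y, sat N (z .: y .: x .: u p) (relf 4 (ren (0 .: 2 .: fun i => 7 + Nat.min i n) (form_enum k))) <-> satW (z .: x .: va) (form_enum k)).
    { intros z x y; rewrite sat_relf, satR_ren.
      replace (fun k => (z .: y .: x .: u p) ((0 .: 2 .: fun i => 7 + Nat.min i n) k)) with (z .: x .: va); [reflexivity|].
      extensionality j; destruct j as [|[|j]]; [reflexivity|reflexivity|exact (Ca j)]. }
    assert (EB : forall z x y, sat N (z .: y .: x .: u p) (relf 4 (ren (0 .: 1 .: fun i => 7 + Nat.min i n) (form_enum k))) <-> satW (z .: y .: va) (form_enum k)).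
    { intros z x y; rewrite sat_relf, satR_ren.
      replace (fun k => (z .: y .: x .: u p) ((0 .: 1 .: fun i => 7 + Nat.min i n) k)) with (z .: y .: va); [reflexivity|].
      extensionality j; destruct j as [|[|j]]; [reflexivity|reflexivity|exact (Ca j)]. }
    cbn [tyD AllIn Iff sat]; split; intros [x [y [Ho F]]]; exists x, y; (split; [exact Ho|]); intros z Hz; specialize (F z Hz).
    - rewrite EA, EB in F; exact F.
    - rewrite EA, EB; exact F. }
  destruct (SAT [3; n] (W .: d .: Q .: va)) as [p Hp].
  - intros K.
    enough (F : exists x y, x <> y /\ mem x Q /\ mem y Q /\ forall k, k < K -> forall z, mem z d ->
      satW (z .: x .: va) (form_enum k) <-> satW (z .: y .: va) (form_enum k)).
    { destruct F as [x [y [Ne [Qx [Qy F]]]]]; exists (op x y); intros [|k] Hk.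
      - exists x, y; split; [exact (proj2 (isop_op HM _ _ _) eq_refl)|]; split; [exact Ne|split; assumption].
      - apply E; exists x, y; split; [apply (isop_op HM); reflexivity|]; apply F; lia. }
    apply NNPP; intros NE.
    (* All truth values at [a] of the first [K] formulae are packed into one subset of [d], formula
       [k] carrying the label [num k]. *)
    set (cd := fun a w => exists k, k < K /\ exists z, mem z d /\ (isop w (num k) z /\ satW (z .: a .: va) (form_enum k))).
    set (H := fun a y => forall w, mem w d -> (mem w y <-> cd a w)).
    assert (Dcd : forall j (a w : ctx N j -> N), term full j a -> term full j w -> D0 j (fun e => cd (a e) (w e))).
    { intros j a w Ta Tw; unfold cd; apply (Def_fin_ex j (fun k e => exists z, mem z d /\ (isop (w e) (num k) z /\ satW (z .: a e .: va) (form_enum k))) K a Ta).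
      intros k; dsolve; apply Def_satR2; tsolve. }
    assert (cdE : forall a k z, k < K -> mem z d -> cd a (op (num k) z) <-> satW (z .: a .: va) (form_enum k)).
    { intros a k z Hk Hz; split.
      - intros [k' [_ [z' [_ [Ho S]]]]]; apply (isop_op HM), (op_inj HM) in Ho as [Ek ->].
        apply num_inj in Ek; subst; exact S.
      - intros S; exists k; split; [exact Hk|]; exists z; split; [exact Hz|]; split; [apply (isop_op HM); reflexivity|exact S]. }
    assert (Hinj : forall a b y, mem a Q -> mem b Q -> H a y -> H b y -> a = b).
    { intros a b y Qa Qb Ha Hb; apply NNPP; intros Nab; apply NE; exists a, b; split; [exact Nab|]; split; [exact Qa|].
      split; [exact Qb|]; intros k Hk z Hz; rewrite <- (cdE a k z Hk Hz), <- (cdE b k z Hk Hz).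
      assert (Hw : mem (op (num k) z) d) by (apply pclosed_op; auto).
      rewrite <- (Ha _ Hw), <- (Hb _ Hw); tauto. }
    (* If these codes separate the elements of [Q], the set [D] of codes not belonging to what they
       code is itself in [Q], and its own code gives a contradiction. *)
    destruct (sep HM (fun y => exists a, mem a Q /\ (H a y /\ ~ mem y a)) (pw d)) as [D HD].
    { unfold H; dsolve; apply Dcd; tsolve. }
    assert (QD : mem D Q) by (apply (in_pw HM); intros y Hy; apply HD in Hy; tauto).
    destruct (sep HM (fun w => cd D w) d) as [y0 Hy0]; [apply Dcd; tsolve|].
    assert (H0 : H D y0) by (intros w Hw; rewrite Hy0; tauto).
    assert (Py0 : mem y0 (pw d)) by (apply (in_pw HM); intros w Hw; apply Hy0 in Hw; tauto).
    assert (N0 : ~ mem y0 D).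
    { intros F; assert (F' := F); apply HD in F' as [_ [a [Qa [Ha Na]]]].
      rewrite (Hinj a D y0 Qa QD Ha H0) in Na; exact (Na F). }
    apply N0, HD; split; [exact Py0|]; exists D; auto.
  - destruct (Hp 0) as [x [y [Ho [Ne [Qx Qy]]]]]; change (isop p x y) in Ho.
    exists x, y; split; [exact Ne|]; split; [exact Qx|]; split; [exact Qy|].
    intros a z Hz; destruct (form_enum_surj a) as [k <-].
    destruct (proj1 (E p k) (Hp (S k))) as [x' [y' [Ho' F]]].
    apply (isop_op HM) in Ho, Ho'; rewrite Ho in Ho'; apply (op_inj HM) in Ho' as [<- <-].
    exact (F z Hz).
Qed.

(** Two indiscernible elements cannot both equal the partner [y], and either may be matched with
    it. *)
Lemma move_J n m va vb : capd n va -> capd n vb -> (forall k, inW (va k)) -> (forall k, inW (vb k)) ->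
  same m va vb -> exists x y, inW x /\ inW y /\ x <> y /\ mem x (pw (pw (c (S m)))) /\ same (S m) (x .: va) (y .: vb).
Proof.
  intros Ca Cb Wa Wb H; destruct (indiscernible_pair n (S m) va Ca Wa) as [x1 [x2 [Ne [Q1 [Q2 F]]]]].
  assert (QW : forall x, mem x (pw (pw (c (S m)))) -> inW x).
  { intros x Hx; apply KU_W, (k_tr HM KU KU_kclass x _ ) with (2 := Hx).
    do 2 apply (k_pw HM KU KU_kclass); apply KU_c. }
  destruct (forth_J n m va vb x1 Ca Cb Wa Wb H (QW x1 Q1)) as [y [Wy S]].
  destruct (classic (x1 = y)) as [<-|Ny].
  - exists x2, x1; split; [exact (QW x2 Q2)|]; split; [exact Wy|]; split; [auto|]; split; [exact Q2|].
    intros a z Hz; rewrite <- (F a z Hz); apply S, Hz.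
  - exists x1, y; split; [exact (QW x1 Q1)|]; auto.
Qed.

Context (e : nat -> N) (e_surj : forall x, exists n, e n = x).

Record jst : Type := JSt { ja : nat -> N; jb : nat -> N; jn : nat; jm : nat }.

Definition jgood (s : jst) : Prop := (capd (jn s) (ja s) /\ capd (jn s) (jb s)) /\
  ((forall k, inW (ja s k)) /\ (forall k, inW (jb s k))) /\ same (jm s) (ja s) (jb s).

Definition jext (s s' : jst) : Prop :=
  (forall k, exists k', ja s' k' = ja s k /\ jb s' k' = jb s k) /\ jm s <= jm s'.

(** Besides totality on both sides, every stage moves an element of the double power set of a late
    bound; this will show that no bound is fixed pointwise. *)
Definition jstep (t : nat) (s s' : jst) : Prop := jext s s' /\ S (jm s) <= jm s' /\
  (inW (e t) -> (exists k, ja s' k = e t) /\ exists k, jb s' k = e t) /\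
  exists k m, jm s <= m /\ ja s' k <> jb s' k /\ mem (ja s' k) (pw (pw (c m))).

Lemma jgood_cons s x y : jgood s -> inW x -> inW y -> same (S (jm s)) (x .: ja s) (y .: jb s) ->
  let s' := JSt (x .: ja s) (y .: jb s) (S (jn s)) (S (jm s)) in jgood s' /\ jext s s'.
Proof.
  intros [[C1 C2] [[W1 W2] S1]] Wx Wy H; split.
  - split; [split; apply capd_S; assumption|]; split; [split; intros [|k]; cbn; auto|exact H].
  - split; [intros k; exists (S k); split; reflexivity|cbn; lia].
Qed.

Lemma same_sym m va vb : same m va vb -> same m vb va.
Proof. intros H a z Hz; symmetry; apply H, Hz. Qed.

Lemma jext_trans s s' s'' : jext s s' -> jext s' s'' -> jext s s''.
Proof.
  intros [A1 A2] [B1 B2]; split; [|lia].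
  intros k; destruct (A1 k) as [k' [E1 E2]], (B1 k') as [k'' [E3 E4]]; exists k''; split; congruence.
Qed.

Lemma jstep_ex t s : jgood s -> exists s', jgood s' /\ jstep t s s'.
Proof.
  intros G.
  destruct (move_J (jn s) (jm s) (ja s) (jb s)) as [x [y [Wx [Wy [Ne [Qx Sx]]]]]]; try apply G.
  destruct (jgood_cons s x y G Wx Wy Sx) as [G1 X1]; set (s1 := JSt (x .: ja s) (y .: jb s) (S (jn s)) (S (jm s))) in *.
  assert (mv : exists k m, jm s <= m /\ ja s1 k <> jb s1 k /\ mem (ja s1 k) (pw (pw (c m)))).
  { exists 0, (S (jm s)); split; [lia|]; split; [exact Ne|exact Qx]. }
  destruct (classic (inW (e t))) as [We|Nw].
  - destruct (forth_J (jn s1) (jm s1) (ja s1) (jb s1) (e t)) as [y1 [Wy1 S1]]; try apply G1; [exact We|].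
    destruct (jgood_cons s1 (e t) y1 G1 We Wy1 S1) as [G2 X2]; set (s2 := JSt (e t .: ja s1) (y1 .: jb s1) (S (jn s1)) (S (jm s1))) in *.
    destruct (forth_J (jn s2) (jm s2) (jb s2) (ja s2) (e t)) as [x2 [Wx2 S2]]; try apply G2; [apply same_sym, G2|exact We|].
    destruct (jgood_cons s2 x2 (e t) G2 Wx2 We (same_sym _ _ _ S2)) as [G3 X3].
    set (s3 := JSt (x2 .: ja s2) (e t .: jb s2) (S (jn s2)) (S (jm s2))) in *.
    assert (X13 := jext_trans s1 s2 s3 X2 X3).
    exists s3; split; [exact G3|]; split; [exact (jext_trans s s1 s3 X1 X13)|]; split; [cbn; lia|]; split.
    + intros _; split; [exists 1; reflexivity|exists 0; reflexivity].
    + destruct mv as [k [m [Lm [Nk Qk]]]], (proj1 X13 k) as [k' [E1 E2]]; exists k', m; rewrite E1, E2; auto.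
  - exists s1; split; [exact G1|]; split; [exact X1|]; split; [cbn; lia|]; split; [tauto|exact mv].
Qed.

Theorem automorphism_relation : exists J : N -> N -> Prop,
  (forall x, inW x -> (exists y, inW y /\ J x y) /\ exists y, inW y /\ J y x) /\
  (forall x y x' y', J x y -> J x' y' -> (x = x' <-> y = y')) /\
  (forall x y x' y', J x y -> J x' y' -> (mem x x' <-> mem y y')) /\
  (forall x y, J x y -> KU x <-> KU y) /\
  (forall x y, seg x -> J x y -> x = y) /\
  (forall n, exists m x y, n <= m /\ J x y /\ x <> y /\ mem x (pw (pw (c m)))).
Proof.
  set (v0 := fun _ : nat => P 0).
  (* Starting from the constant tuple [P 0] on both sides makes the final map fix [P 0]. *)
  destruct (sequence_of_steps jgood jstep (JSt v0 v0 0 0)) as [F [F0 HF]].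
  { split; [split; intros k; reflexivity|]; split; [split; intros k; exact PW|]; intros a z _; tauto. }
  { apply jstep_ex. }
  assert (G : forall n, jgood (F n)) by (intros n; apply HF).
  assert (mono : forall n m, n <= m -> jext (F n) (F m)).
  { intros n m L; induction L as [|m L IH]; [split; [intros k; exists k; auto|lia]|].
    apply (jext_trans _ (F m)); [exact IH|apply HF]. }
  assert (jmn : forall n, n <= jm (F n)).
  { induction n as [|n IH]; [lia|]; destruct (proj2 (HF n)) as [_ [H _]]; lia. }
  set (J := fun x y => exists n k, ja (F n) k = x /\ jb (F n) k = y).
  assert (two : forall x y x' y', J x y -> J x' y' -> exists n k k',
    (ja (F n) k = x /\ jb (F n) k = y) /\ (ja (F n) k' = x' /\ jb (F n) k' = y')).
  { intros x y x' y' [n [k [E1 E2]]] [n' [k' [E3 E4]]].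
    destruct (proj1 (mono n (n + n') ltac:(lia)) k) as [k1 [E5 E6]], (proj1 (mono n' (n + n') ltac:(lia)) k') as [k2 [E7 E8]].
    exists (n + n'), k1, k2; repeat split; congruence. }
  assert (cne : forall m, exists z, mem z (c m)) by (intros m; destruct (I_tot emp) as [b Ib]; exists b; exact (I_c emp b m Ib)).
  assert (Jform : forall n a, satW (ja (F n)) a <-> satW (jb (F n)) a).
  { intros n a; destruct (cne (jm (F n))) as [z Hz], (G n) as [_ [_ S]].
    pose proof (S (ren Datatypes.S a) z Hz) as H; rewrite !satR_ren in H; exact H. }
  assert (Jeq : forall x y x' y', J x y -> J x' y' -> (x = x' <-> y = y')).
  { intros x y x' y' H H'; destruct (two x y x' y' H H') as [n [k [k' [[<- <-] [<- <-]]]]]; exact (Jform n (Eq k k')). }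
  assert (Jmem : forall x y x' y', J x y -> J x' y' -> (mem x x' <-> mem y y')).
  { intros x y x' y' H H'; destruct (two x y x' y' H H') as [n [k [k' [[<- <-] [<- <-]]]]]; exact (Jform n (Mem k k')). }
  assert (Jtot : forall x, inW x -> (exists y, inW y /\ J x y) /\ exists y, inW y /\ J y x).
  { intros x Wx; destruct (e_surj x) as [t <-], (proj2 (HF t)) as [_ [_ [H _]]], (H Wx) as [[k Hk] [k' Hk']]; split.
    - exists (jb (F (S t)) k); split; [apply (G (S t))|exists (S t), k; auto].
    - exists (ja (F (S t)) k'); split; [apply (G (S t))|exists (S t), k'; auto]. }
  (* Each tail is fixed by induction, and with it both its components; so every link, and hence the
     union of the chain, is preserved. *)
  assert (JP : forall n, J (P n) (P n) /\ J (U n) (U n)).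
  { assert (St : forall n, J (P n) (P n) -> J (P (S n)) (P (S n)) /\ J (U n) (U n)).
    { intros n H; destruct (PU_W n) as [Wp Wu], (PU_W (S n)) as [Wp' _].
      destruct (Jtot (U n) Wu) as [[y [_ Hy]] _], (Jtot (P (S n)) Wp') as [[y' [_ Hy']] _].
      assert (Ho : isop (P n) y y').
      { destruct (two _ _ _ _ H Hy) as [n1 [k1 [k2 [[A1 A2] [A3 A4]]]]].
        destruct Hy' as [n2 [k3 [A5 A6]]].
        destruct (proj1 (mono n1 (n1 + n2) ltac:(lia)) k1) as [i1 [B1 B2]], (proj1 (mono n1 (n1 + n2) ltac:(lia)) k2) as [i2 [B3 B4]],
          (proj1 (mono n2 (n1 + n2) ltac:(lia)) k3) as [i3 [B5 B6]].
        pose proof (Jform (n1 + n2) (IsOPair i1 i2 i3)) as Q.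
        destruct (G (n1 + n2)) as [_ [[Ga Gb] _]].
        rewrite (satR_isop inW inW_tr _ i1 i2 i3 (Ga _) (Ga _) (Ga _)), (satR_isop inW inW_tr _ i1 i2 i3 (Gb _) (Gb _) (Gb _)) in Q.
        rewrite B1, B2, B3, B4, B5, B6, A1, A2, A3, A4, A5, A6 in Q; apply Q, PU. }
      pose proof (PU n) as H0; apply (isop_op HM) in Ho, H0; rewrite H0 in Ho; apply (op_inj HM) in Ho as [<- <-]; auto. }
    assert (JPn : forall n, J (P n) (P n)).
    { induction n as [|n IH]; [exists 0, 0; rewrite F0; auto|apply St, IH]. }
    intros n; split; [apply JPn|apply St, JPn]. }
  exists J; split; [exact Jtot|]; split; [exact Jeq|]; split; [exact Jmem|]; split; [|split].
  - intros x y H; split; intros [n Hn]; exists n; apply (Jmem x y (U n) (U n) H (proj2 (JP n))), Hn.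
  - intros x y [a Ia] [n [k [<- <-]]]; destruct (G n) as [_ [_ S]].
    (* A member of the segment lies in every bound, so it may be used as the parameter; the formula
       equating it with the entry forces the partner to be the same. *)
    apply (S (Eq 0 (Datatypes.S k)) (ja (F n) k)); [exact (I_c a _ _ Ia)|reflexivity].
  - intros n; destruct (proj2 (HF n)) as [_ [_ [_ [k [m [Lm [Nk Qk]]]]]]].
    exists m, (ja (F (S n)) k), (jb (F (S n)) k); split; [pose proof (jmn n); lia|]; split; [exists (S n), k; auto|auto].
Qed.

End Segment.

(** * Transitive substructures *)

Section Substructure.
Context {N : structure} (K : N -> Prop) (tr : forall x y, K y -> mem x y -> K x).
Local Notation M := (substructure N K).
Local Notation v1 := (@proj1_sig _ K).

Lemma sub_isop (z a b : M) : isop z a b <-> isop (v1 z) (v1 a) (v1 b).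
Proof.
  change (sat M (z .: a .: fun _ => b) (IsOPair 0 1 2) <-> isop (v1 z) (v1 a) (v1 b)).
  rewrite sat_substructure.
  exact (satR_isop K tr (fun k => v1 ((z .: a .: fun _ => b) k)) 0 1 2 (proj2_sig z) (proj2_sig a) (proj2_sig b)).
Qed.

Lemma sub_rel (f u y : M) : rel f u y <-> rel (v1 f) (v1 u) (v1 y).
Proof.
  split.
  - intros [z [Hz Ho]]; exists (v1 z); split; [exact Hz|apply sub_isop, Ho].
  - intros [z [Hz Ho]]; exists (exist _ z (tr z _ (proj2_sig f) Hz)); split; [exact Hz|apply sub_isop; exact Ho].
Qed.

Lemma sub_trans (x : M) : trans x <-> trans (v1 x).
Proof.
  split.
  - intros H y Hy z Hz; assert (Ky : K y) by exact (tr y _ (proj2_sig x) Hy).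
    exact (H (exist _ y Ky) Hy (exist _ z (tr z y Ky Hz)) Hz).
  - intros H [y Ky] Hy [z Kz] Hz; exact (H y Hy z Hz).
Qed.

Lemma sub_Surj (f a d : M) : Surj f a d <-> Surj (v1 f) (v1 a) (v1 d).
Proof.
  split; intros [F S]; split.
  - assert (R : forall u y, rel (v1 f) u y -> K u /\ K y).
    { intros u y [z [Hz Ho]]; destruct (isop_bounds z u y Ho) as [p [q [H1 [H2 [H3 H4]]]]].
      assert (Kz : K z) by exact (tr z _ (proj2_sig f) Hz).
      split; [apply (tr u p); [apply (tr p z)|]|apply (tr y q); [apply (tr q z)|]]; assumption. }
    intros u y y' H H'; destruct (R u y H) as [Ku Ky], (R u y' H') as [_ Ky'].
    apply (f_equal v1 (x := exist _ y Ky) (y := exist _ y' Ky')).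
    apply (F (exist _ u Ku)); apply sub_rel; assumption.
  - intros y Hy; destruct (S (exist _ y (tr y _ (proj2_sig d) Hy)) Hy) as [u [Hu R]].
    exists (v1 u); split; [exact Hu|]; apply sub_rel in R; exact R.
  - intros u [y Ky] [y' Ky'] H H'; apply sub_rel in H, H'; pose proof (F _ _ _ H H') as E; cbn in E; subst y'.
    f_equal; apply proof_irrelevance.
  - intros y Hy; destruct (S (v1 y) Hy) as [u [Hu R]].
    exists (exist _ u (tr u _ (proj2_sig a) Hu)); split; [exact Hu|]; apply sub_rel; exact R.
Qed.

Lemma sub_ord (x : M) : ord x -> ord (v1 x).
Proof.
  intros [T L]; split; [apply sub_trans, T|]; intros y Hy z Hz.
  assert (Ky : K y) by exact (tr y _ (proj2_sig x) Hy); assert (Kz : K z) by exact (tr z _ (proj2_sig x) Hz).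
  destruct (L (exist _ y Ky) Hy (exist _ z Kz) Hz) as [H|[H|H]]; [left; exact H| |right; right; exact H].
  right; left; exact (f_equal v1 H).
Qed.

End Substructure.

(** * From (I) to (II): the model, its automorphism and the fixed segment *)

Theorem fixed_segment_model (N : structure) (e : nat -> N) : (forall x, exists n, e n = x) ->
  models N MOST -> (forall a, collection Delta0P a -> forall v : nat -> N, sat N v a) -> saturated N ->
  exists (M : structure) (j : M -> M), models M MOST /\ automorphism M j /\ (exists x, j x <> x) /\
    exists f : N -> Ifix M j, (forall y, exists x, f x = y) /\ (forall x y, f x = f y -> x = y) /\
      forall x y, mem x y <-> mem (f x) (f y).
Proof.
  intros e_surj MN MC SAT; assert (HM := models_most N MN).
  destruct (self_embedding HM e e_surj SAT) as [I [c [I_tot [I_sat [I_sub [I_c [c_nice c_ord]]]]]]].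
  { intros a Da; destruct (closed_at_ex a) as [n Hn]; apply (coll_instance_sat N n a); intros v.
    apply MC; exists n, a; split; [exact Da|]; split; [apply (closed_at_mono _ n); auto|reflexivity]. }
  destruct (m_inf N HM) as [i Hi], (chain_seq HM SAT (pr HM (c 0) i)) as [P [U [U0h [U0t [PU US]]]]].
  assert (U0c : mem (c 0) (U 0)) by (apply (U0t _ U0h), (in_pr HM); auto).
  assert (U0i : mem i (U 0)) by (apply (U0t _ U0h), (in_pr HM); auto).
  destruct (trans_around HM (P 0)) as [W [TW PW]].
  destruct (automorphism_relation HM I c I_tot I_c c_nice SAT P U U0t PU US i Hi U0i U0c W TW PW e e_surj)
    as [J [Jtot [Jeq [Jmem [JK [Jseg Jmv]]]]]].
  assert (KC := KU_kclass HM U U0t US i Hi U0i); assert (tr := k_tr HM _ KC).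
  assert (KW := KU_W HM P U PU W TW PW).
  set (M := substructure N (KU U)).
  assert (MM : models M MOST) by exact (kclass_MOST HM _ KC).
  assert (HMM := models_most M MM).
  assert (jx : forall x : M, exists y : M, J (proj1_sig x) (proj1_sig y)).
  { intros [x Kx]; destruct (proj1 (Jtot x (KW x Kx))) as [y [_ H]].
    exists (exist _ y (proj1 (JK x y H) Kx)); exact H. }
  assert (gx : forall y : M, exists x : M, J (proj1_sig x) (proj1_sig y)).
  { intros [y Ky]; destruct (proj2 (Jtot y (KW y Ky))) as [x [_ H]].
    exists (exist _ x (proj2 (JK x y H) Ky)); exact H. }
  set (j := fun x : M => pick (jx x)); set (g := fun y : M => pick (gx y)).
  assert (Hj : forall x : M, J (proj1_sig x) (proj1_sig (j x))) by (intros x; exact (pick_spec (jx x))).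
  assert (Hg : forall y : M, J (proj1_sig (g y)) (proj1_sig y)) by (intros y; exact (pick_spec (gx y))).
  assert (v1_inj : forall x y : M, proj1_sig x = proj1_sig y -> x = y).
  { intros [x Kx] [y Ky] E; cbn in E; subst y; f_equal; apply proof_irrelevance. }
  assert (Aj : automorphism M j).
  { split.
    - exists g; split; intros x; apply v1_inj.
      + apply (Jeq _ _ _ _ (Hg (j x)) (Hj x)); reflexivity.
      + apply (Jeq _ _ _ _ (Hj (g x)) (Hg x)); reflexivity.
    - intros x y; exact (Jmem _ _ _ _ (Hj x) (Hj y)). }
  assert (Kpp : forall m, KU U (pw HM (pw HM (c m)))).
  { intros m; do 2 apply (k_pw HM _ KC); apply (KU_c c c_nice U U0t U0c). }
  assert (mv : forall n, exists m (x : M), n <= m /\ j x <> x /\ mem (proj1_sig x) (pw HM (pw HM (c m)))).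
  { intros n; destruct (Jmv n) as [m [x [y [L [H [Ne Q]]]]]].
    exists m, (exist _ x (tr x _ (Kpp m) Q)); split; [exact L|]; split; [|exact Q].
    intros E; apply Ne; apply (f_equal (@proj1_sig _ _)) in E; cbn in E.
    transitivity (proj1_sig (j (exist _ x (tr x _ (Kpp m) Q)))); [symmetry; exact E|].
    symmetry; apply (proj1 (Jeq x y x _ H (Hj (exist _ x (tr x _ (Kpp m) Q))))); reflexivity. }
  assert (seg_fix : forall x : M, seg I (proj1_sig x) <-> fixd j x).
  { intros x; split.
    - intros Sx; destruct (seg_trans HM I I_tot I_sat _ Sx) as [t [St [Tt Ht]]].
      assert (Kt : KU U t) by exact (KU_seg I c I_c U U0t U0c t St).
      exists (exist _ t Kt); split; [apply (sub_trans (KU U) tr); exact Tt|]; split; [exact Ht|].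
      intros y Hy; apply v1_inj; symmetry; apply (Jseg _ _) with (2 := Hj y).
      exact (seg_tr HM I I_tot I_sat I_sub _ t St Hy).
    - intros Fx; assert (Fx' := Fx); destruct Fx' as [t [Tt [Hx Ft]]].
      assert (Fixt : fixd j t) by (apply (fixd_sub HMM j Aj); intros z Hz; exists t; auto).
      destruct (ord_enum HMM t) as [o [f [h [Oo [Sf Sh]]]]].
      assert (Fo : fixd j o) by exact (fixd_surj HMM j Aj t h o Fixt (proj1 Oo) Sh).
      (* If [o] is an element of a member of the segment, its transitive image [t] is included in
         the segment. Otherwise [o] maps onto some [c n], which is then fixed pointwise, as are the
         later bounds and their double power sets, against [mv]. *)
      destruct (c_ord (proj1_sig o) (sub_ord (KU U) tr o Oo)) as [[a [b [Iab Hb]]]|[n [f' Sf']]].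
      + apply (seg_surj HM I I_tot I_sat I_sub (proj1_sig f) (proj1_sig o) (proj1_sig t)).
        * apply (seg_tr HM I I_tot I_sat I_sub _ b); [exists a; exact Iab|exact Hb].
        * apply (sub_trans (KU U) tr), Tt.
        * apply (sub_Surj (KU U) tr), Sf.
        * exact Hx.
      + exfalso; assert (Kc : forall m, KU U (c m)) by (intros m; exact (KU_c c c_nice U U0t U0c m)).
        destruct (Surj_tight HM f' _ _ Sf') as [f2 [Pf2 [Sf2 _]]].
        assert (Kf2 : KU U f2).
        { apply (k_sub HM (KU U) KC f2 (prod HM (proj1_sig o) (c n))); [|exact Pf2].
          apply (k_prod HM (KU U) KC); [exact (proj2_sig o)|apply Kc]. }
        assert (Fcn : fixd j (exist _ (c n) (Kc n))).
        { apply (fixd_surj HMM j Aj o (exist _ f2 Kf2)); [exact Fo| |].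
          - apply (sub_trans (KU U) tr), c_nice.
          - apply (sub_Surj (KU U) tr); exact Sf2. }
        destruct (mv n) as [m [y [L [Ny Qy]]]].
        assert (Fcm : forall z : M, mem (proj1_sig z) (c m) -> fixd j z).
        { intros z Hz; apply (fixd_tr j z (exist _ (c n) (Kc n)) Fcn); cbn.
          destruct (c_below c c_nice n m L) as [-> |H]; [exact Hz|].
          exact (proj1 (proj1 (c_nice n)) (c m) H _ Hz). }
        apply Ny, fixd_eq, (fixd_sub HMM j Aj); intros z Hz; apply (fixd_sub HMM j Aj); intros w Hw; apply Fcm.
        apply (in_pw HM) in Qy; pose proof (Qy _ Hz) as Qz; apply (in_pw HM) in Qz; exact (Qz _ Hw). }
  exists M, j; split; [exact MM|]; split; [exact Aj|]; split.
  { destruct (mv 0) as [m [x [_ [Nx _]]]]; exists x; exact Nx. }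
  assert (fx : forall a, exists y : Ifix M j, I a (proj1_sig (proj1_sig y))).
  { intros a; destruct (I_tot a) as [b Hb]; assert (Sb : seg I b) by (exists a; exact Hb).
    assert (Kb : KU U b) by exact (KU_seg I c I_c U U0t U0c b Sb).
    assert (Fb : forall y, in_TC_singleton M y (exist _ b Kb) -> j y = y) by (apply (Ifix_iff HMM), seg_fix; exact Sb).
    exists (exist _ (exist _ b Kb) Fb); exact Hb. }
  assert (v2_inj : forall x y : Ifix M j, proj1_sig (proj1_sig x) = proj1_sig (proj1_sig y) -> x = y).
  { intros [x Fx] [y Fy] E; cbn in E; apply v1_inj in E; subst y; f_equal; apply proof_irrelevance. }
  exists (fun a => pick (fx a)); assert (Hf := fun a => pick_spec (fx a) : I a _); split; [|split].
  - intros [y Fy]; destruct (proj2 (seg_fix y) (proj1 (Ifix_iff HMM j y) Fy)) as [a Ia].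
    exists a; apply v2_inj; apply (I_eq I I_sat _ _ _ _ (Hf a) Ia); reflexivity.
  - intros x y E; apply (I_eq I I_sat _ _ _ _ (Hf x) (Hf y)); rewrite E; reflexivity.
  - intros x y; exact (I_mem I I_sat _ _ _ _ (Hf x) (Hf y)).
Qed.

Theorem theorem5p8 (T : form -> Prop)
  (T_theory : is_theory T) (T_complete : complete T) (T_consistent : consistent T)
  (T_infinity : proves T ax_infinity) :
  proves_all T (theory_union MOST (collection Delta0P))
  <->
  exists (M : structure) (j : M -> M),
    models M MOST /\ automorphism M j /\ (exists x : M, j x <> x) /\
    models (Ifix M j) T.
Proof.
  split.
  - intros HT; destruct types_closed as [g Hg].
    destruct (saturated_model T T_theory T_consistent types g Hg) as [N [e [e_surj [MT SAT]]]].
    assert (MN : models N MOST).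
    { split; [apply MT|]; intros a Ha; apply (models_proves T N a MT), HT; left; exact Ha. }
    destruct (fixed_segment_model N e e_surj MN) as [M [j [MM [Aj [Mv [f [f_surj [f_inj f_mem]]]]]]]].
    { intros a Ha; apply (models_proves T N a MT), HT; right; exact Ha. }
    { exact SAT. }
    exists M, j; split; [exact MM|]; split; [exact Aj|]; split; [exact Mv|].
    split; [constructor; exact (f (e 0))|]; intros a Ta v.
    apply (sat_closed _ a 0 _ (fun k => f (e k))); [exact (T_theory a Ta)|lia|].
    apply (sat_iso N (Ifix M j) f f_surj f_inj f_mem a); apply MT, Ta.
  - intros [M [j [MM [Aj [Mv MT]]]]]; exact (Ifix_theory T M j T_complete T_infinity MM Aj Mv MT).
Qed.
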